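(* Let $\mathcal{A}$ be a finite set, $\mathrm{Des}$ a map with $\mathrm{Des}(T)\subseteq[n-1]$ for $T\in\mathcal{A}$, and $\{\varphi_i\}_{1<i<n}$ a family of involutions on $\mathcal{A}$. Let $\mathcal{G}=(\mathcal{A},\sigma,\Phi)$ be the signed, colored graph of type $(n,n)$ with $\sigma(T)_i=-1$ iff $i\in\mathrm{Des}(T)$, and $\Phi_i=\{\{T,\varphi_i(T)\}: T\in\mathcal{A},\ \varphi_i(T)\ne T\}$. Then $\{\varphi_i\}$ is a dual equivalence for $(\mathcal{A},\mathrm{Des})$ if and only if $\mathcal{G}$ is a dual equivalence graph of type $(n,n)$.
   Context: For $m\ge1$ and $D\subseteq[m-1]$, $Q_D(X)=\sum x_{i_1}\cdots x_{i_m}$ over $i_1\le\dots\le i_m$ with $i_j<i_{j+1}$ for $j\in D$ (fundamental quasisymmetric function of degree $m$); $s_\lambda$ is the Schur function. Dual equivalence. Given $(\mathcal{A},\mathrm{Des})$ and involutions $\varphi_2,\dots,\varphi_{n-1}$, for $1<h\le i<n$ and $T\in\mathcal{A}$ let $[T]_{h,i}$ be the equivalence class of $T$ under the equivalence relation generated by $\varphi_h,\dots,\varphi_i$, and let $\mathrm{Des}_{h,i}(U)=\{d-(h-2): d\in\mathrm{Des}(U)\cap\{h-1,\dots,i\}\}\subseteq[i-h+2]$. The family $\{\varphi_i\}$ is a dual equivalence for $(\mathcal{A},\mathrm{Des})$ if (i) for all $1<h\le i<n$ with $i-h\le3$ and all $T\in\mathcal{A}$ there is a partition $\lambda$ of $i-h+3$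 with $\sum_{U\in[T]_{h,i}}Q_{\mathrm{Des}_{h,i}(U)}(X)=s_\lambda(X)$ (degree $i-h+3$ quasisymmetric functions); and (ii) $\varphi_i\varphi_j=\varphi_j\varphi_i$ whenever $|i-j|\ge3$. A signed, colored graph of type $(n,N)$ is $(V,\sigma,E)$: finite $V$, $\sigma:V\to\{\pm1\}^{N-1}$, for $1<i<n$ sets $E_i$ of $2$-element subsets of $V$. It is a dual equivalence graph of type $(n,N)$ if $n\le N$ and (indices only where defined): (ax1) for $w\in V$, $1<i<n$: $\sigma(w)_{i-1}=-\sigma(w)_i$ iff some $x$ has $\{w,x\}\in E_i$, and such $x$ is unique; (ax2) if $\{w,x\}\in E_i$: $\sigma(w)_j=-\sigma(x)_j$ for $j=i-1,i$ and $\sigma(w)_h=\sigma(x)_h$ for $h<i-2$, $h>i+1$; (ax3) if $\{w,x\}\in E_i$ and $\sigma(w)_{i-2}=-\sigma(x)_{i-2}$ then $\sigma(w)_{i-2}=-\sigma(w)_{i-1}$; if $\sigma(w)_{i+1}=-\sigma(x)_{i+1}$ then $\sigma(w)_{i+1}=-\sigma(w)_i$; (ax4) each component of $(V,E_{i-1}\cup E_i)$ is a single vertex, a path $x,y,z$ with only edges $\{x,y\}\in E_{i-1}$, $\{y,z\}\in E_i$, or two vertices joined by both an $E_{i-1}$- and an $E_i$-edge; each component of $(V,E_{i-2}\cup E_{i-1}\cup E_i)$ is: (a) a single vertex; (b) a path $p,q,r,s$ with only edges $\{p,q\}\in E_{i-2}$, $\{q,r\}\in E_{i-1}$, $\{r,s\}\in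 E_i$; (c) vertices $a,b,c,d,e$ with only edges $\{a,b\}\in E_{i-2}\cap E_{i-1}$, $\{b,c\}\in E_i$, $\{c,d\}\in E_{i-2}$, $\{d,e\}\in E_{i-1}\cap E_i$; (d) vertices $u,v,w,x,y,z$ with only edges $\{u,v\}\in E_{i-1}$, $\{v,w\}\in E_{i-2}$, $\{v,x\}\in E_i$, $\{w,y\}\in E_i$, $\{x,y\}\in E_{i-2}$, $\{y,z\}\in E_{i-1}$; (ax5) if $\{w,x\}\in E_i$, $\{x,y\}\in E_j$, $|i-j|\ge3$, then some $v$ has $\{w,v\}\in E_j$, $\{v,y\}\in E_i$; (ax6) for each $1<i<n$, any two vertices of a component of $(V,E_2\cup\dots\cup E_i)$ are joined by a path in it with at most one $E_i$-edge. *)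

(* Defs.v *)
From HB Require Import structures.
From mathcomp Require Import all_boot all_order all_algebra.
Set Implicit Arguments. Unset Strict Implicit. Unset Printing Implicit Defensive.
Import GRing.Theory Num.Theory.

(* Formal power series in x_1, x_2, ... that are homogeneous of degree m
   are represented by their coefficient function on monomials.  A monomial
   x_{i_1} ... x_{i_m} of degree m is encoded by its unique weakly increasing
   index sequence s = [:: i_1; ...; i_m] of positive integers.              *)
Definition monomial_ok (m : nat) (s : seq nat) : bool :=
  [&& size s == m, sorted leq s & all (fun x => 0 < x) s].

(* Coefficient of the fundamental quasisymmetric function Q_D (degree m)
   at the monomial s: 1 iff i_j < i_{j+1} for every j in D (j in [m-1]). *)
Definition fundQ_coef (m : nat) (D : pred nat) (s : seq nat) : nat :=
  all (fun j => D j ==> (nth 0 s j.-1 < nth 0 s j)) (iota 1 m.-1).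

Definition is_partition (la : seq nat) (m : nat) : bool :=
  [&& sorted geq la, all (fun p => 0 < p) la & sumn la == m].

Definition cells (la : seq nat) : seq (nat * nat) :=
  flatten [seq [seq (r, c) | c <- iota 0 (nth 0 la r)] | r <- iota 0 (size la)].

(* f : seq nat gives the entry of the k-th cell of [cells la];
   semistandard: rows weakly increase, columns strictly increase *)
Definition is_ssyt (la : seq nat) (f : seq nat) : bool :=
  let cs := cells la in
  let v := fun rc => nth 0 f (index rc cs) in
  all (fun rc : nat * nat =>
         (((rc.1, rc.2.+1) \in cs) ==> (v rc <= v (rc.1, rc.2.+1))) &&
         (((rc.1.+1, rc.2) \in cs) ==> (v rc < v (rc.1.+1, rc.2)))) cs.

(* Coefficient of the Schur function s_la at the monomial s:
   the number of SSYT of shape la whose multiset of entries is s. *)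
Definition schur_coef (la : seq nat) (s : seq nat) : nat :=
  count (is_ssyt la) (permutations s).

Definition phi_rel (A : finType) (phi : nat -> A -> A) (h i : nat) : rel A :=
  fun u v => has (fun c => phi c u == v) (iota h (i - h).+1).

Definition deq_class (A : finType) (phi : nat -> A -> A) (h i : nat) (T : A)
  : {set A} := [set U | connect (phi_rel phi h i) T U].

Definition Des_hi (A : finType) (Des : A -> pred nat) (h i : nat) (U : A)
  : pred nat := fun k => (1 <= k <= i - h + 2) && Des U (k + (h - 2)).

Definition dual_equivalence (A : finType) (n : nat) (Des : A -> pred nat)
    (phi : nat -> A -> A) : Prop :=
  (forall h i, 1 < h -> h <= i -> i < n -> i - h <= 3 ->
     forall T : A, exists la : seq nat, is_partition la (i - h + 3) /\
       forall s, monomial_ok (i - h + 3) s ->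
         \sum_(U in deq_class phi h i T) fundQ_coef (i - h + 3) (Des_hi Des h i U) s
         = schur_coef la s) /\
  (forall i j, 1 < i < n -> 1 < j < n -> (i + 3 <= j) || (j + 3 <= i) ->
     forall T : A, phi i (phi j T) = phi j (phi i T)).

Definition signed_colored_graph (V : finType) (n N : nat)
    (sigma : V -> nat -> int) (E : nat -> {set {set V}}) : Prop :=
  (forall w j, 1 <= j < N -> sigma w j = 1%R \/ sigma w j = (-1)%R) /\
  (forall i, 1 < i < n -> forall e, e \in E i -> #|e| = 2).

Definition restrict_edges (V : finType) (E : {set {set V}}) (C : {set V})
  : {set {set V}} := [set e in E | e \subset C].

Definition cadj (V : finType) (E : nat -> {set {set V}}) (cs : seq nat) : rel V :=
  fun u v => has (fun c => [set u; v] \in E c) cs.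

Definition comp (V : finType) (E : nat -> {set {set V}}) (cs : seq nat) (w : V)
  : {set V} := [set v | connect (cadj E cs) w v].

Definition shape2 (V : finType) (E : nat -> {set {set V}}) (i : nat)
    (C : {set V}) : Prop :=
  (exists a, C = [set a] /\ restrict_edges (E i.-1) C = set0
                         /\ restrict_edges (E i) C = set0) \/
  (exists x y z, uniq [:: x; y; z] /\ C = [set x; y; z] /\
     restrict_edges (E i.-1) C = [set [set x; y]] /\
     restrict_edges (E i) C = [set [set y; z]]) \/
  (exists x y, x != y /\ C = [set x; y] /\
     restrict_edges (E i.-1) C = [set [set x; y]] /\
     restrict_edges (E i) C = [set [set x; y]]).

Definition shape3 (V : finType) (E : nat -> {set {set V}}) (i : nat)
    (C : {set V}) : Prop :=
  (exists a, C = [set a] /\ restrict_edges (E i.-2) C = set0 /\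
     restrict_edges (E i.-1) C = set0 /\ restrict_edges (E i) C = set0) \/
  (exists p q r s, uniq [:: p; q; r; s] /\ C = [set p; q; r; s] /\
     restrict_edges (E i.-2) C = [set [set p; q]] /\
     restrict_edges (E i.-1) C = [set [set q; r]] /\
     restrict_edges (E i) C = [set [set r; s]]) \/
  (exists a b c d e, uniq [:: a; b; c; d; e] /\ C = [set a; b; c; d; e] /\
     restrict_edges (E i.-2) C = [set [set a; b]; [set c; d]] /\
     restrict_edges (E i.-1) C = [set [set a; b]; [set d; e]] /\
     restrict_edges (E i) C = [set [set b; c]; [set d; e]]) \/
  (exists u v w x y z, uniq [:: u; v; w; x; y; z] /\
     C = [set u; v; w; x; y; z] /\
     restrict_edges (E i.-2) C = [set [set v; w]; [set x; y]] /\
     restrict_edges (E i.-1) C = [set [set u; v]; [set y; z]] /\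
     restrict_edges (E i) C = [set [set v; x]; [set w; y]]).

Fixpoint walk (V : finType) (E : nat -> {set {set V}}) (x : V)
    (p : seq (V * nat)) (y : V) : bool :=
  if p is (v, c) :: p' then ([set x; v] \in E c) && walk E v p' y else x == y.

Definition dual_equivalence_graph (V : finType) (n N : nat)
    (sigma : V -> nat -> int) (E : nat -> {set {set V}}) : Prop :=
  n <= N /\ signed_colored_graph n N sigma E /\
  (forall w i, 1 < i < n ->
     ((sigma w i.-1 = - sigma w i)%R <-> exists x, [set w; x] \in E i) /\
     (forall x y, [set w; x] \in E i -> [set w; y] \in E i -> x = y)) /\
  (forall w x i, 1 < i < n -> [set w; x] \in E i ->
     sigma w i.-1 = (- sigma x i.-1)%R /\ sigma w i = (- sigma x i)%R /\
     (forall h, 1 <= h < N -> (h + 2 < i \/ i.+1 < h) -> sigma w h = sigma x h)) /\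
  (forall w x i, 1 < i < n -> [set w; x] \in E i ->
     (2 < i -> sigma w i.-2 = (- sigma x i.-2)%R ->
        sigma w i.-2 = (- sigma w i.-1)%R) /\
     (i.+1 < N -> sigma w i.+1 = (- sigma x i.+1)%R ->
        sigma w i.+1 = (- sigma w i)%R)) /\
  (forall i, 2 < i < n -> forall w, shape2 E i (comp E [:: i.-1; i] w)) /\
  (forall i, 3 < i < n -> forall w, shape3 E i (comp E [:: i.-2; i.-1; i] w)) /\
  (forall i j w x y, 1 < i < n -> 1 < j < n -> (i + 3 <= j) || (j + 3 <= i) ->
     [set w; x] \in E i -> [set x; y] \in E j ->
     exists v, [set w; v] \in E j /\ [set v; y] \in E i) /\
  (forall i, 1 < i < n -> forall u v, connect (cadj E (iota 2 i.-1)) u v ->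
     exists p : seq (V * nat), walk E u p v /\
       all (fun st => 1 < st.2 <= i) p /\ count (fun st => st.2 == i) p <= 1).

(* Main.v *)
(** A standard Young tableau is recorded by the contents of its entries 1, ..., n;
    elementary dual equivalences act on content vectors by comparing three
    consecutive contents.  In both directions one constructs, by induction on k, a
    map f from A to content vectors of length k that carries descents to descents,
    phi_i to the i-th elementary dual equivalence for i < k, and is injective on
    the classes of phi_2, ..., phi_{k-1}.  The new content is the threshold that
    separates the corners e of f with k a descent from those with k not a descent;
    that phi_k is carried to the k-th elementary dual equivalence then only depends
    on the structure of the classes of at most three consecutive colours.

    Injectivity on the classes of phi_2, ..., phi_k says that each of them meets at
    most one class of phi_2, ..., phi_{k-1} for every position of the largest
    entry.  This is axiom 6.  Starting from Schur positivity instead, classes of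
    four colours are faithfully represented because some coefficient of s_lambda
    equals 1, and an explicit closed walk on tableaux of shape (3,2,1) shows that
    all neighbouring classes are pairwise adjacent (Roberts' argument).
    Conversely, the map f identifies a class of four colours with a dual Knuth
    class of permutations of at most six letters, where the expansion is a finite
    computation. *)
Require Import Defs.
From HB Require Import structures.
From mathcomp Require Import all_boot all_order all_algebra.
From mathcomp Require Import zify.
Set Implicit Arguments. Unset Strict Implicit. Unset Printing Implicit Defensive.
Import GRing.Theory Num.Theory Order.TTheory.

(** * Elementary dual equivalences on fillings *)

(** Each step of the induction rests on faithfulness: vertices of a class whose images carry the
    largest entry at the same place are joined by colours too small to affect descent [k], so this
    descent is a function of the place. Corners with and without the descent are separated because
    exchanging two corners is an application of [phi k.-1], and a vertex where this changes descent
    [k] has equal images under [phi k] and [phi k.-1]. Most other claims are tested by moving a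
    suitable corner to the top: between two different addable cells there is always a removable one.

    The obstacle is to preserve faithfulness. A path may use [phi k] many times, and two successive
    uses must be replaced by one. This is difficult only if the largest entry visits three different
    corners. Once these are removed, a corner appears in each of the two gaps, and another one
    between those: six cells, rearranged by the four colours [k - 3, ..., k]. So [5 <= k], and this
    is the only use of the Schur expansion for four colours. *)

Section Action.
Variables (X : Type) (phi : nat -> X -> X).
Definition act (w : seq nat) (x : X) : X := foldl (fun y c => phi c y) x w.
Lemma act_cat w1 w2 x : act (w1 ++ w2) x = act w2 (act w1 x).
Proof. by rewrite /act foldl_cat. Qed.
Lemma act_cons c w x : act (c :: w) x = act w (phi c x).
Proof. by []. Qed.
Lemma act_rcons c w x : act (rcons w c) x = phi c (act w x).
Proof. by rewrite -cats1 act_cat. Qed.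
Lemma act_rev (P : pred nat) (w : seq nat) x : (forall c, P c -> involutive (phi c)) ->
  all P w -> act (rev w) (act w x) = x.
Proof.
move=> inv; elim: w x => // c w IH x /= /andP[Pc Pw].
by rewrite rev_cons act_rcons IH // inv.
Qed.
End Action.

Section ElementaryDualEquivalence.
Variables (T : Type) (lt : rel T).
Definition btw (x y z : T) := (lt x y && lt y z) || (lt z y && lt y x).
(* A standard filling is the list of the positions of its entries, largest
   entry first; with top entry i.+1 the triple is (i.+1, i, i.-1). *)
Definition dtop (t : seq T) : seq T :=
  if t is z :: y :: x :: s then
    if btw y x z then y :: z :: x :: s
    else if btw x z y then z :: x :: y :: s else t
  else t.
Arguments dtop : simpl never.
(** Entries are counted from the end of the list: the head of [t] is the position of entry [size t].
    Larger entries added in front leave all indices alone; smaller ones added behind shift them. *)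
Fixpoint ded (i : nat) (t : seq T) : seq T :=
  if t is a :: t' then if size t' == i then dtop t else a :: ded i t' else [::].
(** For contents this is the usual descent of a standard tableau: entry [j.+1] lies on a diagonal of
    smaller content than entry [j] exactly when it lies in a strictly lower row (English
    notation). *)
Fixpoint desc (j : nat) (t : seq T) : bool :=
  if t is a :: t' then
    if size t' == j then (if t' is b :: _ then lt a b else false) else desc j t'
  else false.

Lemma size_dtop t : size (dtop t) = size t.
Proof. by case: t => [|z [|y [|x s]]] //=; rewrite /dtop; case: ifP => // _; case: ifP. Qed.
Lemma size_ded i t : size (ded i t) = size t.
Proof. by elim: t => //= a t IH; case: ifP => _; [rewrite size_dtop | rewrite /= IH]. Qed.
Lemma size_dact w t : size (act ded w t) = size t.
Proof. by elim: w t => //= c w IH t; rewrite IH size_ded. Qed.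
Lemma ded_top i t : size t = i.+1 -> ded i t = dtop t.
Proof. by case: t => //= a t [->]; rewrite eqxx. Qed.
Lemma ded_cons i a t : i < size t -> ded i (a :: t) = a :: ded i t.
Proof. by move=> h /=; case: eqP h => // ->; rewrite ltnn. Qed.
Lemma ded_small i t : size t <= i -> ded i t = t.
Proof.
by elim: t => //= a t IH h; rewrite IH ?(ltnW h) //; case: eqP => // e; move: h; rewrite e ltnn.
Qed.
Lemma ded_catl i p t : i < size t -> ded i (p ++ t) = p ++ ded i t.
Proof.
move=> h; elim: p => //= a p ->.
by rewrite size_cat; case: eqP => // e; lia.
Qed.
Lemma dact_catl w p t : all (fun c => c < size t) w ->
  act ded w (p ++ t) = p ++ act ded w t.
Proof.
elim: w t => //= c w IH t /andP[hc hw].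
by rewrite ded_catl // IH // size_ded.
Qed.
(** The bound [1 < i] keeps the triple of the colour inside [t]. *)
Lemma ded_catr i t q : 1 < i -> ded (i + size q) (t ++ q) = ded i t ++ q.
Proof.
move=> i1; elim: t => [|a t IH] /=.
  by rewrite ded_small // leq_addl.
rewrite size_cat eqn_add2r IH; case: eqP => // e.
by case: t e {IH} => [|b [|c t]] /= e; try lia; rewrite /dtop; case: ifP => // _; case: ifP.
Qed.
Lemma desc_cons j a t : j < size t -> desc j (a :: t) = desc j t.
Proof. by move=> h /=; case: eqP h => // ->; rewrite ltnn. Qed.
Lemma desc_catl j p t : j < size t -> desc j (p ++ t) = desc j t.
Proof.
move=> h; elim: p => //= a p ->.
by rewrite size_cat; case: eqP => // e; lia.
Qed.
Lemma desc_catr j t q : 0 < j -> j < size t -> desc (j + size q) (t ++ q) = desc j t.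
Proof.
move=> j0; elim: t => //= a t IH h.
rewrite size_cat eqn_add2r; case: eqP => e; last by apply: IH; lia.
by case: t e {IH h} => //= e; lia.
Qed.
Lemma desc_top a b t : desc (size t).+1 [:: a, b & t] = lt a b.
Proof. by rewrite /= eqxx. Qed.
Lemma desc_top2 a b c t : desc (size t).+1 [:: a, b, c & t] = lt b c.
Proof. by rewrite desc_cons ?desc_top //=. Qed.

End ElementaryDualEquivalence.
Arguments dtop : simpl never.

Lemma perm_swap (T : eqType) (a b : T) s : perm_eq [:: a, b & s] [:: b, a & s].
Proof. by apply/permP => p /=; lia. Qed.
Lemma perm_dtop (T : eqType) (lt : rel T) t : perm_eq (dtop lt t) t.
Proof.
case: t => [|z [|y [|x s]]] //=; rewrite /dtop; case: ifP => _.
  exact: perm_swap.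
by case: ifP => // _; rewrite perm_cons perm_swap.
Qed.
Lemma perm_ded (T : eqType) (lt : rel T) i t : perm_eq (ded lt i t) t.
Proof.
elim: t => //= a t IH; case: ifP => _; first exact: perm_dtop.
by rewrite perm_cons.
Qed.
Lemma perm_dact (T : eqType) (lt : rel T) w t : perm_eq (act (ded lt) w t) t.
Proof. by elim: w t => //= c w IH t; apply: perm_trans (IH _) (perm_ded _ _ _). Qed.

Section Relabel.
Variables (T T' : eqType) (lt : rel T) (lt' : rel T') (f : T -> T').
Let mono (t : seq T) := {in t &, forall x y, lt' (f x) (f y) = lt x y}.
Lemma dtop_map t : mono t -> dtop lt' (map f t) = map f (dtop lt t).
Proof.
case: t => [|z [|y [|x s]]] //= h.
have [hx hy hz] : [/\ x \in [:: z, y, x & s], y \in [:: z, y, x & s] &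
                      z \in [:: z, y, x & s]] by rewrite !inE !eqxx !orbT.
by rewrite /dtop /btw !h //; case: ifP => // _; case: ifP.
Qed.
Lemma ded_map i t : mono t -> ded lt' i (map f t) = map f (ded lt i t).
Proof.
elim: t => //= a t IH h; rewrite size_map; case: ifP => _; first by rewrite -dtop_map.
rewrite IH // => x y hx hy; apply: h; rewrite inE ?hx ?hy orbT //.
Qed.
Lemma desc_map j t : mono t -> desc lt' j (map f t) = desc lt j t.
Proof.
elim: t => //= a t IH h; rewrite size_map; case: ifP => _.
  by case: t h {IH} => //= b t h; rewrite h // !inE eqxx ?orbT.
by apply: IH => x y hx hy; apply: h; rewrite inE ?hx ?hy orbT.
Qed.
End Relabel.

(** * Content vectors of standard Young tableaux *)

Notation lti := (fun x y : int => (x < y)%R).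
Notation dd := (ded lti).
Notation dt := (dtop lti).

Section ContentVectors.
Local Open Scope ring_scope.

(* Boundary word of the partition with contents [t]: the cell of content k can
   be added iff bits k, k+1 are 1, 0; it can be removed iff they are 0, 1. *)
Definition bit (t : seq int) (k : int) : int :=
  ((k <= 0)%R : nat)%:Z - (count_mem k t)%:Z + (count_mem (k - 1) t)%:Z.
Definition addable t k := (bit t k == 1) && (bit t (k + 1) == 0).
Definition removable t k := (bit t k == 0) && (bit t (k + 1) == 1).
(* Content vectors of standard Young tableaux, content of the largest entry first. *)
Fixpoint tableau (t : seq int) : bool :=
  if t is a :: t' then addable t' a && tableau t' else true.

Lemma tableau_cons a t : tableau (a :: t) = addable t a && tableau t.
Proof. by []. Qed.

Lemma perm_bit t t' k : perm_eq t t' -> bit t k = bit t' k.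
Proof. by move=> /permP h; rewrite /bit !h. Qed.
Lemma perm_addable t t' k : perm_eq t t' -> addable t k = addable t' k.
Proof. by move=> h; rewrite /addable !(perm_bit _ h). Qed.
Lemma perm_removable t t' k : perm_eq t t' -> removable t k = removable t' k.
Proof. by move=> h; rewrite /removable !(perm_bit _ h). Qed.

Lemma bit_cons a t k :
  bit (a :: t) k = bit t k - ((a == k) : nat)%:Z + ((a + 1 == k) : nat)%:Z.
Proof. rewrite /bit /=; lia. Qed.

Lemma bit01 t k : tableau t -> (bit t k == 0) || (bit t k == 1).
Proof.
elim: t k => [|a t IH] k /=; first by rewrite /bit /=; lia.
move=> /andP[/andP[h1 h2] /IH H]; have := H k; have := H a; have := H (a + 1).
rewrite bit_cons; case: (a =P k) => [<-|e1]; case: (a + 1 =P k) => [e2|e2]; subst; lia.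
Qed.

Lemma bit_far t : exists M : int, (forall k : int, k <= - M -> bit t k = 1) /\
  (forall k : int, M <= k -> bit t k = 0).
Proof.
elim: t => [|a t [M [h1 h2]]].
  exists 1; split=> k h; rewrite /bit /=; lia.
exists (`|M| + `|a| + 2); split=> k h; rewrite bit_cons.
  by rewrite h1; lia.
by rewrite h2; lia.
Qed.

(** Take [z] at the last bit 1 before [hi]. The zeros after [z] exclude removable cells of content
    in [[z, hi)], since a removable cell at [k] needs bit 1 at [k + 1]; this makes [z] usable as a
    threshold. *)
Lemma scan_down t (lo hi : int) : lo < hi -> tableau t -> bit t lo = 1 ->
  bit t hi = 0 -> exists z, [/\ lo <= z, z < hi, addable t z &
    forall e : int, z < e -> e <= hi -> bit t e = 0].
Proof.
move=> lt_lohi ht b1 b0.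
have [d hd] : exists d : nat, hi = lo + d.+1%:Z by exists (absz (hi - lo - 1)%R); lia.
elim: d hi hd b0 {lt_lohi} => [|d IH] hi hd b0.
  exists lo; split; try lia.
    by rewrite /addable b1; (have <- : hi = lo + 1 by lia); rewrite b0 !eqxx.
  by move=> e h1 h2; have -> : e = hi by lia.
case/orP: (bit01 (hi - 1) ht) => /eqP hb.
  have [|z [h1 h2 h3 h4]] := IH (hi - 1) _ hb; first lia.
  exists z; split=> //; first lia.
  by move=> e h5 h6; case: (e =P hi) => [-> //|ne]; apply: h4; lia.
exists (hi - 1); split; try lia.
  by rewrite /addable hb; (have -> : hi - 1 + 1 = hi by lia); rewrite b0.
by move=> e h1 h2; have -> : e = hi by lia.
Qed.

(** The boundary word has a 0 at [a + 1] and a 1 at [b], so somewhere in between a 0 is followed by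
    a 1. *)
Lemma rem_between t a b : a < b -> tableau t -> addable t a -> addable t b ->
  exists e, [/\ a < e, e < b & removable t e].
Proof.
move=> lt_ab ht /andP[/eqP a1 /eqP a0] /andP[/eqP b1 _].
have {a0 a1} [lo [h1 h2 h3]] : exists lo, [/\ a < lo, lo < b & bit t lo = 0].
  exists (a + 1); split=> //; first lia.
  by case: (a + 1 =P b) => e; [move: a0; rewrite e b1 | lia].
have [d hd] : exists d : nat, b = lo + d.+1%:Z by exists (absz (b - lo - 1)%R); lia.
elim: d lo h1 h2 h3 hd => [|d IH] lo h1 h2 h3 hd.
  exists lo; split=> //; rewrite /removable h3; have -> : lo + 1 = b by lia.
  by rewrite b1.
case/orP: (bit01 (lo + 1) ht) => /eqP hb.
  by have [|||e [? ? ?]] := IH (lo + 1) _ _ hb _; [lia|lia|lia|exists e; split=> //; lia].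
by exists lo; split=> //; rewrite /removable h3 hb.
Qed.

Lemma removable_addable t a k : tableau t -> addable t a -> removable (a :: t) k ->
  k = a \/ removable t k.
Proof.
move=> ht /andP[h1 h2]; rewrite /removable !bit_cons => /andP[h3 h4].
have := bit01 k ht; have := bit01 (k + 1) ht.
case: (a =P k) => e; first by left.
right; case: (a + 1 =P k) => e2; first by subst; lia.
case: (a =P k + 1) => e3; first by subst; lia.
lia.
Qed.

(** If the largest entry [a] is elsewhere, both [a] and [k] are removable in the whole shape, hence
    not on adjacent diagonals. The entry that induction puts at [k] can then be exchanged with the
    largest one. *)
Lemma peel t k : tableau t -> removable t k ->
  exists t', tableau (k :: t') /\ perm_eq t (k :: t').
Proof.
elim: t => [|a t IH]; first by rewrite /removable /bit /=; lia.
move=> /= /andP[ha ht] hk.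
case: (removable_addable ht ha hk) => [->|hk'].
  by exists t; rewrite /= ha ht.
have [t' [/= /andP[h1 h2] h3]] := IH ht hk'.
have ne : a <> k by move=> e; move: ha hk'; rewrite e /addable /removable; lia.
exists (a :: t'); split; last first.
  have h : perm_eq (a :: t) (a :: k :: t') by rewrite perm_cons.
  exact: perm_trans h (perm_swap _ _ _).
move: ha hk' hk; rewrite (perm_addable a h3) (perm_removable k h3) /= h2 andbT.
have h4 : perm_eq (a :: t) (a :: k :: t') by rewrite perm_cons.
rewrite (perm_removable k h4); move: h1.
rewrite /addable /removable !bit_cons.
have := bit01 k h2; have := bit01 (k + 1) h2; have := bit01 a h2; have := bit01 (a + 1) h2.
case: (a =P k + 1) => [e|e]; first by subst; lia.
case: (a + 1 =P k) => [e'|e']; first by subst; lia.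
lia.
Qed.

Lemma tableau_neq2 a b t : tableau [:: a, b & t] -> a <> b.
Proof.
move=> /= /and3P[h1 h2 h3] e; subst; move: h1 h2.
by rewrite /addable !bit_cons; lia.
Qed.
(** Between two successive cells of one diagonal, the cell to the right of the first and the cell
    below it must both be filled. Hence [dtop] never compares equal contents. *)
Lemma tableau_neq3 a b c t : tableau [:: a, b, c & t] -> [/\ a <> b, b <> c & a <> c].
Proof.
move=> h; split; first exact: tableau_neq2 h.
  by move: h => /= /andP[_ h]; apply: (@tableau_neq2 b c t).
move: h => /= /and4P[h1 h2 h3 h4] e; subst; move: h1 h2 h3.
rewrite /addable !bit_cons; have := bit01 (b + 1) h4; have := bit01 b h4.
case: (b =P c) => [e|e]; first by subst; lia.
by case: (b =P c + 1) => [e1|e1]; case: (b + 1 =P c) => [e2|e2]; subst; lia.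
Qed.
Lemma tableau_swap a b t : a <> b + 1 -> b <> a + 1 -> tableau [:: a, b & t] ->
  tableau [:: b, a & t].
Proof.
move=> n1 n2 h; have n3 := tableau_neq2 h; move: h => /= /and3P[h1 h2 h3].
rewrite h3 andbT; move: h1 h2; rewrite /addable !bit_cons; lia.
Qed.
Lemma addable_far a b t : tableau [:: a, b & t] -> a <> b + 1 -> b <> a + 1 -> addable t a.
Proof. by move=> h n1 n2; move: (tableau_swap n1 n2 h) => /= /and3P[_]. Qed.

Lemma btwP (x y z : int) : btw lti x y z -> (x < y /\ y < z) \/ (z < y /\ y < x).
Proof. rewrite /btw; lia. Qed.

Lemma btw_lt (x y z : int) : x < y -> y < z -> btw lti x y z.
Proof. by rewrite /btw => -> ->. Qed.
Lemma btwC (x y z : int) : btw lti x y z = btw lti z y x.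
Proof. by rewrite /btw orbC. Qed.

Lemma tableau_dtop t : tableau t -> tableau (dt t).
Proof.
case: t => [|z [|y [|x s]]] // h; rewrite /dtop.
case: ifP => [/btwP b|_]; first by apply: tableau_swap h; lia.
case: ifP => [/btwP b|_] //.
have [h1 h2] : addable [:: y, x & s] z /\ tableau [:: y, x & s] by apply/andP.
have h3 : tableau [:: x, y & s] by apply: tableau_swap h2; lia.
rewrite tableau_cons h3 andbT.
rewrite -(perm_addable _ (_ : perm_eq [:: y, x & s] _)) //.
exact: perm_swap.
Qed.
Lemma tableau_ded i t : tableau t -> tableau (dd i t).
Proof.
elim: t => //= a t IH /andP[h1 h2]; case: ifP => _; first by apply: tableau_dtop; rewrite /= h1.
by rewrite /= IH // andbT (perm_addable _ (perm_ded _ _ _)).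
Qed.
Lemma tableau_dact w t : tableau t -> tableau (act dd w t).
Proof. by elim: w t => //= c w IH t h; apply/IH/tableau_ded. Qed.

End ContentVectors.

(* [lia] tries to unfold these predicates on explicit lists. *)
Ltac tab_lia := repeat match goal with
  | H : is_true (tableau _) |- _ => clear H
  | H : is_true (perm_eq _ _) |- _ => clear H
  | H : is_true (removable _ _) |- _ => clear H
  | H : is_true (addable _ _) |- _ => clear H
  | H : is_true (all _ _) |- _ => clear H
  end; lia.

Definition below (k : nat) : pred nat := fun c => 1 < c < k.

(** * Transitivity and rigidity of the elementary dual equivalences on tableaux *)

Section Connectivity.
Local Open Scope ring_scope.

Lemma tableau_head a t : tableau (a :: t) -> removable (a :: t) a.
Proof. by move=> /= /andP[]; rewrite /addable /removable !bit_cons; tab_lia. Qed.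

Lemma removable_neq1 t a b : removable t a -> removable t b -> a <> b + 1 /\ b <> a + 1.
Proof. by move=> h1 h2; split=> e; move: h1 h2; rewrite e /removable; tab_lia. Qed.

(** After both corners are removed they are addable, so a removable [e] lies between them. With [e]
    as third content, the top elementary dual equivalence exchanges the two corners. *)
Lemma two_corners t a b : tableau t -> removable t a -> removable t b -> a <> b ->
  exists e s, [/\ tableau [:: a, b, e & s], tableau [:: b, a, e & s],
     perm_eq t [:: a, b, e & s] & btw lti a e b].
Proof.
move=> ht ha hb ne; have [t1 [h1 p1]] := peel ht ha.
have [n1 n2] := removable_neq1 ha hb.
have hb1 : removable t1 b.
  move: h1 hb => /= /andP[h11 h12]; rewrite (perm_removable b p1) => hb.
  by case: (removable_addable h12 h11 hb) => // e; case: ne.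
have ht1 : tableau t1 by case/andP: h1.
have [t2 [h2 p2]] := peel ht1 hb1.
have ht2 : tableau t2 by case/andP: h2.
have b2 : addable t2 b by case/andP: h2.
have p3 : perm_eq t [:: a, b & t2] by rewrite (perm_trans p1) // perm_cons.
have h3 : tableau [:: a, b & t2].
  by move: h1 h2 => /= /andP[c1 _] /andP[c2 c3]; rewrite -(perm_addable a p2) c1 c2 c3.
have a2 : addable t2 a := addable_far h3 n1 n2.
have [e [be he]] : exists e, btw lti a e b /\ removable t2 e.
  case: (ltgtP a b) => [hab|hba|/ne //].
    by have [e [? ? ?]] := rem_between hab ht2 a2 b2; exists e; split=> //; apply: btw_lt.
  by have [e [? ? ?]] := rem_between hba ht2 b2 a2; exists e; rewrite btwC; split=> //; apply: btw_lt.
have [s [hs ps]] := peel ht2 he.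
have q : perm_eq [:: a, b & t2] [:: a, b, e & s] by rewrite !perm_cons.
have h4 : tableau [:: a, b, e & s].
  have qb : perm_eq (b :: t2) [:: b, e & s] by rewrite perm_cons.
  move: h3 hs => /= /and3P[c1 c2 _] /andP[c3 c4].
  by rewrite -(perm_addable a qb) -(perm_addable b ps) c1 c2 c3 c4.
exists e, s; split=> //; last exact: perm_trans p3 q.
exact: tableau_swap h4.
Qed.

Lemma dt_mid (a b e : int) s : btw lti a e b -> dt [:: a, b, e & s] = [:: b, a, e & s].
Proof. by move=> h; rewrite /dtop (btwC b e a) h. Qed.

Lemma sub_below k k' w : (k <= k')%N -> all (below k) w -> all (below k') w.
Proof. by move=> h; apply: sub_all => c; rewrite /below; tab_lia. Qed.
Lemma dact_cons a w t : all (below (size t)) w -> act dd w (a :: t) = a :: act dd w t.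
Proof.
move=> h; rewrite (@dact_catl _ _ w [:: a] t) //.
by apply: sub_all h => c; rewrite /below; tab_lia.
Qed.

(** If the largest entries sit at different corners, smaller colours bring both tableaux to the two
    fillings of [two_corners], and a single application of colour [n] exchanges these. This is axiom
    6 for tableaux. *)
Lemma tableau_connect n t t' : size t = n.+1 -> tableau t -> tableau t' -> perm_eq t t' ->
  (head 0 t = head 0 t' -> exists w, all (below n) w /\ act dd w t = t') /\
  (head 0 t <> head 0 t' -> (1 < n)%N /\ exists w1 w2,
     [/\ all (below n) w1, all (below n) w2 & act dd (w1 ++ n :: w2) t = t']).
Proof.
elim: n t t' => [|n IH] t t' st ht ht' p.
  case: t st ht p => [|a [|? ?]] // _ ha p.
  have p' : perm_eq t' [:: a] by rewrite perm_sym.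
  rewrite (perm_small_eq _ p') //; split=> // _.
  by exists [::].
have st' : size t' = n.+2 by rewrite -(perm_size p).
have same u u' : size u = n.+2 -> tableau u -> tableau u' -> perm_eq u u' ->
    head 0 u = head 0 u' -> exists w, all (below n.+1) w /\ act dd w u = u'.
  case: u => [//|a u] [su] /andP[_ hu]; case: u' => [|a' u'].
    by move=> _ /perm_size.
  move=> /andP[_ hu'] pu /= e; subst a'; rewrite perm_cons in pu.
  have [h1 h2] := IH u u' su hu hu' pu.
  case: (head 0 u =P head 0 u') => e.
    have [w [hw ew]] := h1 e; have hw' := sub_below (leqnSn n) hw.
    by exists w; split=> //; rewrite dact_cons ?su // ew.
  have [n1 [w1 [w2 [hw1 hw2 ew]]]] := h2 e.
  have hw : all (below n.+1) (w1 ++ n :: w2).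
    by rewrite all_cat /= (sub_below _ hw1) // (sub_below _ hw2) // /below n1 /= andbT.
  by exists (w1 ++ n :: w2); split=> //; rewrite dact_cons ?su // ew.
split; first exact: same.
case: t st ht p same => [//|a t] [st] ht p same.
case: t' st' ht' p same => [//|b t'] [st'] ht' p same /= ne.
have ha := tableau_head ht.
have hb : removable (a :: t) b by rewrite (perm_removable b p); apply: tableau_head.
have [e [s [h1 h2 h3 h4]]] := two_corners ht ha hb ne.
have ss : n = (size s).+1 by move: (perm_size h3); rewrite /= st => -[].
have [|w1 [hw1 e1]] := same (a :: t) _ _ ht h1 h3 erefl; first by rewrite /= st.
have q : perm_eq [:: b, a, e & s] [:: a, b, e & s] by exact: perm_swap.
have [| |w2 [hw2 e2]] := same [:: b, a, e & s] (b :: t') _ h2 ht' _ erefl.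
- by rewrite /= ss.
- by apply: perm_trans q _; apply: perm_trans p; rewrite perm_sym.
split; first by rewrite ss.
exists w1, w2; split=> //; rewrite act_cat e1 act_cons ded_top; last by rewrite /= ss.
by rewrite dt_mid.
Qed.

Lemma tableau_connected n t t' : size t = n -> tableau t -> tableau t' -> perm_eq t t' ->
  exists w, all (below n) w /\ act dd w t = t'.
Proof.
case: n => [|n] st ht ht' p.
  case: t st p {ht} => // _; rewrite perm_sym => /perm_nilP ->; by exists [::].
have [h1 h2] := tableau_connect st ht ht' p.
case: (head 0 t =P head 0 t') => [/h1|/h2] [].
  by move=> w [hw ew]; exists w; split=> //; apply: sub_below hw.
move=> n1 [w1 [w2 [hw1 hw2 ew]]]; exists (w1 ++ n :: w2); split=> //.
by rewrite all_cat /= (sub_below _ hw1) // (sub_below _ hw2) // /below n1 /= andbT.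
Qed.

(** Makes a difference between two possible next cells visible as a descent: with [e] on top of [s],
    exactly one of [a], [b] is smaller than [e]. *)
Lemma addable_sep s a b : tableau s -> addable s a -> addable s b -> a <> b ->
  exists e r w, [/\ btw lti a e b, tableau (e :: r), perm_eq s (e :: r),
     all (below (size s)) w & act dd w s = e :: r].
Proof.
move=> hs ha hb ne.
have [e [be he]] : exists e, btw lti a e b /\ removable s e.
  case: (ltgtP a b) => [hab|hba|/ne //].
    by have [e [? ? ?]] := rem_between hab hs ha hb; exists e; split=> //; apply: btw_lt.
  by have [e [? ? ?]] := rem_between hba hs hb ha; exists e; rewrite btwC; split=> //; apply: btw_lt.
have [r [hr pr]] := peel hs he.
by have [w [hw ew]] := tableau_connected erefl hs hr pr; exists e, r, w.
Qed.

(** By induction the tableaux agree below the largest entry. Two different places for it would be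
    told apart by the last descent, once a corner between them is moved to the top of the rest. *)
Lemma tableau_rigid n t t' : size t = n -> size t' = n -> tableau t -> tableau t' ->
  (forall w j, all (below n) w -> (0 < j < n)%N ->
     desc lti j (act dd w t) = desc lti j (act dd w t')) -> t = t'.
Proof.
elim: n t t' => [|n IH] t t'; first by case: t => // _; case: t'.
case: t => [//|a t] [st]; case: t' => [//|a' t'] [st'] /andP[ha ht] /andP[ha' ht'] H.
have {IH} e : t = t'.
  apply: IH => // w j hw hj.
  have := H w j (sub_below (leqnSn n) hw); rewrite !dact_cons ?st ?st' //.
  by rewrite !desc_cons ?size_dact ?st ?st' //; [apply; tab_lia|tab_lia|tab_lia].
subst t'; case: (a =P a') => [-> //|ne].
have [e [r [w [be hr pr hw ew]]]] := addable_sep ht ha ha' ne.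
rewrite st in hw.
have sr : n = (size r).+1 by rewrite -st (perm_size pr).
have hn : (0 < n < n.+1)%N by rewrite sr /= ltnSn.
have := H w n (sub_below (leqnSn n) hw) hn; rewrite !dact_cons ?st // ew sr !desc_top.
by move: be; clear; rewrite /btw; tab_lia.
Qed.

Lemma ded_third pre a b e s : btw lti a e b ->
  dd (size s).+2 (pre ++ [:: a, b, e & s]) = pre ++ [:: b, a, e & s].
Proof. by move=> h; rewrite ded_catl // ded_top // dt_mid. Qed.

(** Without [p], [q], [r] the shape has a corner in each of the two gaps, and these are again
    separated by some [a]. The order of the six contents is the starting point of a closed walk. *)
Lemma three_corners t p q r : tableau t -> removable t p -> removable t q -> removable t r ->
  btw lti p q r ->
  exists b b' a s, [/\ tableau [:: p, q, b, r, b', a & s], perm_eq t [:: p, q, b, r, b', a & s],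
    btw lti p b q, btw lti q b' r & btw lti b a b'].
Proof.
move=> ht hp hq hr bq.
have [npq npr nqr] : [/\ p <> q, p <> r & q <> r] by move: bq; clear; rewrite /btw; split; lia.
have [t1 [h1 p1]] := peel ht hr; have /andP[ar ht1] := h1.
have rem1 x : x <> r -> removable t x -> removable t1 x.
  by move=> ne; rewrite (perm_removable x p1) => /(removable_addable ht1 ar)[/ne|].
have [b [s1 [h2 _ p2 bb]]] := two_corners ht1 (rem1 p npr hp) (rem1 q nqr hq) npq.
have /and4P[ap aq ab hs1] := h2.
(* Removing r first gives b; removing p first gives b'. *)
have [t3 [h3 p3]] := peel ht hp; have /andP[ap3 ht3] := h3.
have rem3 x : x <> p -> removable t x -> removable t3 x.
  by move=> ne; rewrite (perm_removable x p3) => /(removable_addable ht3 ap3)[/ne|].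
have nrq : r <> q by move/esym.
have [b' [s2 [h4 _ p4 bb']]] := two_corners ht3 (rem3 r (fun e => npr (esym e)) hr)
  (rem3 q (fun e => npq (esym e)) hq) nrq.
have /and4P[ar2 aq2 ab2 hs2] := h4.
have q1 : perm_eq t [:: r, p, q, b & s1] by rewrite (perm_trans p1) // perm_cons.
have q2 : perm_eq t [:: p, r, q, b' & s2] by rewrite (perm_trans p3) // perm_cons.
have q3 : perm_eq (b :: s1) (b' :: s2).
  have : perm_eq [:: r, p, q, b & s1] [:: p, r, q, b' & s2].
    by apply: perm_trans q2; rewrite perm_sym.
  by rewrite (permPl (perm_swap _ _ _)) !perm_cons.
have tb : tableau (b :: s1) by rewrite /= ab.
have tb' : tableau (b' :: s2) by rewrite /= ab2.
have rb := tableau_head tb.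
have rb' : removable (b :: s1) b' by rewrite (perm_removable _ q3) tableau_head.
have nbb : b <> b' by move: bb bb' bq; clear; rewrite /btw; lia.
have [a [s [h5 h6 p5 ba]]] := two_corners tb rb rb' nbb.
have q4 : perm_eq s1 [:: b', a & s] by rewrite perm_cons in p5.
have pf : perm_eq t [:: p, q, b, r, b', a & s].
  apply: (perm_trans q1); apply: (@perm_trans _ [:: r, p, q, b, b', a & s]).
    by rewrite !perm_cons.
  apply: (perm_trans (perm_swap _ _ _)); rewrite perm_cons.
  apply: (perm_trans (perm_swap _ _ _)); rewrite perm_cons.
  exact: perm_swap.
exists b, b', a, s; split=> //; last by rewrite btwC.
have [e1 e2] := removable_neq1 hp hr; have [e3 e4] := removable_neq1 hq hr.
have e5 : b <> r + 1 /\ r <> b + 1 by move: bb bq e3 e4; clear; rewrite /btw; lia.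
have tt : tableau [:: r, p, q, b, b', a & s].
  have t5 : tableau [:: b, b', a & s] by [].
  have t6 : tableau [:: q, b, b', a & s].
    by rewrite /= -(perm_addable q p5) aq.
  have t7 : tableau [:: p, q, b, b', a & s].
    have q5 : perm_eq (q :: b :: s1) [:: q, b, b', a & s] by rewrite perm_cons.
    by rewrite tableau_cons t6 -(perm_addable p q5) ap.
  have q6 : perm_eq t1 [:: p, q, b, b', a & s] by rewrite (perm_trans p2) // !perm_cons.
  by rewrite tableau_cons t7 -(perm_addable r q6) ar.
(* The content [r] is adjacent to none of [p], [q], [b], so it sinks from the front to its place
   behind [b]. *)
have step x u : x <> r + 1 -> r <> x + 1 -> tableau [:: r, x & u] -> tableau [:: x, r & u].
  by move=> g1 g2; apply: tableau_swap.
have u1 := step _ _ e1 e2 tt.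
have u2 : tableau [:: q, r, b, b', a & s] by apply: step => //; case/andP: u1.
have u3 : tableau [:: b, r, b', a & s] by apply: step; [case: e5|case: e5|case/andP: u2].
have u4 : tableau [:: q, b, r, b', a & s].
  case/andP: u2 => g1 _; rewrite tableau_cons u3 andbT.
  by rewrite (perm_addable q (perm_swap _ _ _)).
case/andP: u1 => g1 _; rewrite tableau_cons u4 andbT.
rewrite -(perm_addable p (_ : perm_eq [:: r, q, b, b', a & s] _)) //.
apply: (perm_trans (perm_swap _ _ _)); rewrite perm_cons; exact: perm_swap.
Qed.

(* On the shape (3,2,1) with corners p, q, r, the largest entry travels p, q, r, p. *)
Lemma corner_loop p q r b b' a s :
  btw lti p q r -> btw lti p b q -> btw lti q b' r -> btw lti b a b' ->
  let m := size s in
  [/\ act dd [:: m.+4.+1; m.+3; m.+4; m.+2; m.+3] [:: p, q, b, r, b', a & s]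
        = [:: q, r, b', p, b, a & s],
      act dd [:: m.+4.+1; m.+3; m.+2; m.+4; m.+2] [:: q, r, b', p, b, a & s]
        = [:: r, p, q, b', b, a & s] &
      act dd [:: m.+4.+1; m.+4; m.+2; m.+3] [:: r, p, q, b', b, a & s]
        = [:: p, q, b, r, b', a & s] ].
Proof.
move=> h1 h2 h3 h4 m.
have [g1 g2 g3] : [/\ btw lti b b' r, btw lti p b r & btw lti b' b p].
  by move: h1 h2 h3; clear; rewrite /btw; split; lia.
have [g4 g5 g6] : [/\ btw lti q b p, btw lti r q p & btw lti r b' q].
  by move: h1 h2 h3; clear; rewrite /btw; split; lia.
have [g7 g10 g9] : [/\ btw lti r b' b, btw lti p b b' & btw lti b' a b].
  by move: h1 h2 h3 h4; clear; rewrite /btw; split; lia.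
have third pre x y e u w : btw lti x e y ->
    act dd ((size u).+2 :: w) (pre ++ [:: x, y, e & u]) = act dd w (pre ++ [:: y, x, e & u]).
  by move=> h; rewrite act_cons ded_third.
split.
- apply: (etrans (third [::] p q b [:: r, b', a & s] _ h2)).
  apply: (etrans (third [:: q; p] b r b' [:: a & s] _ g1)).
  apply: (etrans (third [:: q] p r b [:: b', a & s] _ g2)).
  apply: (etrans (third [:: q; r; p] b b' a s _ h4)).
  exact: (third [:: q; r] p b' b [:: a & s] [::] g10).
- apply: (etrans (third [::] q r b' [:: p, b, a & s] _ h3)).
  apply: (etrans (third [:: r; q] b' p b [:: a & s] _ g3)).
  apply: (etrans (third [:: r; q; p] b' b a s _ g9)).
  apply: (etrans (third [:: r] q p b [:: b', a & s] _ g4)).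
  exact: (third [:: r; p; q] b b' a s [::] h4).
- apply: (etrans (third [::] r p q [:: b', b, a & s] _ g5)).
  apply: (etrans (third [:: p] r q b' [:: b, a & s] _ g6)).
  apply: (etrans (third [:: p; q; r] b' b a s _ g9)).
  exact: (third [:: p; q] r b b' [:: a & s] [::] g7).
Qed.
End Connectivity.

(** * Realization of a graph by tableaux *)

Lemma connect_act (A : finType) (phi : nat -> A -> A) (cs : seq nat) (U V : A) :
  reflect (exists w, all (mem cs) w /\ act phi w U = V)
    (connect (fun u v => has (fun c => phi c u == v) cs) U V).
Proof.
apply: (iffP connectP) => [[p]|[w [hw <-]]].
  elim: p U => [|x p IH] U /=; first by move=> _ ->; exists [::].
  move=> /andP[/hasP[c hc /eqP <-] hp] /(IH _ hp)[w [hw <-]].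
  by exists (c :: w); rewrite /= hw andbT.
elim: w U hw => [|c w IH] U /=; first by exists [::].
move=> /andP[hc /(IH (phi c U))[p hp e]]; exists (phi c U :: p) => //=.
by rewrite hp andbT; apply/hasP; exists c.
Qed.

Section Structure.
Variables (A : finType) (n : nat) (Des : A -> pred nat) (phi : nat -> A -> A).

(* [loc_up] and [loc_down] recognize the double edges of axiom 4 by their signs;
   in [loc_three], U is the vertex c of shape (c), or w or x in shape (d). *)
Record local_axioms : Prop := LocalAxioms {
  loc_inv : forall i, 1 < i < n -> involutive (phi i);
  loc_move : forall U i, 1 < i < n -> (phi i U != U) = (Des U i.-1 != Des U i);
  loc_flip : forall U i, 1 < i < n -> phi i U != U ->
    Des (phi i U) i.-1 = ~~ Des U i.-1 /\ Des (phi i U) i = ~~ Des U i;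
  loc_far : forall U i h, 1 < i < n -> 0 < h < n -> (h + 2 < i \/ i.+1 < h) ->
    Des (phi i U) h = Des U h;
  loc_up : forall U i, 1 < i -> i.+1 < n -> Des (phi i U) i.+1 != Des U i.+1 ->
    phi i.+1 U = phi i U;
  loc_down : forall U i, 2 < i < n -> Des (phi i U) i.-2 != Des U i.-2 ->
    phi i.-1 U = phi i U;
  loc_three : forall U i, 3 < i < n -> phi i.-2 U != U -> phi i U != U -> phi i.-1 U = U ->
    let W := phi i.-2 U in let V := phi i U in
    (phi i W = phi i.-1 W /\ phi i.-2 V = phi i.-1 V) \/
    [/\ phi i W = phi i.-2 V, phi i W <> phi i.-1 W & phi i.-2 V <> phi i.-1 V];
  loc_comm : forall i j U, 1 < i < n -> 1 < j < n -> i + 3 <= j ->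
    phi i (phi j U) = phi j (phi i U) }.

Hypothesis loc : local_axioms.

(** The colours [2, ..., k.-1] are those that act on the entries [1, ..., k]. *)
Definition linked k U V := exists w, all (below k) w /\ act phi w U = V.
Definition realization k (f : A -> seq int) :=
  [/\ forall U, tableau (f U) /\ size (f U) = k,
      forall U j, 0 < j < k -> Des U j = desc lti j (f U) &
      forall U i, below k i -> f (phi i U) = dd i (f U)].
Definition faithful k (f : A -> seq int) :=
  forall U V, linked k U V -> f U = f V -> U = V.

Lemma below_inv k c : k <= n -> below k c -> involutive (phi c).
Proof. by move=> kn /andP[h1 h2]; apply: (loc_inv loc); rewrite h1 (leq_trans h2). Qed.
Lemma linked_refl k U : linked k U U. Proof. by exists [::]. Qed.
Lemma linked_trans k V U W : linked k U V -> linked k V W -> linked k U W.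
Proof.
by move=> [w [h <-]] [w' [h' <-]]; exists (w ++ w'); rewrite all_cat h h' act_cat.
Qed.
Lemma linked_sym k U V : k <= n -> linked k U V -> linked k V U.
Proof.
move=> kn [w [h <-]]; exists (rev w); rewrite all_rev; split=> //.
by apply: act_rev h => c; apply: below_inv.
Qed.
Lemma linked_act k w U : all (below k) w -> linked k U (act phi w U).
Proof. by exists w. Qed.
Lemma linked1 k c U : below k c -> linked k U (phi c U).
Proof. by move=> h; exists [:: c]; rewrite /= h. Qed.
Lemma linked_sub k k' U V : k <= k' -> linked k U V -> linked k' U V.
Proof. by move=> h [w [hw e]]; exists w; split=> //; apply: sub_below hw. Qed.

(** * The next content as a threshold for descents *)

Section Step.
Variables (k : nat) (f : A -> seq int).
Hypotheses (Hr : realization k f) (Hf : faithful k f) (kn : k < n).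

Let tab U : tableau (f U). Proof. by case: Hr => h _ _; case: (h U). Qed.
Let sizf U : size (f U) = k. Proof. by case: Hr => h _ _; case: (h U). Qed.
Let desf U j : 0 < j < k -> Des U j = desc lti j (f U).
Proof. by case: Hr => _ h _; apply: h. Qed.

Lemma real_act U w : all (below k) w -> f (act phi w U) = act dd w (f U).
Proof.
case: Hr => _ _ h; elim: w U => //= c w IH U /andP[hc hw].
by rewrite IH // h.
Qed.
Lemma real_perm U V : linked k U V -> perm_eq (f U) (f V).
Proof. by move=> [w [hw <-]]; rewrite real_act // perm_sym perm_dact. Qed.
Lemma real_surj U t : tableau t -> perm_eq (f U) t -> exists V, linked k U V /\ f V = t.
Proof.
move=> ht p; have [w [hw e]] := tableau_connected (sizf U) (tab U) ht p.
by exists (act phi w U); rewrite real_act //; split=> //; exists w.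
Qed.

(** The images are joined by colours that fix the largest entry. The same word applied to [U] ends
    at a vertex with the image of [V], which is [V] by faithfulness. *)
Lemma same_head_linked U V : linked k U V -> head 0%R (f U) = head 0%R (f V) ->
  linked k.-1 U V.
Proof.
move=> hl e; case: k Hr Hf kn sizf hl => [|k'] hr hf kn' sz hl.
  by case: hl => w [hw <-]; exists w; split=> //; case: w hw => //= c w; rewrite /below andbF.
have hp : perm_eq (f U) (f V).
  by case: hl => [w [hw <-]]; case: hr => _ _ h; elim: w U hw {e hf sz} => //= c w IH U /andP[hc hw];
   apply: perm_trans (IH _ hw); rewrite h // perm_sym perm_ded.
have [h _] := tableau_connect (sz U) (tab U) (tab V) hp.
have [w [hw ew]] := h e; exists w; split=> //.
have hw' := sub_below (leqnSn k') hw.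
have hf1 : f (act phi w U) = act dd w (f U).
  case: hr => _ _ h'; elim: w U hw' {e hf hl hp h ew hw} => //= c w IH U /andP[hc hw].
  by rewrite IH // h'.
apply: hf; last by rewrite hf1.
by apply: linked_trans hl; apply: linked_sym; [apply: ltnW | apply: linked_act].
Qed.

Lemma far_linked U V : linked k.-1 U V -> 0 < k -> Des U k = Des V k.
Proof.
move=> [w [hw <-]] k0; elim: w U hw => //= c w IH U /andP[hc hw].
rewrite -IH // (loc_far loc) //; rewrite /below in hc; tab_lia.
Qed.

(** Only the two corners matter, so [U] and [V] may be replaced by [phi k.-1 W] and [W], with tops
    [a, b] and [b, a]. If [k] were a descent of the former only, [loc_up] would make [phi k] move
    [W], although neither [k.-1] nor [k] is a descent of [W]. *)
Lemma des_mono U V : linked k U V -> 0 < k -> (head 0%R (f U) <= head 0%R (f V))%R ->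
  Des U k -> Des V k.
Proof.
move=> hl k0 hle; case: (head 0%R (f U) =P head 0%R (f V)) => e.
  by rewrite (far_linked (same_head_linked hl e) k0).
have hlt : (head 0%R (f U) < head 0%R (f V))%R by tab_lia.
have p := real_perm hl.
case eU : (f U) hlt e p (tab U) (sizf U) => [|a s]; first by move=> _ _ _ _ /=; tab_lia.
case eV : (f V) (tab V) => [|b s']; first by move=> _ _ _ /perm_size.
move=> tV hlt ne p tU sz; rewrite /= in hlt ne.
have ha := tableau_head tU.
have hb : removable (a :: s) b by rewrite (perm_removable b p) tableau_head.
have [c [r [h1 h2 h3 h4]]] := two_corners tU ha hb ne.
have q : perm_eq [:: a, b, c & r] [:: b, a, c & r] by exact: perm_swap.
have [|W [lW eW]] := @real_surj U [:: b, a, c & r] h2; first by rewrite eU (perm_trans h3).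
have hk : k = (size r).+3 by rewrite -(sizf W) eW.
have bk : below k k.-1 by rewrite /below; tab_lia.
have eW' : f (phi k.-1 W) = [:: a, b, c & r].
  case: Hr => _ _ h; rewrite h // eW ded_top; last by rewrite hk.
  by rewrite dt_mid //; move: h4; rewrite /btw; tab_lia.
have lW' : linked k U (phi k.-1 W) by apply: linked_trans lW (linked1 _ bk).
have k1 : k.-1.+1 = k by tab_lia.
have -> : Des U k = Des (phi k.-1 W) k.
  by apply: far_linked k0; apply: same_head_linked => //; rewrite eU eW'.
have -> : Des V k = Des W k.
  apply: far_linked k0; apply: same_head_linked; last by rewrite eV eW.
  by apply: linked_trans lW; apply: linked_sym => //; apply: ltnW.
case: (Des (phi k.-1 W) k =P Des W k) => [->//|] /eqP nd d1.
have hb1 : 1 < k.-1 by case/andP: bk.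
have := loc_up loc hb1; rewrite k1 => /(_ W kn nd) ek.
have mv : phi k W != W by rewrite ek; apply/eqP => e; move: eW'; rewrite e eW => -[]; tab_lia.
move: mv; rewrite (loc_move loc); last by tab_lia.
have -> : Des W k.-1 = false.
  rewrite desf; last by tab_lia.
  by rewrite eW hk /= eqxx; tab_lia.
by case: (Des W k).
Qed.

Lemma threshold U : exists z, addable (f U) z /\ (0 < k -> forall V, linked k U V ->
  Des V k = (z < head 0%R (f V))%R).
Proof.
have [M [M1 M0]] := bit_far (f U).
have MM : (- M < M)%R.
  rewrite ltNge; apply/negP => h; move: (M1 M) (M0 M); rewrite h lexx.
  by move=> h1 h2; have := h1 isT; rewrite h2.
have corner V : 0 < k -> linked k U V -> removable (f U) (head 0%R (f V)).
  move=> k0 hl; rewrite (perm_removable _ (real_perm hl)).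
  case e : (f V) (tab V) (sizf V) => [|a s] h; first by move=> /= s0; move: k0; rewrite -s0.
  by move=> _; apply: tableau_head.
pose P := [pred V | connect (fun u v => has (fun c => phi c u == v) (iota 2 (k - 2))) U V
                     && Des V k && (0 < k)].
have PP V : P V <-> [/\ linked k U V, Des V k & 0 < k].
  rewrite /=; split.
    move=> /andP[/andP[/connect_act[w [hw e]] -> ->]]; split=> //; exists w; split=> //.
    by apply: sub_all hw => c; rewrite /= mem_iota /below; tab_lia.
  move=> [[w [hw e]] -> ->]; rewrite !andbT; apply/connect_act; exists w; split=> //.
  by apply: sub_all hw => c; rewrite /= mem_iota /below; tab_lia.
case: (pickP P) => [V0 PV0|none].
  (* The threshold is the last addable cell before the lowest corner that gives a descent; no corner
     lies between the two. *)
  pose V := [arg min_(V < V0 | P V) head 0%R (f V)]%O.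
  have [hV hmin] : P V /\ forall W, P W -> (head 0%R (f V) <= head 0%R (f W))%R.
    by rewrite /V; case: arg_minP.
  have /PP[lV dV k0] := hV.
  have /andP[/eqP b0 /eqP b1] := corner V k0 lV.
  have lt_lo : (- M < head 0%R (f V))%R.
    by rewrite ltNge; apply/negP => /M1; rewrite b0.
  have [||z [z1 z2 z3 z4]] := scan_down lt_lo (tab U); [exact: M1|by []|].
  exists z; split=> // _ W lW.
  case dW : (Des W k).
    by apply/esym; apply: lt_le_trans z2 _; apply: hmin; apply/PP.
  apply/esym/negbTE/negP => zW.
  case: (leP (head 0%R (f V)) (head 0%R (f W))) => hVW.
    have lVW : linked k V W by apply: linked_trans lW; apply: linked_sym => //; apply: ltnW.
    by move: (des_mono lVW k0 hVW dV); rewrite dW.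
  have /andP[_] := corner W k0 lW; rewrite z4 //; tab_lia.
(* No corner gives a descent, so the threshold is the addable cell of largest content, beyond all
   corners. *)
have [||z [z1 z2 z3 z4]] := scan_down MM (tab U); [exact: M1|exact: M0|].
exists z; split=> // k0 W lW.
case dW : (Des W k); first by have := none W; have /PP -> // : [/\ linked k U W, Des W k & 0 < k].
apply/esym/negbTE/negP => zW; have /andP[_] := corner W k0 lW.
case: (leP M (head 0%R (f W))) => h; first by rewrite M0 //; tab_lia.
rewrite z4 //; tab_lia.
Qed.

(** The threshold is unique, hence constant on classes: some vertex of the class has its largest
    entry at a corner between two candidates, and they would disagree about its descent. *)
Lemma threshold_fun : exists z : A -> int, [/\ forall U, addable (f U) (z U),
  0 < k -> forall U, Des U k = (z U < head 0%R (f U))%R &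
  forall U V, linked k U V -> z U = z V].
Proof.
have [z hz] := fin_all_exists threshold.
exists z; split=> [U|k0 U|U V hl]; first by case: (hz U).
  by case: (hz U) => _ h; apply: h => //; apply: linked_refl.
have [k0|k0] := posnP k.
  case: hl => w [hw <-]; case: w hw => //= c w; rewrite k0 /below andbF //.
case: (z U =P z V) => // ne.
have [aU hU] := hz U; have [aV hV] := hz V.
have [|e [r [w [be _ _ hw ew]]]] := addable_sep (tab U) aU _ ne.
  by rewrite (perm_addable _ (real_perm hl)).
rewrite sizf in hw.
have lW : linked k U (act phi w U) by apply: linked_act.
have hW := real_act U hw; rewrite ew in hW.
have := hU k0 _ lW; rewrite (hV k0) ?hW /=.
  by move: be; rewrite /btw; tab_lia.
by apply: linked_trans lW; apply: linked_sym => //; apply: ltnW.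
Qed.

(** * Equivariance of the extended filling for the top colour *)

Section Top.
Hypothesis (k1 : 1 < k).
Variable z : A -> int.
Hypotheses (z_add : forall U, addable (f U) (z U))
  (z_des : forall U, Des U k = (z U < head 0 (f U))%R)
  (z_linked : forall U V, linked k U V -> z U = z V).

Let tabz U : tableau (z U :: f U). Proof. by rewrite /= z_add tab. Qed.
Let knk : 1 < k < n. Proof. by rewrite k1. Qed.
Let phiK : involutive (phi k). Proof. exact: loc_inv loc _ knk. Qed.

Lemma top_shape U : exists y x s, f U = [:: y, x & s] /\ k = (size s).+2.
Proof.
have := sizf U; case: (f U) => [|y [|x s]] h; try by move: k1; rewrite -h.
by exists y, x, s.
Qed.

Lemma act_comm U w : all (below k.-2) w -> act phi w (phi k U) = phi k (act phi w U).
Proof.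
elim: w U => //= c w IH U /andP[hc hw]; rewrite -IH //; congr (act _ _ _).
by rewrite /below in hc; apply: (loc_comm loc) => //; lia.
Qed.

Lemma real_act2 U y x s w : f U = [:: y, x & s] -> all (below k.-2) w ->
  f (act phi w U) = [:: y, x & act dd w s].
Proof.
move=> e hw; have sz : k.-2 = size s by rewrite -(sizf U) e.
have h1 : all (below (size s)) w by rewrite -sz.
have h2 : all (below (size (x :: s))) w by apply: sub_below h1.
rewrite real_act; last by apply: sub_below hw; rewrite -subn2 leq_subr.
by rewrite e dact_cons // dact_cons.
Qed.

Lemma phi_pred U y x e r : f U = [:: y, x, e & r] -> f (phi k.-1 U) = dt [:: y, x, e & r].
Proof.
move=> eU; have sz : k = (size r).+3 by rewrite -(sizf U) eU.
case: Hr => _ _ h; rewrite h; last by rewrite /below sz /= ltnSn.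
by rewrite eU ded_top // sz.
Qed.

Lemma below_pred U y x e r : f U = [:: y, x, e & r] -> below k k.-1.
Proof. by move=> eU; rewrite /below -(sizf U) eU /= ltnSn. Qed.

(* If the third content separates the two others, phi_k and phi_{k-1} agree
   after moving a corner e between x and y to the end of s. *)
Lemma top_mid U y x s : f U = [:: y, x & s] -> btw lti x (z U) y ->
  linked k U (phi k U) /\ f (phi k U) = [:: x, y & s].
Proof.
move=> eU bz; have sz : k.-2 = size s by rewrite -(sizf U) eU.
have tU := tab U; rewrite eU in tU.
have n1 : y <> (x + 1)%R /\ x <> (y + 1)%R by move: bz; clear; rewrite /btw; lia.
have ay : addable s y by case: n1 => n1 n2; apply: addable_far tU n1 n2.
have ts : tableau s by case/and3P: tU.
have ax : addable s x by case/and3P: tU.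
have [|e [r [w [be _ _ hw ew]]]] := addable_sep ts ax ay.
  by move: bz; clear; rewrite /btw; lia.
rewrite -sz in hw; pose V := act phi w U.
have hwk : all (below k) w by apply: sub_below hw; rewrite -subn2 leq_subr.
have eV : f V = [:: y, x, e & r] by rewrite (real_act2 eU hw) ew.
have eV' : f (phi k.-1 V) = [:: x, y, e & r].
  by rewrite (phi_pred eV) dt_mid // btwC.
have lV : linked k U V by apply: linked_act.
have bk := below_pred eV.
have lV' : linked k U (phi k.-1 V) by apply: linked_trans lV (linked1 _ bk).
have hk : k.-1.+1 = k by rewrite prednK // ltnW.
have kk : phi k V = phi k.-1 V.
  have hb1 : 1 < k.-1 by case/andP: bk.
  have := loc_up loc hb1; rewrite hk => /(_ V kn) -> //.
  rewrite !z_des -(z_linked lV) -(z_linked lV') eV eV' /=.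
  by move: bz; clear; rewrite /btw; lia.
have e1 : act phi w (phi k U) = phi k.-1 V by rewrite act_comm // kk.
have kn' := ltnW kn.
have inv c : below k c -> involutive (phi c) by apply: below_inv.
have e2 : phi k U = act phi (rev w) (phi k.-1 V) by rewrite -e1 (act_rev _ inv).
have e3 : U = act phi (rev w) V by rewrite (act_rev _ inv).
have hrw : all (below k.-2) (rev w) by rewrite all_rev.
split.
  by rewrite e2; apply: linked_trans lV' _; apply: linked_act; rewrite all_rev.
rewrite e2 (real_act2 eV' hrw).
by have := real_act2 eV hrw; rewrite -e3 eU => -[->].
Qed.

(** The colours acting on [s] commute with [phi k], and [phi k] preserves the descents inside [s];
    rigidity applies. *)
Lemma top_tail U y x s y' x' s' : f U = [:: y, x & s] -> f (phi k U) = [:: y', x' & s'] ->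
  s = s'.
Proof.
move=> eU eV; have tU := tab U; have tV := tab (phi k U); rewrite eU in tU; rewrite eV in tV.
have sz : k.-2 = size s by rewrite -(sizf U) eU.
have sz' : k.-2 = size s' by rewrite -(sizf (phi k U)) eV.
apply: (@tableau_rigid k.-2) => //; first by case/and3P: tU.
  by case/and3P: tV.
move=> w j hw hj.
have e1 := real_act2 eU hw; have e2 := real_act2 eV hw.
have hj1 : 0 < j < k by move: hj; clear; lia.
have d1 := desf (act phi w U) hj1; have d2 := desf (act phi w (phi k U)) hj1.
rewrite e1 !desc_cons /= ?size_dact -?sz in d1; try by move: hj; clear; lia.
rewrite e2 !desc_cons /= ?size_dact -?sz' in d2; try by move: hj; clear; lia.
rewrite -d1 -d2 act_comm // (loc_far loc) //; move: hj kn; clear; lia.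
Qed.

Lemma z_neq U y x s : f U = [:: y, x & s] -> [/\ z U <> y, y <> x & z U <> x].
Proof. by move=> e; have := tabz U; rewrite e => /tableau_neq3. Qed.

Lemma top_descents U y x s : f U = [:: y, x & s] ->
  Des U k.-1 = (y < x)%R /\ Des U k = (z U < y)%R.
Proof.
move=> e; rewrite z_des e /=; split=> //.
rewrite desf; last by rewrite -(sizf U) e /= ltnSn.
by rewrite e -(sizf U) e /= eqxx.
Qed.

(** A corner [e] between [x] and [x'], moved to the top of [s], would make [phi k] change the
    descent at [k.-2]. Then [loc_down] gives [phi k.-1 W = phi k W], whose image is already known
    and does not fit. *)
Lemma top_same_x U y x s y' x' : phi k U <> U -> f U = [:: y, x & s] ->
  f (phi k U) = [:: y', x' & s] ->
  btw lti y x (z U) -> btw lti y' x' (z (phi k U)) -> x = x'.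
Proof.
move=> mv eU eV bz bz'; case: (x =P x') => // ne.
have tU := tab U; have tV := tab (phi k U); rewrite eU in tU; rewrite eV in tV.
have sz : k.-2 = size s by rewrite -(sizf U) eU.
have ts : tableau s by case/and3P: tU.
have ax : addable s x by case/and3P: tU.
have ax' : addable s x' by case/and3P: tV.
have [e [r [w [be _ _ hw ew]]]] := addable_sep ts ax ax' ne.
rewrite -sz in hw; pose W := act phi w U.
have hwk : all (below k) w by apply: sub_below hw; rewrite -subn2 leq_subr.
have eW : f W = [:: y, x, e & r] by rewrite (real_act2 eU hw) ew.
have eW' : f (phi k W) = [:: y', x', e & r] by rewrite -act_comm // (real_act2 eV hw) ew.
have sr : k = (size r).+3 by rewrite -(sizf W) eW.
have kk : phi k.-1 W = phi k W.
  have k2 : 2 < k < n by rewrite kn sr.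
  apply: (loc_down loc) => //.
  have hk2 : 0 < k.-2 < k by rewrite sr /= leqnSn.
  rewrite !desf // eW eW' sr !desc_top2.
  by move: be; clear; rewrite /btw; lia.
have lW : linked k U W by apply: linked_act.
have mvW : phi k W <> W.
  move=> e1; apply: mv; have inv c : below k c -> involutive (phi c) by apply: below_inv (ltnW kn).
  have : act phi (rev w) (phi k W) = act phi (rev w) W by rewrite e1.
  by rewrite -act_comm // !(act_rev _ inv).
have ez : z (phi k U) = z U.
  have l1 : linked k (phi k U) (phi k W) by rewrite -act_comm //; apply: linked_act.
  rewrite (z_linked l1) -kk (z_linked lW); apply/esym/z_linked/linked1.
  exact: below_pred eW.
rewrite ez in bz'.
have := phi_pred eW; rewrite kk eW' /dtop.
have := z_neq eW; have := z_neq eW'; rewrite -(z_linked lW) => -[_ n1 _] [_ n2 _].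
case: ifP => _; first by move=> -[] ? ?; subst; move: bz bz' be; clear; rewrite /btw; lia.
case: ifP => _ [] ? ?; subst; move: be; clear; rewrite /btw; lia.
Qed.

(* If z U <> y', some corner e lies between them.  After bringing e to the end of s,
   with b between x and e, [loc_three] forces e to be on the same side of z U and y'. *)
Lemma top_same_z U y x s y' : f U = [:: y, x & s] -> f (phi k U) = [:: y', x & s] ->
  phi k U <> U -> btw lti y x (z U) -> btw lti y' x (z (phi k U)) -> z U = y'.
Proof.
move=> eU eV mv bz bz'; case: (z U =P y') => // ne.
have [d1 d2] := top_descents eU; have [d1' d2'] := top_descents eV.
have mvU : phi k U != U by apply/eqP.
have [f1 f2] := loc_flip loc knk mvU.
have sg : (y < x)%R = ~~ (y' < x)%R by rewrite -d1 -d1' f1 negbK.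
have tU := tab U; have tV := tab (phi k U); rewrite eU in tU; rewrite eV in tV.
have t1 : tableau (x :: s) by case/andP: tU.
have ay' : addable (x :: s) y' by case/andP: tV.
have az : addable (x :: s) (z U).
  have := tabz U; rewrite eU => /addable_far; apply; move: bz; clear; rewrite /btw; lia.
have [e [r0 [w0 [be tr pr _ _]]]] := addable_sep t1 az ay' ne.
have rx := tableau_head t1.
have re : removable (x :: s) e by rewrite (perm_removable _ pr) tableau_head.
have nxe : x <> e by move: bz bz' be sg; clear; rewrite /btw; lia.
have [b [r [h1 h2 h3 h4]]] := two_corners t1 rx re nxe.
have sz : k.-2 = size s by rewrite -(sizf U) eU.
have ps : perm_eq s [:: e, b & r] by rewrite perm_cons in h3.
have ts : tableau s by case/andP: t1.
have teb : tableau [:: e, b & r] by case/andP: h1.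
have [w [hw ew]] := tableau_connected (esym sz) ts teb ps.
pose W := act phi w U.
have hwk : all (below k) w by apply: sub_below hw; rewrite -subn2 leq_subr.
have lW : linked k U W by apply: linked_act.
have lWV : linked k (phi k U) (phi k W) by rewrite -act_comm //; apply: linked_act.
have eW : f W = [:: y, x, e, b & r] by rewrite (real_act2 eU hw) ew.
have eV' : f (phi k W) = [:: y', x, e, b & r] by rewrite -act_comm // (real_act2 eV hw) ew.
have sr : k = (size r).+4 by rewrite -(sizf W) eW.
have bk1 : below k k.-1 by rewrite /below sr /=.
have bk2 : below k k.-2 by rewrite /below sr /= leqnSn.
have phi2 Y c : f Y = [:: c, x, e, b & r] -> f (phi k.-2 Y) = [:: c, e, x, b & r].
  move=> eY; case: Hr => _ _ h; rewrite h // eY ded_cons; last by rewrite sr /=.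
  by rewrite ded_top ?sr // dt_mid.
have eW2 := phi2 _ _ eW; have eV2 := phi2 _ _ eV'.
pose WW := phi k.-2 W; pose VV := phi k W.
have lWW : linked k U WW by apply: linked_trans lW (linked1 _ bk2).
have eW21 : f (phi k.-1 WW) = [:: e, y, x, b & r].
  by rewrite (phi_pred eW2) dt_mid //; move: bz bz' be sg; clear; rewrite /btw; lia.
have lW21 : linked k U (phi k.-1 WW) by apply: linked_trans lWW (linked1 _ bk1).
have dW2 : Des WW k = (z U < y)%R by rewrite z_des -(z_linked lWW) eW2.
have dW21 : Des (phi k.-1 WW) k = (z U < e)%R by rewrite z_des -(z_linked lW21) eW21.
have k2n : 1 < k.-1 by case/andP: bk1.
have kS : k.-1.+1 = k by rewrite sr.
have k1n : 1 < k.-1 < n by rewrite k2n; case/andP: bk1 => _ /ltn_trans ->.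
have k2n' : 1 < k.-2 < n by move: bk2 kn; clear; rewrite /below; lia.
(* [eqL] and [eqR] describe the two double edges by positions. Since [e] lies between [z U] and
   [y'], exactly one of the positional conditions holds, whereas [loc_three] allows both or none. *)
have eqL : phi k WW = phi k.-1 WW <-> (z U < y)%R != (z U < e)%R.
  split=> [e1|nz].
    have mvW : phi k WW != WW.
      apply/eqP => e2; rewrite e1 in e2; move: eW21; rewrite e2 eW2 => -[] ?.
      by move: nxe => _ ?; subst; move: bz bz' be sg; clear; rewrite /btw; lia.
    have [_] := loc_flip loc knk mvW; rewrite e1 dW21 dW2 => ->.
    by case: (z U < y)%R.
  have := loc_up loc k2n; rewrite kS => -> //.
  by rewrite dW2 dW21 eq_sym.
have eqR : phi k.-2 VV = phi k.-1 VV <-> (btw lti x y' e).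
  have eV21 := phi_pred eV'; split=> [e1|bb].
    have : [:: y', e, x, b & r] = dt [:: y', x, e, b & r] by rewrite -eV21 -e1 -eV2.
    rewrite /dtop; case: ifP => _; first by move=> [] ? ? ; subst; case/tableau_neq2: tV.
    by case: ifP => [|_ []] // ; rewrite btwC.
  apply: Hf; last first.
    rewrite eV21 eV2 /dtop (btwC e y' x) bb; case: ifP => // h.
    by move: h bb; clear; rewrite /btw; lia.
  apply: linked_trans (linked1 _ bk1).
  by apply: linked_sym (ltnW kn) _; apply: linked1.
have m2 : phi k.-2 W != W.
  by apply/eqP => e1; move: eW2; rewrite e1 eW => -[].
have mk : phi k W != W.
  rewrite (loc_move loc) //; have [-> ->] := top_descents eW.
  by rewrite -(z_linked lW); move: bz; clear; rewrite /btw; lia.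
have m1 : phi k.-1 W = W.
  apply/eqP; rewrite -[_ == _]negbK (loc_move loc) // -[k.-1.-1]/(k.-2) negbK; apply/eqP.
  have [-> _] := top_descents eW.
  rewrite desf; last by rewrite sr /= leqnSn.
  rewrite eW sr (_ : desc _ _ _ = (x < e)%R); last exact: (desc_top2 lti y x e (b :: r)).
  by move: bz bz' be sg nxe; clear; rewrite /btw; lia.
have k3 : 3 < k < n by rewrite kn sr.
have := loc_three loc k3 m2 mk m1.
rewrite -/WW -/VV => -[[/eqL h5 /eqR h6]|[_ h5 h6]].
  by move: h5 h6 bz bz' be sg; clear; rewrite /btw; lia.
have h5' : ~ ((z U < y)%R != (z U < e)%R) by move/eqL.
have h6' : ~ (btw lti x y' e) by move/eqR.
by move: h5' h6' bz bz' be sg; clear; rewrite /btw; lia.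
Qed.

(** If [z U] lies between the other two, [top_mid] applies; if this happens at the image, [top_mid]
    there leads back to [U]. Otherwise [x] is the middle content on both sides and is kept, and
    [top_same_z], used at [U] and at its image, shows that the outer contents are exchanged. *)
Lemma top_equivariant U : z (phi k U) :: f (phi k U) = dt (z U :: f U).
Proof.
have [y [x [s [eU sz]]]] := top_shape U.
have [y' [x' [s' [eV sz']]]] := top_shape (phi k U).
have es := top_tail eU eV; subst s'.
have [n1 n2 n3] := z_neq eU; have [n1' n2' n3'] := z_neq eV.
have [d1 d2] := top_descents eU; have [d1' d2'] := top_descents eV.
case: (phi k U =P U) => [e|mv].
  have := loc_move loc U knk; rewrite e eqxx d1 d2 => /esym/negbFE/eqP e1.
  rewrite eU /dtop.
  case: ifP; first by move: e1; clear; rewrite /btw; lia.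
  by case: ifP => //; move: e1; clear; rewrite /btw; lia.
have mvU : phi k U != U by apply/eqP.
have mv' : phi k (phi k U) <> phi k U by rewrite phiK => e; apply: mv.
have := mvU; rewrite (loc_move loc) // d1 d2 => sg.
have [f1 f2] := loc_flip loc knk mvU; rewrite d1 d1' d2 d2' in f1 f2.
case bz : (btw lti x (z U) y).
  have [hl e1] := top_mid eU bz; rewrite e1 -(z_linked hl) eU /dtop bz.
  by case: ifP => // b2; move: bz b2; clear; rewrite /btw; lia.
case bz' : (btw lti x' (z (phi k U)) y').
  have [hl e1] := top_mid eV bz'; rewrite phiK eU in e1 hl.
  have e2 := z_linked hl; case: e1 => ? ?; subst.
  by move: bz' bz; rewrite e2 btwC => ->.
have {}bz : btw lti y x (z U) by move: sg bz n1 n2 n3; clear; rewrite /btw; lia.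
have {}bz' : btw lti y' x' (z (phi k U)).
  by move: sg f1 f2 bz' n1' n2' n3'; clear; rewrite /btw; lia.
have ex := top_same_x mv eU eV bz bz'; subst x'.
have e1 := top_same_z eU eV mv bz bz'.
have eU' : f (phi k (phi k U)) = [:: y, x & s] by rewrite phiK.
have bz2 : btw lti y x (z (phi k (phi k U))) by rewrite phiK.
have e2 := top_same_z eV eU' mv' bz' bz2.
by rewrite eV e2 -e1 eU /dtop bz.
Qed.
End Top.

End Step.
(* Axiom 6 for the colours 2, ..., k. *)
Definition short_paths k := forall U V, linked k.+1 U V ->
  linked k U V \/ exists W, linked k U W /\ linked k (phi k W) V.

(** * Faithfulness of the extended filling *)

Section Extension.
Variables (k : nat) (f : A -> seq int) (z : A -> int).
Hypotheses (Hr : realization k f) (Hf : faithful k f) (kn : k < n).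
Hypotheses (z_add : forall U, addable (f U) (z U))
  (z_des : 0 < k -> forall U, Des U k = (z U < head 0 (f U))%R)
  (z_linked : forall U V, linked k U V -> z U = z V).
Definition ext U := z U :: f U.
Local Notation g := ext.

Lemma below_succ c : below k.+1 c -> below k c \/ c = k /\ 1 < k.
Proof. by rewrite /below; lia. Qed.

Lemma ext_real : realization k.+1 g.
Proof.
have [h1 h2 h3] := Hr; split=> [U|U j hj|U c hc].
- by have [t s] := h1 U; rewrite /= t s z_add.
- case: (j =P k) => e; last first.
    have hj' : 0 < j < k by move: hj e; clear; lia.
    rewrite desc_cons; last by case: (h1 U) => _ ->; case/andP: hj'.
    exact: h2.
  subst j; rewrite /g z_des; last by case/andP: hj.
  have [_ s] := h1 U; case: (f U) s => [|a t] s; first by move: hj; rewrite -s.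
  by rewrite -s; apply/esym/desc_top.
case: (below_succ hc) => [hc'|[-> k1]].
  rewrite /g h3 // -(z_linked (linked1 U hc')) ded_cons //.
  by have [_ ->] := h1 U; case/andP: hc'.
rewrite /g (top_equivariant Hr Hf kn k1 z_add (z_des (ltnW k1)) z_linked).
by rewrite ded_top //; have [_ s] := h1 U; rewrite /= s.
Qed.

Lemma top_cases U : 1 < k -> linked k U (phi k U) \/
  exists c c' d s, [/\ g U = [:: c, c', d & s], btw lti c d c' &
                       g (phi k U) = [:: c', c, d & s]].
Proof.
move=> k1; have zd := z_des (ltnW k1).
have [y [x [s [eU sz]]]] := top_shape Hr k1 U.
case: (phi k U =P U) => [->|/eqP mv]; first by left; apply: linked_refl.
case bz : (btw lti x (z U) y).
  by left; case: (top_mid Hr kn k1 zd z_linked eU bz).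
right; exists (z U), y, x, s.
have [n1 n2 n3] := z_neq Hr z_add eU.
have bx : btw lti (z U) x y.
  move: mv; rewrite (loc_move loc) ?k1 //; have [-> ->] := top_descents Hr zd eU.
  by move: bz n1 n2 n3; clear; rewrite /btw; lia.
split=> //; first by rewrite /g eU.
by rewrite /g (top_equivariant Hr Hf kn k1 z_add zd z_linked) eU dt_mid.
Qed.

(** A step of [phi k] that leaves its class of smaller colours changes the place of the largest
    entry, and smaller colours never restore it. A short path between vertices with the same image
    therefore contains no such step. *)
Lemma faithful_ext : (1 < k -> short_paths k) -> faithful k.+1 g.
Proof.
move=> sp U V hl [ez ef].
have [k1|k1] := leqP k 1.
  by case: hl => w [hw <-]; case: w hw => //= c w /andP[]; rewrite /below; lia.
case: (sp k1 U V hl) => [/Hf->//|[W [l1 l2]]].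
case: (top_cases W k1) => [l3|[c [c' [d [s [e1 b e2]]]]]].
  by apply: Hf => //; apply: linked_trans (linked_trans l1 l3) l2.
have e3 := z_linked l1; have e4 := z_linked l2.
have : z W = z (phi k W) by rewrite e4 -e3 ez.
move: e1 e2; rewrite /g => -[-> _] [-> _] e.
by move: b e; clear; rewrite /btw; lia.
Qed.

(* Roberts: if the 4-colour windows below k are faithfully realized, there is
   at most one k-neighbour component for each position of the largest entry,
   and these components are pairwise neighbours. *)
Section Windows.
Hypotheses (k1 : 1 < k)
  (win : 5 <= k -> forall X w, all (fun c => k - 3 <= c <= k) w ->
     g (act phi w X) = g X -> act phi w X = X).

Let tabg U : tableau (g U) /\ size (g U) = k.+1. Proof. by case: ext_real. Qed.
Let kn' := ltnW kn.

(** Both [phi k] and [phi k.-2] move [X], and [phi k.-1] fixes it. The second alternative of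
    [loc_three] gives the claim; the first would make [phi k] flip descent [k] of [phi k.-2 X],
    although [c'] and [d2] lie on the same side of [c]. *)
Lemma near_swap X c c' d d2 b r : g X = [:: c, c', d, d2, b & r] ->
  btw lti c' d d2 -> btw lti c d2 c' -> btw lti d b d2 ->
  linked k (phi k X) (phi k (phi k.-2 X)).
Proof.
move=> [ez eX] b1 b2 b3; have zd := z_des (ltnW k1).
have sz : k = (size r).+4 by have [_] := tabg X; rewrite /g eX => -[<-].
have bk2 : below k k.-2 by rewrite /below sz /= leqnSn.
have bk1 : below k k.-1 by rewrite /below sz /=.
have [_ hdes hphi] := Hr.
have e2 : f (phi k.-2 X) = [:: c', d2, d, b & r].
  rewrite hphi // eX ded_cons; last by rewrite sz /=.
  by rewrite ded_top ?sz // dt_mid.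
have e21 : f (phi k.-1 (phi k.-2 X)) = [:: d2, c', d, b & r].
  by rewrite (phi_pred Hr e2) dt_mid // btwC; move: b1; rewrite btwC.
have [t1 t2] := top_descents Hr zd eX.
have m2 : phi k.-2 X != X.
  apply/eqP => e; move: e2; rewrite e eX => -[] e'.
  by move: b3; rewrite e'; clear; rewrite /btw; lia.
have mk : phi k X != X.
  rewrite (loc_move loc) ?k1 // t1 t2 ez.
  by move: b1 b2 b3; clear; rewrite /btw; lia.
have k1n : 1 < k.-1 < n by move: bk1 kn; clear; rewrite /below; lia.
have m1 : phi k.-1 X = X.
  apply/eqP; rewrite -[_ == _]negbK (loc_move loc) // -[k.-1.-1]/(k.-2) negbK; apply/eqP.
  rewrite t1 hdes; last by rewrite sz /= leqnSn.
  rewrite eX sz (_ : desc _ _ _ = (d < d2)%R); last exact: (desc_top2 lti c' d d2 (b :: r)).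
  by move: b1 b2 b3; clear; rewrite /btw; lia.
have k3 : 3 < k < n by rewrite kn sz.
have := loc_three loc k3 m2 mk m1 => /= -[[e _]|[-> _ _]]; last exact: linked1.
have l2 : linked k X (phi k.-2 X) := linked1 X bk2.
have l21 : linked k (phi k.-2 X) (phi k.-1 (phi k.-2 X)) := linked1 _ bk1.
have mW : phi k (phi k.-2 X) != phi k.-2 X.
  rewrite e; apply/eqP => e'; move: e21; rewrite e' e2 => -[] h _.
  by move: b1; rewrite h; clear; rewrite /btw; lia.
have k1kn : 1 < k < n by rewrite k1.
have [_] := loc_flip loc k1kn mW; rewrite e !zd -(z_linked l21) -(z_linked l2) ez e2 e21 /=.
by move: b1 b2 b3; clear; rewrite /btw; lia.
Qed.

(** The tails differ by colours below [k.-2], which commute with [phi k]. *)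
Lemma near_same U V c c' d s s2 : linked k U V -> g U = [:: c, c', d & s] ->
  g V = [:: c, c', d & s2] -> linked k (phi k U) (phi k V).
Proof.
move=> hl [ez eU] [ez' eV].
have [/= tU _] := tabg U; have [/= tV _] := tabg V; rewrite eU in tU; rewrite eV in tV.
have ts : tableau s by case/and4P: tU.
have ts' : tableau s2 by case/and4P: tV.
have ps : perm_eq s s2.
  by have := real_perm Hr hl; rewrite eU eV !perm_cons.
have sz : k.-2 = size s by have [_ h _] := Hr; have [h' _ _] := Hr; case: (h' U) => _; rewrite eU => <-.
have [w [hw ew]] := tableau_connected (esym sz) ts ts' ps.
have hwk : all (below k) w by apply: sub_below hw; rewrite -subn2 leq_subr.
have -> : V = act phi w U.
  apply: Hf; last by rewrite (real_act2 Hr eU hw) ew.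
  by apply: linked_trans (linked_sym kn' hl) _; apply: linked_act.
by rewrite -(act_comm kn) //; apply: linked_act.
Qed.

(** Different [d] and [d2] are corners of the same shape. Bringing both to the top in either order
    gives [X] and [Y], exchanged by [phi k.-2], and [near_swap] compares their images. *)
Lemma near_unique U V c c' d d2 s s2 : linked k U V -> g U = [:: c, c', d & s] ->
  g V = [:: c, c', d2 & s2] -> btw lti c d c' -> btw lti c d2 c' ->
  linked k (phi k U) (phi k V).
Proof.
move=> hl eU eV b b2; case: (d =P d2) => [e|ne].
  by rewrite -e in eV; apply: near_same hl eU eV.
have [ez efU] := eU; have [ez' efV] := eV.
have [/= tU _] := tabg U; have [/= tV _] := tabg V; rewrite efU in tU; rewrite efV in tV.
have ac : addable (d :: s) c' by case/and4P: tU.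
have td : tableau (d :: s) by case/andP: tU => _ /andP[].
have td2 : tableau (d2 :: s2) by case/andP: tV => _ /andP[].
have pd : perm_eq (d :: s) (d2 :: s2) by have := real_perm Hr hl; rewrite efU efV !perm_cons.
have r1 := tableau_head td.
have r2 : removable (d :: s) d2 by rewrite (perm_removable _ pd) tableau_head.
have [e [r [h1 h2 h3 h4]]] := two_corners td r1 r2 ne.
have p1 : perm_eq (f U) [:: c', d, d2, e & r] by rewrite efU perm_cons.
have p2 : perm_eq (f U) [:: c', d2, d, e & r].
  by apply: perm_trans p1 _; rewrite perm_cons perm_swap.
have t1 : tableau [:: c', d, d2, e & r] by rewrite tableau_cons h1 -(perm_addable c' h3) ac.
have t2 : tableau [:: c', d2, d, e & r].
  by rewrite tableau_cons h2 -(perm_addable c' (perm_swap _ _ _)); case/andP: t1 => ->.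
have [X [lX eX]] := real_surj Hr t1 p1; have [Y [lY eY]] := real_surj Hr t2 p2.
have gX : g X = [:: c, c', d, d2, e & r] by rewrite /g eX -(z_linked lX) ez.
have gY : g Y = [:: c, c', d2, d, e & r] by rewrite /g eY -(z_linked lY) ez.
have l1 := near_same lX eU gX.
have lYV : linked k Y V := linked_trans (linked_sym kn' lY) hl.
have l2 := near_same lYV gY eV.
have sz : k = (size r).+4 by have [_] := tabg X; rewrite gX => -[<-].
have bk2 : below k k.-2 by rewrite /below sz /= leqnSn.
have [_ _ hphi] := Hr.
have flip T x y : f T = [:: c', x, y, e & r] -> btw lti x e y ->
    f (phi k.-2 T) = [:: c', y, x, e & r].
  move=> eT bT; rewrite hphi // eT ded_cons; last by rewrite sz.
  by rewrite ded_top ?sz // dt_mid.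
have eXY : phi k.-2 X = Y.
  apply: Hf; last by rewrite (flip _ _ _ eX h4) eY.
  apply: linked_trans (linked_sym kn' (linked1 X bk2)) _.
  by apply: linked_trans lY; apply: linked_sym.
have eYX : phi k.-2 Y = X by rewrite -eXY (below_inv kn' bk2).
have l3 : linked k (phi k X) (phi k Y).
  have h4' : btw lti d2 e d by rewrite btwC.
  case bb : (btw lti c' d d2); first by rewrite -eXY; apply: near_swap gX bb b2 h4.
  have bb' : btw lti c' d2 d by move: bb ne b b2; clear; rewrite /btw; lia.
  by apply: linked_sym => //; rewrite -eYX; apply: near_swap gY bb' b h4'.
exact: linked_trans l1 (linked_trans l3 l2).
Qed.

Definition near U V := linked k U V \/ exists W, linked k U W /\ linked k (phi k W) V.

(** By [near_unique] the two given [phi k]-steps follow two sides of the triangle [X0], [X1], [X2],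
    up to smaller colours. Its third side, traversed backwards, joins the ends by a single
    [phi k]-step. *)
Lemma loop_near U W V (X0 X1 X2 : A) u0 u1 u2 c0 c1 c2 d0 d1 d2 s0 s1 s2 e1 s' e0 s'' :
  all (below k) u0 -> all (below k) u1 -> all (below k) u2 ->
  X1 = act phi (k :: u0) X0 -> X2 = act phi (k :: u1) X1 -> X0 = act phi (k :: u2) X2 ->
  g X0 = [:: c0, c1, d0 & s0] -> g X1 = [:: c1, c2, d1 & s1] -> g X2 = [:: c2, c0, d2 & s2] ->
  btw lti c0 d0 c1 -> btw lti c1 d1 c2 ->
  linked k U W -> linked k W X0 -> g W = [:: c0, c1, e0 & s''] -> btw lti c0 e0 c1 ->
  linked k (phi k W) V -> g V = [:: c1, c2, e1 & s'] -> btw lti c1 e1 c2 ->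
  near U (phi k V).
Proof.
move=> h0 h1 h2 E1 E2 E0 g0 g1 g2 b0 b1 lUW lW gW bW lWV gV bV.
have L1 : linked k (phi k X0) X1 by exists u0; rewrite E1.
have L2 : linked k (phi k X1) X2 by exists u1; rewrite E2.
have L0 : linked k (phi k X2) X0 by exists u2; rewrite [in RHS]E0.
have N0 := near_unique lW gW g0 bW b0.
have l1 : linked k V X1.
  by apply: linked_trans (linked_sym kn' lWV) _; apply: linked_trans N0 L1.
have N1 := near_unique l1 gV g1 bV b1.
have phiK : phi k (phi k X2) = X2 by apply: loc_inv loc _ _ _; rewrite k1.
right; exists (phi k X2); split.
  by apply: linked_trans lUW _; apply: linked_trans lW _; apply: linked_sym.
rewrite phiK; apply: linked_sym => //; exact: linked_trans N1 L2.
Qed.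
(** The triangle is known only for tableaux. Its lift to [A] ends at a vertex with the same image as
    its start, and [win] identifies the two. *)
Lemma loop_near_model U W V T0 T1 T2 u0 u1 u2 c0 c1 c2 d0 d1 d2 s0 s1 s2 e1 s' e0 s'' :
  5 <= k -> all (fun c => k - 3 <= c < k) (u0 ++ u1 ++ u2) ->
  act dd (k :: u0) T0 = T1 -> act dd (k :: u1) T1 = T2 -> act dd (k :: u2) T2 = T0 ->
  tableau T0 -> perm_eq (g W) T0 ->
  T0 = [:: c0, c1, d0 & s0] -> T1 = [:: c1, c2, d1 & s1] -> T2 = [:: c2, c0, d2 & s2] ->
  btw lti c0 d0 c1 -> btw lti c1 d1 c2 ->
  linked k U W -> g W = [:: c0, c1, e0 & s''] -> btw lti c0 e0 c1 ->
  linked k (phi k W) V -> g V = [:: c1, c2, e1 & s'] -> btw lti c1 e1 c2 ->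
  near U (phi k V).
Proof.
move=> k5 hu E0 E1 E2 tT pT eT0 eT1 eT2 b0 b1 lUW gW bW lWV gV bV.
have [t0 p0] : tableau [:: c1, d0 & s0] /\ perm_eq (f W) [:: c1, d0 & s0].
  move: pT tT; rewrite eT0 /g; case: gW => -> _; rewrite perm_cons => ->.
  by rewrite tableau_cons => /andP[].
have [X [lX eX]] := real_surj Hr t0 p0.
have gX : g X = T0 by rewrite /g eX -(z_linked lX) eT0; case: gW => ->.
have hb u : all (fun c => k - 3 <= c < k) u -> all (below k) u.
  by apply: sub_all => c; rewrite /below; move: k5; clear; lia.
have hw u : all (fun c => k - 3 <= c < k) u -> all (fun c => k - 3 <= c <= k) (k :: u).
  move=> hu'; rewrite /= leqnn leq_subr /=; apply: sub_all hu' => c.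
  by case/andP=> -> /ltnW.
have hk u : all (fun c => k - 3 <= c < k) u -> all (below k.+1) (k :: u).
  move=> hu'; rewrite /= {1}/below k1 ltnSn /=; apply: sub_below (hb _ hu'); exact: leqnSn.
move: hu; rewrite !all_cat => /and3P[h0 h1 h2].
have ga := real_act ext_real.
have g1 : g (act phi (k :: u0) X) = T1 by rewrite ga ?hk // gX.
have g2 : g (act phi (k :: u1) (act phi (k :: u0) X)) = T2 by rewrite ga ?hk // g1.
have X0 : X = act phi (k :: u2) (act phi (k :: u1) (act phi (k :: u0) X)).
  apply/esym; rewrite -!act_cat; apply: win => //; last by rewrite !act_cat ga ?hk // g2 E2 gX.
  by rewrite !all_cat !hw.
apply: (loop_near (hb _ h0) (hb _ h1) (hb _ h2) erefl erefl X0 _ _ _ b0 b1 lUW lX gW bW lWV gV bV).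
- exact: etrans gX eT0.
- exact: etrans g1 eT1.
- exact: etrans g2 eT2.
Qed.

Lemma near_step U V c : near U V -> below k.+1 c -> near U (phi c V).
Proof.
move=> hn /below_succ[hc|[-> _]].
  case: hn => [l|[W [l1 l2]]]; first by left; apply: linked_trans l (linked1 _ hc).
  by right; exists W; split=> //; apply: linked_trans l2 (linked1 _ hc).
case: hn => [l|[W [l1 l2]]]; first by right; exists V; split=> //; apply: linked_refl.
case: (top_cases V k1) => [l|[c1 [c2 [d' [s' [gV bV _]]]]]].
  by right; exists W; split=> //; apply: linked_trans l2 l.
case: (top_cases W k1) => [l|[c0 [c1' [d [s [gW bW gW']]]]]].
  right; exists V; split; last exact: linked_refl.
  exact: linked_trans (linked_trans l1 l) l2.
have ec : c1' = c1.
  by have := z_linked l2; case: gW' => -> _; case: gV => -> _.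
subst c1'.
case: (c0 =P c2) => [e|ne].
  left; rewrite -e in gV bV; have bW' : btw lti c1 d c0 by rewrite btwC.
  have := near_unique l2 gW' gV bW' bV.
  have -> : phi k (phi k W) = W by apply: loc_inv loc _ _ _; rewrite k1.
  exact: linked_trans.
have pWV : perm_eq (g W) (g V).
  apply: (real_perm ext_real); apply: (@linked_trans _ (phi k W)).
    by apply: linked1; rewrite /below k1 ltnSn.
  exact: linked_sub (leqnSn k) l2.
have [tW sW] := tabg W; have [tV sV] := tabg V.
have r0 : removable (g W) c0 by move: tW; rewrite gW; apply: tableau_head.
have r1 : removable (g W) c1 by rewrite (perm_removable _ pWV); move: tV; rewrite gV; apply: tableau_head.
have r2 : removable (g W) c2.
  rewrite (perm_removable _ pWV) gV -(perm_removable _ (perm_swap _ _ _)).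
  apply: tableau_head; move: tV; rewrite gV; apply: tableau_swap.
    by move: bV; clear; rewrite /btw; lia.
  by move: bV; clear; rewrite /btw; lia.
have n01 : c0 <> c1 by move: bW; clear; rewrite /btw; lia.
have n12 : c1 <> c2 by move: bV; clear; rewrite /btw; lia.
(* [corner_loop] runs [p, q, r, p] with [q] in the middle. Depending on which corner is in the
   middle, the steps from [c0] to [c1] to [c2] begin at its first, second or third vertex. *)
have [bq|[bq|bq]] : btw lti c0 c1 c2 \/ btw lti c2 c0 c1 \/ btw lti c1 c2 c0.
  by move: n01 n12 ne; clear; rewrite /btw; lia.
- have [b [b' [a [u [tT pT bb bb' ba]]]]] := three_corners tW r0 r1 r2 bq.
  have [E0 E1 E2] := corner_loop u bq bb bb' ba.
  have sk : k = (size u).+4.+1 by move: (perm_size pT); rewrite sW => -[].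
  rewrite -sk in E0 E1 E2.
  apply: (loop_near_model _ _ E0 E1 E2 tT pT erefl erefl erefl bb bb' l1 gW bW l2 gV bV).
    by rewrite sk.
  by rewrite /= sk; clear; lia.
- have [b [b' [a [u [tT pT bb bb' ba]]]]] := three_corners tW r2 r0 r1 bq.
  have [E0 E1 E2] := corner_loop u bq bb bb' ba.
  have sk : k = (size u).+4.+1 by move: (perm_size pT); rewrite sW => -[].
  rewrite -sk in E0 E1 E2.
  have tT1 : tableau [:: c0, c1, b', c2, b, a & u] by rewrite -E0; apply: tableau_dact.
  have pT1 : perm_eq (g W) [:: c0, c1, b', c2, b, a & u].
    by apply: (perm_trans pT); rewrite -E0 perm_sym perm_dact.
  have bc : btw lti c1 c0 c2 by rewrite btwC.
  apply: (loop_near_model _ _ E1 E2 E0 tT1 pT1 erefl erefl erefl bb' bc l1 gW bW l2 gV bV).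
    by rewrite sk.
  by rewrite /= sk; clear; lia.
have [b [b' [a [u [tT pT bb bb' ba]]]]] := three_corners tW r1 r2 r0 bq.
have [E0 E1 E2] := corner_loop u bq bb bb' ba.
have sk : k = (size u).+4.+1 by move: (perm_size pT); rewrite sW => -[].
rewrite -sk in E0 E1 E2.
have tT2 : tableau [:: c0, c1, c2, b', b, a & u].
  by rewrite -E1; apply: tableau_dact; rewrite -E0; apply: tableau_dact.
have pT2 : perm_eq (g W) [:: c0, c1, c2, b', b, a & u].
  apply: (perm_trans pT); rewrite -E1 perm_sym (permPl (perm_dact _ _ _)) -E0.
  exact: perm_dact.
have bc : btw lti c0 c2 c1 by rewrite btwC.
apply: (loop_near_model _ _ E2 E0 E1 tT2 pT2 erefl erefl erefl bc bb l1 gW bW l2 gV bV).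
  by rewrite sk.
by rewrite /= sk; clear; lia.
Qed.

Lemma short_of_windows : short_paths k.
Proof.
move=> U V [w [hw <-]]; rewrite -/(near U _).
elim/last_ind: w hw => [|w c IH]; first by move=> _; left; apply: linked_refl.
by rewrite all_rcons act_rcons => /andP[hc /IH hn]; apply: near_step.
Qed.
End Windows.
End Extension.

Definition window_faithful k (g : A -> seq int) := forall X w,
  all (fun c => k - 3 <= c <= k) w -> g (act phi w X) = g X -> act phi w X = X.

(** The hypothesis covers both directions: axiom 6 is either given, or derived from faithful windows
    of the realization that has just been extended. *)
Theorem faithful_realization k : k <= n ->
  (forall k, 1 < k < n -> short_paths k \/
     (5 <= k -> forall g, realization k.+1 g -> window_faithful k g)) ->
  exists f, realization k f /\ faithful k f.
Proof.
move=> kn H; elim: k kn => [|k IH] kn.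
  exists (fun=> [::]); split; first by split=> // U i; rewrite /below andbF.
  by move=> U V [[|c w] [hw <-]] //; move: hw; rewrite /= /below andbF.
have [f [Hr Hf]] := IH (ltnW kn).
have [z [z1 z2 z3]] := threshold_fun Hr Hf kn.
have hg := ext_real Hr Hf kn z1 z2 z3.
exists (ext f z); split=> //; apply: (faithful_ext Hr Hf kn z1 z2 z3) => k1.
have k1n : 1 < k < n by rewrite k1.
case: (H k k1n) => // hw; apply: (short_of_windows Hr Hf kn z1 z2 z3 k1) => k5 X w.
exact: hw.
Qed.

(** The word with at most one letter [k] that joins the two tableaux lifts, and faithfulness
    identifies its end. *)
Lemma short_of_faithful k g : 1 < k < n -> realization k.+1 g -> faithful k.+1 g ->
  short_paths k.
Proof.
move=> /andP[k1 kn] hr hf U V hl.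
have [h1 h2 h3] := hr; have [tU sU] := h1 U; have [tV sV] := h1 V.
have lift w : all (below k.+1) w -> act dd w (g U) = g V -> V = act phi w U.
  move=> hw e; apply: hf; last by rewrite (real_act hr) // e.
  by apply: linked_trans (linked_sym kn hl) _; apply: linked_act.
have [c1 c2] := tableau_connect sU tU tV (real_perm hr hl).
case: (head 0%R (g U) =P head 0%R (g V)) => [/c1[w [hw ew]]|/c2[_ [w1 [w2 [hw1 hw2 ew]]]]].
  left; rewrite (lift w (sub_below (leqnSn k) hw) ew); exact: linked_act.
right; exists (act phi w1 U); split; first exact: linked_act.
rewrite (lift _ _ ew); last first.
  by rewrite all_cat /= (sub_below _ hw1) // (sub_below _ hw2) // /below k1 ltnSn.
by rewrite act_cat act_cons; apply: linked_act.
Qed.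
End Structure.

(** * Descent sets in the expansion of a Schur function *)

Fixpoint bits (r : nat) : seq (seq bool) :=
  if r is r'.+1 then map (cons false) (bits r') ++ map (cons true) (bits r') else [:: [::]].
Definition subbits (d e : seq bool) := all2 implb d e.
(** The monomial starting at 1 that increases by one exactly at the positions of [e]. There the
    coefficient of a fundamental quasisymmetric function tests inclusion of its descent set in
    [e]. *)
Definition canonical (e : seq bool) : seq nat := 1 :: scanl (fun x (b : bool) => x + b) 1 e.
Fixpoint compositions (f m : nat) : seq (seq nat) :=
  if m == 0 then [:: [::]]
  else if f is f'.+1 then
    flatten [seq map (cons p) (compositions f' (m - p)) | p <- iota 1 m]
  else [::].
Definition partitions m := [seq la <- compositions m m | sorted geq la].

Lemma mem_bits r (e : seq bool) : size e = r -> e \in bits r.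
Proof.
elim: r e => [|r IH] [|b e] //= [/IH he].
by rewrite mem_cat; case: b; rewrite map_f ?orbT.
Qed.

Lemma mem_compositions f m la : m <= f -> all (fun p => 0 < p) la -> sumn la = m ->
  la \in compositions f m.
Proof.
elim: f m la => [|f IH] m [|p la] /=.
- by move=> _ _ <-.
- by rewrite leqn0 => /eqP -> /andP[]; lia.
- by move=> _ _ <-.
move=> hm /andP[p0 hla] e; have /negbTE -> : m != 0 by lia.
apply/flattenP; exists (map (cons p) (compositions f (m - p))).
  by apply/mapP; exists p => //; rewrite mem_iota; lia.
by apply: map_f; apply: IH => //; lia.
Qed.
Lemma mem_partitions m la : is_partition la m -> la \in partitions m.
Proof.
move=> /and3P[h1 h2 /eqP h3]; rewrite mem_filter h1 /=.
exact: mem_compositions.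
Qed.

(** Inclusion counts determine a multiset of sets. A leading [false] in [e] counts only the vectors
    starting with [false], a leading [true] counts all, so subtraction separates the two kinds. *)
Lemma subbits_perm r (X Y : seq (seq bool)) :
  all (fun x => size x == r) X -> all (fun x => size x == r) Y ->
  (forall e, size e = r -> count (subbits^~ e) X = count (subbits^~ e) Y) -> perm_eq X Y.
Proof.
pose part b (Z : seq (seq bool)) := [seq behead x | x <- Z & head false x == b].
elim: r X Y => [|r IH] X Y hX hY H.
  have nil Z : all (fun x : seq bool => size x == 0) Z -> Z = nseq (size Z) [::].
    by elim: Z => //= z Z IH /andP[/nilP -> /IH {1}->].
  have cnil Z : all (fun x : seq bool => size x == 0) Z -> count (subbits^~ [::]) Z = size Z.
    by elim: Z => //= z Z IH /andP[/nilP -> /IH ->].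
  by rewrite (nil X hX) (nil Y hY) -(cnil X) // -(cnil Y) // H.
have hpart b Z : all (fun x : seq bool => size x == r.+1) Z ->
    all (fun x => size x == r) (part b Z).
  move=> hZ; apply/allP => y /mapP[x]; rewrite mem_filter => /andP[_ hx] ->.
  by rewrite size_behead (eqP (allP hZ x hx)).
have c0 e Z : all (fun x : seq bool => size x == r.+1) Z ->
    count (subbits^~ (false :: e)) Z = count (subbits^~ e) (part false Z).
  by elim: Z => //= -[//|[] z] Z IHZ /andP[_ /IHZ ->].
have c1 e Z : all (fun x : seq bool => size x == r.+1) Z ->
    count (subbits^~ (true :: e)) Z =
      count (subbits^~ e) (part false Z) + count (subbits^~ e) (part true Z).
  elim: Z => //= -[//|[] z] Z IHZ /andP[_ /IHZ ->] /=; last by rewrite addnA.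
  by rewrite addnCA.
have split Z : all (fun x : seq bool => size x == r.+1) Z ->
    perm_eq Z (map (cons false) (part false Z) ++ map (cons true) (part true Z)).
  elim: Z => //= -[//|[] z] Z IHZ /andP[_ /IHZ h] /=; last by rewrite perm_cons.
  apply/permP => p; move/permP/(_ p): h; rewrite /= !count_cat /= => ->; exact: addnCA.
have p0 : perm_eq (part false X) (part false Y).
  apply: IH; [exact: hpart|exact: hpart|move=> e se].
  by rewrite -!c0 //; apply: H; rewrite /= se.
have p1 : perm_eq (part true X) (part true Y).
  apply: IH; [exact: hpart|exact: hpart|move=> e se].
  have := H (true :: e); rewrite !c1 //= se => /(_ erefl).
  by rewrite -!c0 // H /= ?se // => /addnI.
apply: (perm_trans (split X hX)); rewrite perm_sym; apply: (perm_trans (split Y hY)).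
by rewrite perm_sym perm_cat // perm_map.
Qed.

Lemma perm_lift (S T : eqType) (f : S -> T) s L : perm_eq (map f s) L ->
  exists us, perm_eq us s /\ map f us = L.
Proof.
elim: L s => [|d L IH] s h.
  by exists [::]; split=> //; move/perm_size: h; rewrite size_map; case: s.
have : d \in map f s by rewrite (perm_mem h) mem_head.
case/mapP => x /perm_to_rem hx ed.
have [|us [h1 h2]] := IH (rem x s).
  by move: h; rewrite (permPl (perm_map f hx)) /= -ed perm_cons.
exists (x :: us); rewrite /= h2 -ed; split=> //.
by rewrite perm_sym (permPl hx) perm_cons perm_sym.
Qed.

(* The descent sets of the standard tableaux of a fixed shape of size m, in the
   order in which axiom 4 lists the vertices. *)
Definition descent_lists (m : nat) : seq (seq (seq bool)) :=
  let t := true in let f := false in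
  match m with
  | 3 => [:: [:: [:: f; f]]; [:: [:: t; t]]; [:: [:: t; f]; [:: f; t]]]
  | 4 => [:: [:: [:: f; f; f]]; [:: [:: t; t; t]]; [:: [:: f; t; f]; [:: t; f; t]];
             [:: [:: t; f; f]; [:: f; t; f]; [:: f; f; t]];
             [:: [:: f; t; t]; [:: t; f; t]; [:: t; t; f]]]
  | 5 => [:: [:: [:: f; f; f; f]]; [:: [:: t; t; t; t]];
             [:: [:: t; f; f; f]; [:: f; t; f; f]; [:: f; f; t; f]; [:: f; f; f; t]];
             [:: [:: f; t; t; t]; [:: t; f; t; t]; [:: t; t; f; t]; [:: t; t; t; f]];
             [:: [:: f; t; f; f]; [:: t; f; t; f]; [:: t; f; f; t]; [:: f; t; f; t];
                 [:: f; f; t; f]];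
             [:: [:: t; f; t; t]; [:: f; t; f; t]; [:: f; t; t; f]; [:: t; f; t; f];
                 [:: t; t; f; t]];
             [:: [:: t; t; f; f]; [:: t; f; t; f]; [:: f; t; t; f]; [:: t; f; f; t];
                 [:: f; t; f; t]; [:: f; f; t; t]]]
  | _ => [::]
  end.

Lemma schur_descents m la : 3 <= m <= 5 -> is_partition la m ->
  exists2 L, L \in descent_lists m & forall e, size e = m.-1 ->
    schur_coef la (canonical e) = count (subbits^~ e) L.
Proof.
move=> hm hla.
have chk : all (fun m => all (fun la =>
   let tab := [seq schur_coef la (canonical e) | e <- bits m.-1] in
   has (fun L => tab == [seq count (subbits^~ e) L | e <- bits m.-1]) (descent_lists m))
   (partitions m)) [:: 3; 4; 5] by vm_compute.
have mm : m \in [:: 3; 4; 5] by rewrite !inE; lia.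
have /hasP[L hL /eqP h] := allP (allP chk m mm) la (mem_partitions hla).
move/eq_in_map: h => h; exists L; first exact: hL.
by move=> e /mem_bits; exact: h.
Qed.

Lemma fundQ_canonical m d e : 3 <= m <= 6 -> size d = m.-1 -> size e = m.-1 ->
  fundQ_coef m (fun j => nth false d j.-1) (canonical e) = subbits d e.
Proof.
move=> hm sd se.
have chk : all (fun m => all (fun d => all (fun e =>
   fundQ_coef m (fun j => nth false d j.-1) (canonical e) == subbits d e)
   (bits m.-1)) (bits m.-1)) [:: 3; 4; 5; 6] by vm_compute.
have mm : m \in [:: 3; 4; 5; 6] by rewrite !inE; lia.
by have /eqP := allP (allP (allP chk m mm) d (mem_bits sd)) e (mem_bits se).
Qed.

Lemma canonical_ok e m : size e = m.-1 -> 0 < m -> monomial_ok m (canonical e).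
Proof.
move=> se m0; rewrite /monomial_ok /canonical /= size_scanl se prednK // eqxx /=.
have h x : 0 < x -> path leq x (scanl (fun x (b : bool) => x + b) x e) &&
    all (fun y => 0 < y) (scanl (fun x (b : bool) => x + b) x e).
  elim: e x {se} => //= b e IH x hx.
  by have /andP[-> ->] := IH (x + b) (ltn_addr _ hx); rewrite leq_addr ltn_addr.
exact: h.
Qed.

(** * Classes of at most three consecutive colours *)

(* Row j lists, for each vertex of [descent_lists], its neighbour for the j-th colour. *)
Definition edge_tables (m k : nat) : seq (seq nat) :=
  match m, k with
  | 4, 1 => [:: [:: 0]; [:: 0]]
  | 4, 2 => [:: [:: 1; 0]; [:: 1; 0]]
  | 4, 3 => [:: [:: 1; 0; 2]; [:: 0; 2; 1]]
  | 5, 1 => [:: [:: 0]; [:: 0]; [:: 0]]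
  | 5, 4 => [:: [:: 1; 0; 2; 3]; [:: 0; 2; 1; 3]; [:: 0; 1; 3; 2]]
  | 5, 5 => [:: [:: 1; 0; 3; 2; 4]; [:: 1; 0; 2; 4; 3]; [:: 0; 2; 1; 4; 3]]
  | 5, 6 => [:: [:: 0; 2; 1; 4; 3; 5]; [:: 1; 0; 2; 3; 5; 4]; [:: 0; 3; 4; 1; 2; 5]]
  | _, _ => [::]
  end.

Section Candidates.
Variable L : seq (seq bool).
Let k := size L.
Definition lbit (a j : nat) := nth false (nth [::] L a) j.
(** The restriction imposed by a single colour: it fixes a vertex whose two descents agree, and
    otherwise flips both. *)
Definition targets j a : seq nat :=
  if lbit a j == lbit a j.+1 then [:: a]
  else [seq b <- iota 0 k | (lbit b j == ~~ lbit a j) && (lbit b j.+1 == ~~ lbit a j.+1)].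
Definition candidates j : seq (seq nat) :=
  [seq p <- foldr (fun a acc => [seq b :: p | b <- targets j a, p <- acc]) [:: [::]] (iota 0 k)
     | all (fun a => nth 0 p (nth 0 p a) == a) (iota 0 k)].
(** [compat_up] and [compat_down] are [loc_up] and [loc_down] in terms of tables. *)
Definition compat_up j p q := all (fun a =>
  (lbit (nth 0 p a) j.+2 != lbit a j.+2) ==> (nth 0 q a == nth 0 p a)) (iota 0 k).
Definition compat_down j p q := all (fun a =>
  (lbit (nth 0 p a) j.-1 != lbit a j.-1) ==> (nth 0 q a == nth 0 p a)) (iota 0 k).
(** Connectedness in a form that can be evaluated: some vertex [t] lies in no proper subset closed
    under the colours. *)
Definition connected_table (ps : seq (seq nat)) := has (fun t => all (fun S =>
  nth false S t && all (fun p => all (fun a => nth false S a ==> nth false S (nth 0 p a))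
    (iota 0 k)) ps ==> all id S) (bits k)) (iota 0 k).
Lemma mem_choices (c : nat -> seq nat) s (g : nat -> nat) :
  {in s, forall a, g a \in c a} ->
  map g s \in foldr (fun a acc => [seq b :: p | b <- c a, p <- acc]) [:: [::]] s.
Proof.
elim: s => //= a s IH h; apply/allpairsP; exists (g a, map g s); split=> //=.
  by apply: h; rewrite mem_head.
by apply: IH => b hb; apply: h; rewrite inE hb orbT.
Qed.
End Candidates.

(** * Reconstruction of the involutions from the Schur expansions *)

Section FromSchur.
Variables (A : finType) (n : nat) (Des : A -> pred nat) (phi : nat -> A -> A).
Hypothesis Hinv : forall i, 1 < i < n -> involutive (phi i).
Hypothesis Hde : dual_equivalence n Des phi.

Definition window_bits h m U := [seq Des U (h.-1 + j) | j <- iota 0 m.-1].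
Lemma size_window_bits h m U : size (window_bits h m U) = m.-1.
Proof. by rewrite size_map size_iota. Qed.
Lemma nth_window_bits h m U j : j < m.-1 -> nth false (window_bits h m U) j = Des U (h.-1 + j).
Proof. by move=> hj; rewrite (nth_map 0) ?size_iota // nth_iota. Qed.

Lemma fundQ_window h i U s : 1 < h -> h <= i ->
  fundQ_coef (i - h + 3) (Des_hi Des h i U) s =
  fundQ_coef (i - h + 3) (fun j => nth false (window_bits h (i - h + 3) U) j.-1) s.
Proof.
move=> h1 hi; congr (nat_of_bool _); apply: eq_in_all => j; rewrite mem_iota => hj.
congr (_ ==> _); rewrite nth_window_bits; last by move: hj; clear; lia.
rewrite /Des_hi; have -> : (0 < j <= i - h + 2) by move: hj; clear; lia.
by congr (Des U _); move: hj h1; clear; lia.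
Qed.

Lemma sum_count (C : {set A}) (b : A -> bool) :
  \sum_(U in C) (b U : nat) = count b (enum C).
Proof. by rewrite -big_enum /=; elim: (enum C) => [|x s IH]; rewrite ?big_nil ?big_cons //= IH. Qed.

(** Coefficients at canonical monomials are inclusion counts, so the expansion fixes the multiset of
    descent sets and the class can be listed in the order of the table. *)
Lemma window_class h i T : 1 < h -> h <= i -> i < n -> i - h <= 2 ->
  exists L us, [/\ L \in descent_lists (i - h + 3), uniq us,
    us =i deq_class phi h i T & map (window_bits h (i - h + 3)) us = L].
Proof.
move=> h1 hi hn h3; have [Hgf _] := Hde.
have [|la [pla hla]] := Hgf h i h1 hi hn _ T; first by apply: leq_trans h3 _.
have hm : 3 <= i - h + 3 <= 5 by move: h3; clear; lia.
have hm6 : 3 <= i - h + 3 <= 6 by move: h3; clear; lia.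
have m0 : 0 < i - h + 3 by move: hm; clear; lia.
have [L hL eL] := schur_descents hm pla.
have sL : all (fun x => size x == (i - h + 3).-1) L.
  have chk : all (fun m => all (all (fun x : seq bool => size x == m.-1)) (descent_lists m)) [:: 3; 4; 5] by [].
  by apply: (allP (allP chk _ _) L hL); rewrite !inE; move: hm; clear; lia.
pose C := enum (deq_class phi h i T).
have p : perm_eq (map (window_bits h (i - h + 3)) C) L.
  apply: (@subbits_perm (i - h + 3).-1) => //.
    by apply/allP => x /mapP[U _ ->]; rewrite size_window_bits.
  move=> e se; rewrite -eL // -hla ?canonical_ok //.
  rewrite (eq_bigr (fun U => subbits (window_bits h (i - h + 3) U) e : nat)).
    by rewrite sum_count count_map.
  by move=> U _; rewrite fundQ_window // fundQ_canonical // size_window_bits.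
have [us [pus eus]] := perm_lift p.
exists L, us; split=> //; first by rewrite (perm_uniq pus) enum_uniq.
by move=> U; rewrite (perm_mem pus) mem_enum.
Qed.

Lemma class_act h i T U : h <= i -> (U \in deq_class phi h i T) <->
  exists w, all (fun c => h <= c <= i) w /\ act phi w T = U.
Proof.
move=> hi; have e w : all (mem (iota h (i - h).+1)) w = all (fun c => h <= c <= i) w.
  apply: eq_all => c; rewrite -[LHS]/(c \in iota _ _) mem_iota; move: hi; clear; lia.
rewrite inE; split=> [/connect_act|] [w [hw ew]]; last apply/connect_act;
  by exists w; rewrite -?e // e.
Qed.
Lemma class_self h i T : h <= i -> T \in deq_class phi h i T.
Proof. by move=> hi; apply/(class_act _ _ hi); exists [::]. Qed.
Lemma class_phi h i T U c : h <= c <= i -> U \in deq_class phi h i T ->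
  phi c U \in deq_class phi h i T.
Proof.
move=> hc; have hi : h <= i by move: hc; clear; lia.
move=> /(class_act _ _ hi)[w [hw <-]]; apply/(class_act _ _ hi).
by exists (rcons w c); rewrite all_rcons hc hw act_rcons.
Qed.

(** A class of one colour has at most two elements. In degree three the descent sets are one set
    with equal bits, or the pair of sets with unequal bits. *)
Lemma schur_move U i : 1 < i < n -> (phi i U != U) = (Des U i.-1 != Des U i) /\
  (phi i U != U -> Des (phi i U) i.-1 = ~~ Des U i.-1 /\ Des (phi i U) i = ~~ Des U i).
Proof.
move=> /andP[i1 hin].
have [|L [us [hL uus cus eL]]] := window_class U i1 (leqnn i) hin; first by rewrite subnn.
rewrite subnn add0n in hL eL.
have mem1 V : V \in us -> V = U \/ V = phi i U.
  rewrite cus => /(class_act _ _ (leqnn i))[w [hw <-]].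
  have := Hinv (i := i); rewrite i1 hin => /(_ isT) inv.
  elim/last_ind: w hw => [|w c IH]; first by left.
  rewrite all_rcons act_rcons => /andP[hc /IH].
  have -> : c = i by move: hc; clear; lia.
  by case=> ->; [right|left; rewrite inv].
have hU : U \in us by rewrite cus class_self.
have hV : phi i U \in us by rewrite cus; apply: class_phi; rewrite ?leqnn // class_self.
have bit V : window_bits i 3 V = [:: Des V i.-1; Des V i].
  by rewrite /window_bits /= addn0 addn1 prednK // ltnW.
have eL' : map (fun V => [:: Des V i.-1; Des V i]) us = L by rewrite -eL; apply: eq_map => V; rewrite bit.
case: (phi i U =P U) => [e|ne].
  split=> //; apply/esym/negbTE; rewrite negbK.
  move: hL eL' uus hU mem1; rewrite e !inE; clear.
  case: us => [|u [|v us]] //.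
    by rewrite !inE => hL eL _ /eqP -> _; move: hL; rewrite -eL /=; case: (Des u i.-1); case: (Des u i).
  move=> hL eL uq _ mem1; move: uq; have [] := mem1 u; rewrite ?mem_head // => ->;
  by have [] := mem1 v; rewrite ?inE ?eqxx ?orbT // => ->; rewrite /= mem_head.
move: hL eL' uus hU hV ne; rewrite !inE; clear.
case: us => [|u [|v [|x us]]] //=; last by move=> h1 h2; move: h1; rewrite -h2 !eqseq_cons /= !andbF.
  by move=> _ _ _; rewrite !inE => /eqP -> /eqP ->.
move=> hL eL _; rewrite !inE => h1 h2 ne; split=> [|_].
  by apply/esym; move: hL; rewrite -eL /=; case/orP: h1 => /eqP ->;
     case: (Des u i.-1) (Des u i) (Des v i.-1) (Des v i) => [] [] [] [].
move: h2 ne hL; rewrite -eL /=; case/orP: h1 => /eqP -> /orP[] /eqP -> // _;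
  by case: (Des u i.-1) (Des u i) (Des v i.-1) (Des v i) => [] [] [] [].
Qed.

Section Indices.
Variables (h i : nat) (T : A) (us : seq A) (L : seq (seq bool)).
Hypotheses (h1 : 1 < h) (hi : h <= i) (hin : i < n) (uus : uniq us)
  (cus : us =i deq_class phi h i T) (eL : map (window_bits h (i - h + 3)) us = L).

Definition index_table j := [seq index (phi (h + j) (nth T us a)) us | a <- iota 0 (size L)].

Lemma size_indices : size us = size L.
Proof. by rewrite -eL size_map. Qed.

Lemma index_tableE j a : j <= i - h -> a < size L ->
  nth 0 (index_table j) a < size L /\
  nth T us (nth 0 (index_table j) a) = phi (h + j) (nth T us a).
Proof.
move=> hj ha; have hU : phi (h + j) (nth T us a) \in us.
  rewrite cus; apply: class_phi; first by move: hi hj; clear; lia.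
  by rewrite -cus mem_nth // size_indices.
rewrite (nth_map 0) ?size_iota // nth_iota // add0n.
by rewrite nth_index // -size_indices index_mem.
Qed.

Lemma lbit_window a j : j <= (i - h).+1 -> a < size L ->
  lbit L a j = Des (nth T us a) (h.-1 + j).
Proof.
move=> hj ha; rewrite /lbit -eL (nth_map T) ?size_indices // nth_window_bits //.
by move: hj hi; clear; lia.
Qed.

Lemma index_table_candidate j : j <= i - h -> index_table j \in candidates L j.
Proof.
move=> hj; have hc : 1 < h + j < n by move: h1 hi hin hj; clear; lia.
rewrite mem_filter; apply/andP; split.
  apply/allP => a; rewrite mem_iota add0n => /= ha.
  have [b1 b2] := index_tableE hj ha; have [c1 c2] := index_tableE hj b1.
  have : nth T us (nth 0 (index_table j) (nth 0 (index_table j) a)) = nth T us a.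
    by rewrite c2 b2 Hinv.
  by move/eqP; rewrite nth_uniq ?size_indices.
apply: mem_choices => a; rewrite mem_iota add0n => /= ha.
set b := index _ _; have [mv fl] := schur_move (nth T us a) hc.
have hb : nth 0 (index_table j) a = b by rewrite (nth_map 0) ?size_iota // nth_iota.
have [b1 b2] := index_tableE hj ha; rewrite hb in b1 b2.
have e1 : (h + j).-1 = h.-1 + j by move: h1; clear; lia.
have e2 : h + j = h.-1 + j.+1 by move: h1; clear; lia.
rewrite /targets !lbit_window //; try by move: hj; clear; lia.
rewrite -e1 -e2; case: ifP => hd.
  rewrite inE; move: mv; rewrite hd => /negbFE/eqP e.
  by rewrite -(nth_uniq T _ _ uus) ?size_indices // b2 e.
have [f1 f2] := fl (etrans mv (negbT hd)).
rewrite mem_filter mem_iota add0n b1 andbT !lbit_window //; try by move: hj; clear; lia.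
by rewrite -e1 -e2 b2 f1 f2 !eqxx.
Qed.
End Indices.

(** For two colours the descents alone leave a single candidate for each colour. *)
Lemma window2 h T : 1 < h -> h.+1 < n -> exists L us, [/\ L \in descent_lists 4, uniq us,
  us =i deq_class phi h h.+1 T, map (window_bits h 4) us = L &
  forall j a, j <= 1 -> a < size L -> phi (h + j) (nth T us a) =
    nth T us (nth 0 (nth [::] (edge_tables 4 (size L)) j) a)].
Proof.
move=> h1 hn; have hi := leqnSn h.
have [|L [us [hL uus cus eL]]] := window_class T h1 hi hn; first by rewrite subSnn.
have em : h.+1 - h = 1 by rewrite subSnn.
have eL' := eL; rewrite em in hL eL'.
exists L, us; split=> // j a hj ha.
have chk : all (fun L => all (fun p => all (fun q => [:: p; q] == edge_tables 4 (size L))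
  (candidates L 1)) (candidates L 0)) (descent_lists 4) by vm_compute.
have c0 : index_table h T us L 0 \in candidates L 0 by apply: (index_table_candidate h1 hi hn).
have c1 : index_table h T us L 1 \in candidates L 1 by apply: (index_table_candidate h1 hi hn); rewrite ?em.
have /eqP <- := allP (allP (allP chk L hL) _ c0) _ c1.
have hj' : j <= h.+1 - h by rewrite em.
have [_ <-] := index_tableE hi cus eL hj' ha.
by case: j hj {hj'} => [|[|]].
Qed.

Lemma schur_up U i : 1 < i -> i.+1 < n -> Des (phi i U) i.+1 != Des U i.+1 ->
  phi i.+1 U = phi i U.
Proof.
move=> i1 hn; have [L [us [hL uus cus eL htab]]] := window2 U i1 hn.
have : U \in us by rewrite cus class_self.
move=> /(nthP U)[a ha <-]; have sL : size us = size L by rewrite -eL size_map.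
rewrite sL in ha.
have := htab 0 a isT ha; have := htab 1 a isT ha; rewrite addn0 addn1 => -> ->.
have chk : all (fun L => all (fun a => let q := edge_tables 4 (size L) in
   [&& nth 0 (nth [::] q 0) a < size L & ((lbit L (nth 0 (nth [::] q 0) a) 2 != lbit L a 2) ==>
     (nth 0 (nth [::] q 1) a == nth 0 (nth [::] q 0) a))]) (iota 0 (size L)))
   (descent_lists 4) by vm_compute.
have hia : a \in iota 0 (size L) by rewrite mem_iota.
have /andP[hb] := allP (allP chk L hL) a hia.
have lb b : b < size L -> lbit L b 2 = Des (nth U us b) i.+1.
  move=> hb'; rewrite /lbit -eL (nth_map U) ?sL // nth_window_bits //.
  by congr (Des _ _); move: i1; clear; lia.
by rewrite !lb // => /implyP h /h /eqP ->.
Qed.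

Lemma schur_down U i : 2 < i < n -> Des (phi i U) i.-2 != Des U i.-2 -> phi i.-1 U = phi i U.
Proof.
case: i => [//|i] /= /andP[i1 hn]; have [L [us [hL uus cus eL htab]]] := window2 U i1 hn.
have : U \in us by rewrite cus class_self.
move=> /(nthP U)[a ha <-]; have sL : size us = size L by rewrite -eL size_map.
rewrite sL in ha.
have := htab 0 a isT ha; have := htab 1 a isT ha; rewrite addn0 addn1 => -> ->.
have chk : all (fun L => all (fun a => let q := edge_tables 4 (size L) in
   [&& nth 0 (nth [::] q 1) a < size L & ((lbit L (nth 0 (nth [::] q 1) a) 0 != lbit L a 0) ==>
     (nth 0 (nth [::] q 0) a == nth 0 (nth [::] q 1) a))]) (iota 0 (size L)))
   (descent_lists 4) by vm_compute.
have hia : a \in iota 0 (size L) by rewrite mem_iota.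
have /andP[hb] := allP (allP chk L hL) a hia.
have lb b : b < size L -> lbit L b 0 = Des (nth U us b) i.-1.
  move=> hb'; rewrite /lbit -eL (nth_map U) ?sL // nth_window_bits //.
  by congr (Des _ _); rewrite addn0.
by rewrite !lb // => /implyP h /h /eqP ->.
Qed.

(** For three colours the candidates are filtered by the double edges known from [window2] and by
    the fact that the class is a single orbit. *)
Lemma window3 h T : 1 < h -> h.+2 < n -> exists L us, [/\ L \in descent_lists 5, uniq us,
  us =i deq_class phi h h.+2 T, map (window_bits h 5) us = L &
  forall j a, j <= 2 -> a < size L -> phi (h + j) (nth T us a) =
    nth T us (nth 0 (nth [::] (edge_tables 5 (size L)) j) a)].
Proof.
move=> h1 hn; have hi : h <= h.+2 by rewrite ltnW.
have em : h.+2 - h = 2 by clear; lia.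
have [|L [us [hL uus cus eL]]] := window_class T h1 hi hn; first by rewrite em.
have eL' := eL; rewrite em in hL eL'.
exists L, us; split=> // j a hj ha.
have chk : all (fun L => all (fun p => all (fun q => compat_up L 0 p q && compat_down L 1 q p ==>
   all (fun r => [&& compat_up L 1 q r, compat_down L 2 r q & connected_table L [:: p; q; r]] ==>
     ([:: p; q; r] == edge_tables 5 (size L))) (candidates L 2))
  (candidates L 1)) (candidates L 0)) (descent_lists 5) by vm_compute.
pose p j := index_table h T us L j.
have cand j' : j' <= 2 -> p j' \in candidates L j'.
  by move=> hj'; apply: (index_table_candidate h1 hi hn) => //; rewrite em.
have tabE j' b : j' <= 2 -> b < size L -> nth 0 (p j') b < size L /\
    nth T us (nth 0 (p j') b) = phi (h + j') (nth T us b).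
  by move=> hj' hb; apply: (index_tableE hi cus eL) => //; rewrite em.
have lb b j' : j' <= 3 -> b < size L -> lbit L b j' = Des (nth T us b) (h.-1 + j').
  by move=> hj' hb; apply: (lbit_window T hi eL) => //; rewrite em.
have sL : size us = size L by rewrite -eL size_map.
have up j' : j' < 2 -> compat_up L j' (p j') (p j'.+1).
  move=> hj'; apply/allP => b; rewrite mem_iota add0n => /= hb.
  have [|b1 b2] := tabE j' b _ hb; first exact: ltnW.
  have [|b3 b4] := tabE j'.+1 b _ hb; first by [].
  apply/implyP; rewrite !lb // b2 => hd; rewrite -(nth_uniq T _ _ uus) ?sL // b2 b4.
  rewrite addnS; apply/eqP/schur_up; first by move: h1; clear; lia.
    by move: hj' hn; clear; lia.
  by have <- : h.-1 + j'.+2 = (h + j').+1 by move: h1; clear; lia.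
have down j' : 0 < j' <= 2 -> compat_down L j' (p j') (p j'.-1).
  move=> hj'; apply/allP => b; rewrite mem_iota add0n => /= hb.
  have [|b1 b2] := tabE j' b _ hb; first by case/andP: hj'.
  have [|b3 b4] := tabE j'.-1 b _ hb; first by move: hj'; clear; lia.
  have hj3 : j'.-1 <= 3 by move: hj'; clear; lia.
  apply/implyP; rewrite !lb // b2 => hd; rewrite -(nth_uniq T _ _ uus) ?sL // b2 b4.
  have -> : h + j'.-1 = (h + j').-1 by move: hj'; clear; lia.
  apply/eqP/schur_down; first by move: h1 hj' hn; clear; lia.
  by have <- : h.-1 + j'.-1 = (h + j').-2 by move: h1 hj'; clear; lia.
have h0 := allP (allP (allP chk L hL) _ (cand 0 isT)) _ (cand 1 isT).
move: h0; rewrite (up 0) // (down 1) // => /allP/(_ _ (cand 2 isT)).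
have conn : connected_table L [:: p 0; p 1; p 2].
  have hT : T \in us by rewrite cus class_self.
  apply/hasP; exists (index T us); first by rewrite mem_iota -sL index_mem.
  apply/allP => S hS; apply/implyP => /andP[S0 hcl].
  have sS : size S = size L.
    clear -hS; elim: (size L) S hS => [|r IH] S /=; first by rewrite inE => /eqP ->.
    by rewrite mem_cat => /orP[] /mapP[x /IH <- ->].
  have cl j' b : j' <= 2 -> b < size L -> nth false S b -> nth false S (nth 0 (p j') b).
    move=> hj' hb; apply/implyP; have hib : b \in iota 0 (size L) by rewrite mem_iota.
    have /allP : all (fun a => nth false S a ==> nth false S (nth 0 (p j') a)) (iota 0 (size L)).
      by apply: (allP hcl); case: j' hj' => [|[|[|]]] //; rewrite !inE eqxx ?orbT.
    by apply.
  have reach w : all (fun c => h <= c <= h.+2) w ->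
      act phi w T \in us /\ nth false S (index (act phi w T) us).
    elim/last_ind: w => [|w c IH] //; rewrite all_rcons act_rcons => /andP[hc /IH[m1 m2]].
    have [j' [hj' ec]] : exists j', j' <= 2 /\ c = h + j'.
      by exists (c - h); move: hc; clear; lia.
    have hb : index (act phi w T) us < size L by rewrite -sL index_mem.
    have [b1 b2] := tabE _ _ hj' hb; rewrite nth_index // -ec in b2.
    rewrite -b2 mem_nth ?sL // index_uniq ?sL //; split=> //; exact: cl.
  apply/(all_nthP false) => b; rewrite sS => hb.
  have : nth T us b \in deq_class phi h h.+2 T by rewrite -cus mem_nth // sL.
  move=> /(class_act _ _ hi)[w [hw ew]]; have [_] := reach w hw.
  by rewrite ew index_uniq // sL.
rewrite (up 1) // (down 2) // conn => /eqP <-.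
have [_ <-] := tabE j a hj ha.
by case: j hj => [|[|[|]]].
Qed.
End FromSchur.

(** * The local axioms from Schur positivity *)

Section LocalFromSchur.
Variables (A : finType) (n : nat) (Des : A -> pred nat) (phi : nat -> A -> A).
Hypothesis Hinv : forall i, 1 < i < n -> involutive (phi i).
Hypothesis Hde : dual_equivalence n Des phi.

Lemma schur_three h U : 1 < h -> h.+2 < n ->
  [/\ Des (phi h U) h.+2 = Des U h.+2, Des (phi h.+2 U) h.-1 = Des U h.-1 &
   phi h U != U -> phi h.+2 U != U -> phi h.+1 U = U ->
    let W := phi h U in let V := phi h.+2 U in
    (phi h.+2 W = phi h.+1 W /\ phi h V = phi h.+1 V) \/
    [/\ phi h.+2 W = phi h V, phi h.+2 W <> phi h.+1 W & phi h V <> phi h.+1 V] ].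
Proof.
move=> h1 hn; have [L [us [hL uus cus eL htab]]] := window3 Hinv Hde U h1 hn.
have : U \in us by rewrite cus class_self // ltnW.
move=> /(nthP U)[a ha <-]; have sL : size us = size L by rewrite -eL size_map.
rewrite sL in ha; have hia : a \in iota 0 (size L) by rewrite mem_iota.
pose q j b := nth 0 (nth [::] (edge_tables 5 (size L)) j) b.
have chk : all (fun L => all (fun a => let q j b := nth 0 (nth [::] (edge_tables 5 (size L)) j) b in
   [&& q 0 a < size L, q 1 a < size L, q 2 a < size L, lbit L (q 0 a) 3 == lbit L a 3,
       lbit L (q 2 a) 0 == lbit L a 0 &
     [&& q 0 a != a, q 2 a != a & q 1 a == a] ==>
       (q 2 (q 0 a) == q 1 (q 0 a)) && (q 0 (q 2 a) == q 1 (q 2 a)) ||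
       [&& q 2 (q 0 a) == q 0 (q 2 a), q 2 (q 0 a) != q 1 (q 0 a) & q 0 (q 2 a) != q 1 (q 2 a)]])
   (iota 0 (size L))) (descent_lists 5) by vm_compute.
have {}chk b : b < size L -> _ := fun hb => allP (allP chk L hL) b (etrans (mem_iota 0 _ b) hb).
have qs j b : j <= 2 -> b < size L -> q j b < size L.
  move=> hj /chk/and5P[? ? ? _ _]; case: j hj => [|[|[|]]] //.
have p0 b : b < size L -> phi h (nth U us b) = nth U us (q 0 b).
  by move=> hb; have := htab 0 b isT hb; rewrite addn0.
have p1 b : b < size L -> phi h.+1 (nth U us b) = nth U us (q 1 b).
  by move=> hb; have := htab 1 b isT hb; rewrite addn1.
have p2 b : b < size L -> phi h.+2 (nth U us b) = nth U us (q 2 b).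
  by move=> hb; have := htab 2 b isT hb; rewrite addn2.
have lb b j : j < 4 -> b < size L -> lbit L b j = Des (nth U us b) (h.-1 + j).
  by move=> hj hb; rewrite /lbit -eL (nth_map U) ?sL // nth_window_bits.
have /and5P[_ _ _ b3 /andP[b0 /implyP h3]] := chk a ha.
have e3 : h.-1 + 3 = h.+2 by move: h1; clear; lia.
rewrite p0 // p2 // p1 //; split.
- by rewrite -e3 -!lb ?qs //; apply/eqP.
- by rewrite -[h.-1]addn0 -!lb ?qs //; apply/eqP.
rewrite !nth_uniq ?sL ?qs // => m0 m2 /eqP; rewrite nth_uniq ?sL ?qs // => m1.
rewrite /= p2 ?qs // p1 ?qs // p0 ?qs // p1 ?qs //.
have {}h3 := h3 (introT and3P (And3 m0 m2 m1)); case/orP: h3.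
  by case/andP => /eqP e1 /eqP e2; left; split; congr (nth U us _).
case/and3P => /eqP e n1 n2; right; split; first by congr (nth U us _).
  by apply/eqP; rewrite nth_uniq ?sL ?qs.
by apply/eqP; rewrite nth_uniq ?sL ?qs.
Qed.

Lemma schur_comm i j U : 1 < i < n -> 1 < j < n -> i + 3 <= j -> phi i (phi j U) = phi j (phi i U).
Proof. by move=> hi hj h; case: Hde => _ hc; apply: hc => //; rewrite h. Qed.

(** The nearest cases are visible in a window of three colours. Farther away, [phi i] commutes with
    [phi c], so it preserves whether [c.-1] and [c] have equal descent bits, and invariance passes
    from one to the other. *)
Lemma schur_far U i h : 1 < i < n -> 0 < h < n -> (h + 2 < i \/ i.+1 < h) ->
  Des (phi i U) h = Des U h.
Proof.
move=> hi hh.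
have moved c : 1 < c < n -> (forall V, phi i (phi c V) = phi c (phi i V)) ->
    (Des (phi i U) c.-1 != Des (phi i U) c) = (Des U c.-1 != Des U c).
  move=> hc hcomm; have [<- _] := schur_move Hinv Hde (phi i U) hc.
  have [<- _] := schur_move Hinv Hde U hc.
  by rewrite -hcomm (inj_eq (can_inj (Hinv hi))).
have hi1 : 1 < i by case/andP: hi.
case=> hd; last first.
  have [d ed] : exists d, h = i.+2 + d by exists (h - i.+2); move: hd; clear; lia.
  elim: d h ed hh {hd} => [|d IH] h ed hh.
    have hn : i.+2 < n by move: hh ed; clear; lia.
    by rewrite ed addn0; case: (schur_three U hi1 hn).
  have hc : 1 < h < n by move: hh ed; clear; lia.
  have e : Des (phi i U) h.-1 = Des U h.-1 by apply: IH; move: hh ed; clear; lia.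
  have hm V : phi i (phi h V) = phi h (phi i V) by apply: schur_comm => //; move: ed; clear; lia.
  by have := moved h hc hm; rewrite e; case: (Des U h.-1); case: (Des _ h); case: (Des U h).
have [d ed] : exists d, i = h + 3 + d by exists (i - h - 3); move: hd; clear; lia.
elim: d h ed hh {hd} => [|d IH] h ed hh.
  have h2 : 1 < h.+1 by move: hh; clear; lia.
  have hn : h.+3 < n by move: hi ed; clear; lia.
  have [_ + _] := schur_three U h2 hn; have -> : i = h.+3 by move: ed; clear; lia.
  by [].
have hc : 1 < h.+1 < n by move: hi hh ed; clear; lia.
have e : Des (phi i U) h.+1 = Des U h.+1 by apply: IH; move: hi hh ed; clear; lia.
have hm V : phi i (phi h.+1 V) = phi h.+1 (phi i V).
  by apply/esym/schur_comm => //; move: ed; clear; lia.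
by have := moved h.+1 hc hm; rewrite e /=; case: (Des U h.+1); case: (Des _ h); case: (Des U h).
Qed.

Lemma schur_local : local_axioms n Des phi.
Proof.
split=> //.
- by move=> U i hi; case: (schur_move Hinv Hde U hi).
- by move=> U i hi; case: (schur_move Hinv Hde U hi).
- exact: schur_far.
- exact: schur_up Hinv Hde.
- exact: schur_down Hinv Hde.
- move=> U [|[|h]] //= /andP[h1 hn]; have [_ _] := schur_three U (h1 : 1 < h) hn.
  exact.
- exact: schur_comm.
Qed.
End LocalFromSchur.

(** * Signed, coloured graphs *)

Section Edges.
Variables (A : finType) (n : nat) (Des : A -> pred nat) (phi : nat -> A -> A).
Hypothesis Hinv : forall i, 1 < i < n -> involutive (phi i).

Definition edges (i : nat) : {set {set A}} := [set [set T; phi i T] | T : A & phi i T != T].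
Definition sign (T : A) (i : nat) : int := if Des T i then (-1)%R else 1%R.

Lemma sign_opp (a b : bool) :
  ((if a then (-1)%R else 1%R : int) = - (if b then (-1)%R else 1%R : int))%R <-> a != b.
Proof. by case: a; case: b. Qed.
Lemma sign_eq (a b : bool) :
  ((if a then (-1)%R else 1%R : int) = (if b then (-1)%R else 1%R : int)) <-> a = b.
Proof. by case: a; case: b. Qed.

Lemma mem_edges i U V : 1 < i < n -> ([set U; V] \in edges i) = (phi i U == V) && (U != V).
Proof.
move=> hi; apply/imsetP/andP => [[T]|[/eqP <- ne]]; last by exists U; rewrite // inE eq_sym.
rewrite inE => mT e.
have hU : (U == T) || (U == phi i T) by have := set21 U V; rewrite e !inE.
have hV : (V == T) || (V == phi i T) by have := set22 U V; rewrite e !inE.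
have hT : (T == U) || (T == V) by have := set21 T (phi i T); rewrite -e !inE.
have hP : (phi i T == U) || (phi i T == V) by have := set22 T (phi i T); rewrite -e !inE.
case/orP: hU hT hP => /eqP ->; case/orP: hV => /eqP ->; rewrite ?(Hinv hi) ?eqxx ?orbb //.
- by move=> _ /eqP h; rewrite h eqxx in mT.
- by move=> _ _; rewrite eq_sym.
- by rewrite eq_sym => /eqP h; rewrite h eqxx in mT.
Qed.
Lemma edge_phi i U : phi i U != U -> [set U; phi i U] \in edges i.
Proof. by move=> h; apply/imsetP; exists U; rewrite ?inE. Qed.

Lemma comp_connect cs w v : all (fun c => 1 < c < n) cs ->
  connect (cadj edges cs) w v = connect (fun u v => has (fun c => phi c u == v) cs) w v.
Proof.
move=> /allP hcs; apply/idP/idP; apply: connect_sub => x y /hasP[c hc].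
  rewrite mem_edges ?hcs // => /andP[e _]; apply: connect1; apply/hasP; exists c => //.
move/eqP <-; case: (phi c x =P x) => [->|/eqP ne]; first exact: connect0.
by apply: connect1; apply/hasP; exists c => //; apply: edge_phi.
Qed.

Lemma comp_phi cs w U c : all (fun c => 1 < c < n) cs -> c \in cs ->
  U \in Defs.comp edges cs w -> phi c U \in Defs.comp edges cs w.
Proof.
move=> hcs hc; rewrite !inE !comp_connect // => h; apply: connect_trans h _.
by apply: connect1; apply/hasP; exists c.
Qed.
Lemma comp_self cs w : w \in Defs.comp edges cs w.
Proof. by rewrite inE connect0. Qed.

Lemma restrict_phi c (C : {set A}) U : U \in C -> phi c U \in C -> phi c U != U ->
  [set U; phi c U] \in restrict_edges (edges c) C.
Proof.
move=> hU hP hm; rewrite inE edge_phi //=; apply/subsetP => x.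
by rewrite !inE => /orP[] /eqP ->.
Qed.
Lemma restrict_mem c (C : {set A}) a b : 1 < c < n -> [set a; b] \in restrict_edges (edges c) C ->
  phi c a = b /\ phi c b = a.
Proof.
move=> hc; rewrite inE mem_edges // => /andP[/andP[/eqP e _] _].
by rewrite -e Hinv.
Qed.
Lemma set2_fst (a b c d : A) : [set a; b] = [set c; d] -> (a == c) || (a == d).
Proof. by move=> e; have := set21 a b; rewrite e !inE. Qed.
Lemma set2_snd (a b c d : A) : [set a; b] = [set c; d] -> (c == a) || (c == b).
Proof. by move=> e; have := set21 c d; rewrite -e !inE. Qed.

Section FromGraph.
Hypothesis Hg : dual_equivalence_graph n n sign edges.

Lemma graph_move U i : 1 < i < n -> (phi i U != U) = (Des U i.-1 != Des U i).
Proof.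
move=> hi; have [_ [_ [ax1 _]]] := Hg; have [[h1 h2] _] := ax1 U i hi.
apply/idP/idP => [m|/sign_opp/h1[x]].
  by apply/sign_opp/h2; exists (phi i U); apply: edge_phi.
by rewrite mem_edges // => /andP[/eqP ->]; rewrite eq_sym.
Qed.
Lemma graph_flip U i : 1 < i < n -> phi i U != U ->
  Des (phi i U) i.-1 = ~~ Des U i.-1 /\ Des (phi i U) i = ~~ Des U i.
Proof.
move=> hi m; have [_ [_ [_ [ax2 _]]]] := Hg.
have [/sign_opp h1 [/sign_opp h2 _]] := ax2 _ _ i hi (edge_phi m).
by move: h1 h2; case: (Des U i.-1); case: (Des U i); case: (Des _ i.-1); case: (Des _ i).
Qed.
Lemma graph_far U i h : 1 < i < n -> 0 < h < n -> (h + 2 < i \/ i.+1 < h) ->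
  Des (phi i U) h = Des U h.
Proof.
move=> hi hh hd; case: (phi i U =P U) => [->//|/eqP m].
have [_ [_ [_ [ax2 _]]]] := Hg; have [_ [_ h3]] := ax2 _ _ i hi (edge_phi m).
exact/esym/sign_eq/h3.
Qed.

(** By axiom 3, [phi i.+1] moves both ends of the edge from [U] to [phi i U]. A path of two edges
    has no such edge, so by axiom 4 the component is a double edge. *)
Lemma graph_up U i : 1 < i -> i.+1 < n -> Des (phi i U) i.+1 != Des U i.+1 ->
  phi i.+1 U = phi i U.
Proof.
move=> i1 hn hd.
have hi : 1 < i < n by move: i1 hn; clear; lia.
have hi' : 1 < i.+1 < n by move: i1 hn; clear; lia.
have mU : phi i U != U by apply/eqP => e; move: hd; rewrite e eqxx.
have [_ [_ [_ [_ [ax3 [ax4 _]]]]]] := Hg.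
have [_ h] := ax3 _ _ i hi (edge_phi mU).
have /sign_opp hU : sign U i.+1 = (- sign U i)%R by apply: h => //; apply/sign_opp; rewrite eq_sym.
have mU1 : phi i.+1 U != U by rewrite graph_move // eq_sym.
have [_ f2] := graph_flip hi mU.
have mV1 : phi i.+1 (phi i U) != phi i U.
  by rewrite graph_move //= f2; move: hd hU; case: (Des U i); case: (Des _ i.+1); case: (Des U i.+1).
have hcs : all (fun c => 1 < c < n) [:: i; i.+1] by rewrite /= hi hi'.
have i2n : 2 < i.+1 < n by move: i1 hn; clear; lia.
have := ax4 i.+1 i2n U; rewrite /=; set C := Defs.comp _ _ _ => sh.
have cU : U \in C by apply: comp_self.
have cP V : V \in C -> phi i V \in C by apply: comp_phi => //; rewrite inE eqxx.
have cQ V : V \in C -> phi i.+1 V \in C by apply: comp_phi => //; rewrite !inE eqxx orbT.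
have rU := restrict_phi cU (cP _ cU) mU; have rU1 := restrict_phi cU (cQ _ cU) mU1.
have rV1 := restrict_phi (cP _ cU) (cQ _ (cP _ cU)) mV1.
case: sh => [[a [_ [e _]]]|[[x [y [z [uq [_ [e1 e2]]]]]]|[x [y [_ [_ [e1 e2]]]]]]].
- by move: rU; rewrite e inE.
- move: rU rU1 rV1; rewrite e1 e2 !inE => /eqP/set2_snd h1 /eqP/set2_fst h2 /eqP/set2_fst h3.
  have [nxy nxz] : x != y /\ x != z by move: uq; rewrite /= !inE negb_or => /andP[/andP[]].
  by case/orP: h1 => /eqP e; [case/orP: h2|case/orP: h3] => /eqP e'; move: nxy nxz;
     rewrite e e' eqxx.
have x1 : [set x; y] \in restrict_edges (edges i) C by rewrite e1 inE.
have x2 : [set x; y] \in restrict_edges (edges i.+1) C by rewrite e2 inE.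
have [p1 p2] := restrict_mem hi x1; have [p3 p4] := restrict_mem hi' x2.
by move: rU; rewrite e1 inE => /eqP/set2_fst/orP[] /eqP ->; rewrite ?p1 ?p2 ?p3 ?p4.
Qed.

Lemma graph_down U i : 2 < i < n -> Des (phi i U) i.-2 != Des U i.-2 -> phi i.-1 U = phi i U.
Proof.
case: i => [//|i] /= hi2 hd; have [i1 hn] : 1 < i /\ i.+1 < n by move: hi2; clear; lia.
have hi : 1 < i < n by move: i1 hn; clear; lia.
have hi' : 1 < i.+1 < n by move: i1 hn; clear; lia.
have mU1 : phi i.+1 U != U by apply/eqP => e; move: hd; rewrite e eqxx.
have [_ [_ [_ [_ [ax3 [ax4 _]]]]]] := Hg.
have [h _] := ax3 _ _ i.+1 hi' (edge_phi mU1).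
have /sign_opp hU : sign U i.-1 = (- sign U i)%R.
  by apply: h => //; apply/sign_opp; rewrite eq_sym.
have mU : phi i U != U by rewrite graph_move.
have [f1 _] := graph_flip hi' mU1; rewrite /= in f1.
have mV : phi i (phi i.+1 U) != phi i.+1 U.
  by rewrite graph_move //= f1; move: hd hU; case: (Des U i); case: (Des _ i.-1); case: (Des U i.-1).
have hcs : all (fun c => 1 < c < n) [:: i; i.+1] by rewrite /= hi hi'.
have := ax4 i.+1 hi2 U; rewrite /=; set C := Defs.comp _ _ _ => sh.
have cU : U \in C by apply: comp_self.
have cP V : V \in C -> phi i V \in C by apply: comp_phi => //; rewrite inE eqxx.
have cQ V : V \in C -> phi i.+1 V \in C by apply: comp_phi => //; rewrite !inE eqxx orbT.
have rU := restrict_phi cU (cP _ cU) mU; have rU1 := restrict_phi cU (cQ _ cU) mU1.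
have rV := restrict_phi (cQ _ cU) (cP _ (cQ _ cU)) mV.
case: sh => [[a [_ [e _]]]|[[x [y [z [uq [_ [e1 e2]]]]]]|[x [y [_ [_ [e1 e2]]]]]]].
- by move: rU; rewrite e inE.
- have e3 : [set y; z] = [set z; y] by rewrite setUC.
  move: rU rU1 rV; rewrite e1 e2 !inE => /eqP/set2_fst h2 /eqP h1 /eqP/set2_fst h3.
  rewrite e3 in h1; move/set2_snd: h1 => h1.
  have [nxz nyz] : x != z /\ y != z.
    by move: uq; rewrite /= !inE negb_or => /andP[/andP[_ ->]] /andP[].
  by case/orP: h1 => /eqP e; [case/orP: h2|case/orP: h3] => /eqP e'; move: nxz nyz;
     rewrite e e' eqxx.
have x1 : [set x; y] \in restrict_edges (edges i) C by rewrite e1 inE.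
have x2 : [set x; y] \in restrict_edges (edges i.+1) C by rewrite e2 inE.
have [p1 p2] := restrict_mem hi x1; have [p3 p4] := restrict_mem hi' x2.
by move: rU; rewrite e1 inE => /eqP/set2_fst/orP[] /eqP ->; rewrite ?p1 ?p2 ?p3 ?p4.
Qed.

(** Each of the two colours preserves the descents that decide whether the other moves a vertex. So
    axiom 5 is needed only when both move [U]. *)
Lemma graph_comm i j U : 1 < i < n -> 1 < j < n -> i + 3 <= j ->
  phi i (phi j U) = phi j (phi i U).
Proof.
move=> hi hj hij.
have mi V : (phi i (phi j V) != phi j V) = (phi i V != V).
  by rewrite !graph_move // !graph_far //; move: hi hj hij; clear; lia.
have mj V : (phi j (phi i V) != phi i V) = (phi j V != V).
  by rewrite !graph_move // !graph_far //; move: hi hj hij; clear; lia.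
case: (phi i U =P U) => [ei|/eqP ni].
  by apply/eqP; rewrite ei -[_ == _]negbK mi ei eqxx.
case: (phi j U =P U) => [ej|/eqP nj].
  by apply/esym/eqP; rewrite ej -[_ == _]negbK mj ej eqxx.
have [_ [_ [_ [_ [_ [_ [_ [ax5 _]]]]]]]] := Hg.
have e1 : [set phi i U; U] \in edges i by rewrite setUC edge_phi.
have [|v []] := ax5 i j _ _ _ hi hj _ e1 (edge_phi nj); first by rewrite hij.
rewrite !mem_edges // => /andP[/eqP <- _] /andP[/eqP e _].
by rewrite -e Hinv.
Qed.

Lemma graph_three U i : 3 < i < n -> phi i.-2 U != U -> phi i U != U -> phi i.-1 U = U ->
  let W := phi i.-2 U in let V := phi i U in
  (phi i W = phi i.-1 W /\ phi i.-2 V = phi i.-1 V) \/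
  [/\ phi i W = phi i.-2 V, phi i W <> phi i.-1 W & phi i.-2 V <> phi i.-1 V].
Proof.
move=> hi3 m0 m2 m1 /=.
have [_ [_ [_ [_ [_ [_ [ax4 _]]]]]]] := Hg.
have h0 : 1 < i.-2 < n by move: hi3; clear; lia.
have h1 : 1 < i.-1 < n by move: hi3; clear; lia.
have h2 : 1 < i < n by move: hi3; clear; lia.
have hcs : all (fun c => 1 < c < n) [:: i.-2; i.-1; i] by rewrite /= h0 h1 h2.
have := ax4 i hi3 U; set C := Defs.comp _ _ _ => sh.
have cU : U \in C by apply: comp_self.
have cP c V : c \in [:: i.-2; i.-1; i] -> V \in C -> phi c V \in C by move=> hc; apply: comp_phi.
have r0 : [set U; phi i.-2 U] \in restrict_edges (edges i.-2) C.
  by apply: restrict_phi => //; apply: cP; rewrite // !inE eqxx.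
have r2 : [set U; phi i U] \in restrict_edges (edges i) C.
  by apply: restrict_phi => //; apply: cP; rewrite // !inE eqxx !orbT.
case: sh => [[a [_ [e _]]]|[[p [q [r [s [uq [_ [e0 [e1 e2]]]]]]]]|[]]].
- by move: r0; rewrite e inE.
- move: r0 r2; rewrite e0 e2 !inE => /eqP/set2_fst h3 /eqP/set2_fst h4.
  by move: uq h3 h4; rewrite /= !inE => uq /orP[] /eqP -> /orP[] /eqP e;
    move: uq; rewrite e eqxx ?orbT ?andbF.
- move=> [a [b [c [d [e [uq [_ [e0 [e1 e2]]]]]]]]].
  have s0 x y : [set x; y] \in [set [set a; b]; [set c; d]] -> phi i.-2 x = y /\ phi i.-2 y = x.
    by rewrite -e0; apply: restrict_mem.
  have s1 x y : [set x; y] \in [set [set a; b]; [set d; e]] -> phi i.-1 x = y /\ phi i.-1 y = x.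
    by rewrite -e1; apply: restrict_mem.
  have s2 x y : [set x; y] \in [set [set b; c]; [set d; e]] -> phi i x = y /\ phi i y = x.
    by rewrite -e2; apply: restrict_mem.
  have [[ab ba] [cd dc]] := (s0 a b (set21 _ _), s0 c d (set22 _ _)).
  have [[ab' ba'] [de ed]] := (s1 a b (set21 _ _), s1 d e (set22 _ _)).
  have [[bc cb] [de' ed']] := (s2 b c (set21 _ _), s2 d e (set22 _ _)).
  have hU : U \in [:: a; b; c; d].
    by move: r0; rewrite e0 !inE => /orP[] /eqP/set2_fst/orP[] /eqP ->; rewrite eqxx ?orbT.
  left; move: m1 m2 hU uq; rewrite !inE /= !inE => m1 m2.
  case/or4P=> /eqP eU; subst U.
  + by move: m1; rewrite ab' => ->; rewrite eqxx.
  + by move: m1; rewrite ba' => ->; rewrite eqxx.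
  + by move=> _; rewrite cd cb de' de ba ba'.
  + by move: m1; rewrite de => ->; rewrite eqxx /= ?orbT ?andbF.
move=> [u [v [w [x [y [z [uq [_ [e0 [e1 e2]]]]]]]]]].
have s0 a b : [set a; b] \in [set [set v; w]; [set x; y]] -> phi i.-2 a = b /\ phi i.-2 b = a.
  by rewrite -e0; apply: restrict_mem.
have s1 a b : [set a; b] \in [set [set u; v]; [set y; z]] -> phi i.-1 a = b /\ phi i.-1 b = a.
  by rewrite -e1; apply: restrict_mem.
have s2 a b : [set a; b] \in [set [set v; x]; [set w; y]] -> phi i a = b /\ phi i b = a.
  by rewrite -e2; apply: restrict_mem.
have [[vw wv] [xy yx]] := (s0 v w (set21 _ _), s0 x y (set22 _ _)).
have [[uv vu] [yz zy]] := (s1 u v (set21 _ _), s1 y z (set22 _ _)).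
have [[vx xv] [wy yw]] := (s2 v x (set21 _ _), s2 w y (set22 _ _)).
have hU : U \in [:: v; w; x; y].
  by move: r0; rewrite e0 !inE => /orP[] /eqP/set2_fst/orP[] /eqP ->; rewrite eqxx ?orbT.
have /= := uq; rewrite !inE !negb_or => /and5P[/and5P[nuv _ nux nuy nuz] /and4P[_ _ _ _] /and3P[nwx nwy nwz] /andP[_ nxz] _].
right; move: hU; rewrite !inE => /or4P[] /eqP eU; subst U.
- by move: m1 nuv; rewrite vu => ->; rewrite eqxx.
- rewrite wv wy vx vu yx yz; split=> // e; first by move: nux; rewrite e eqxx.
  by move: nxz; rewrite e eqxx.
- rewrite xy xv yw yz vw vu; split=> // e; first by move: nwz; rewrite e eqxx.
  have /= := uq; rewrite !inE e eqxx !orbT //=.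
- by move: m1 => ez; move: uq; rewrite /= !inE -ez yz eqxx !andbF.
Qed.

Lemma graph_local : local_axioms n Des phi.
Proof.
split=> //; [exact: graph_move|exact: graph_flip|exact: graph_far|exact: graph_up|
  exact: graph_down|exact: graph_three|exact: graph_comm].
Qed.

Lemma linked_short i U w : 1 < i < n -> all (below i.+1) w -> count (pred1 i) w <= 1 ->
  linked phi i U (act phi w U) \/
  exists W, linked phi i U W /\ linked phi i (phi i W) (act phi w U).
Proof.
move=> hi; elim: w U => [|c w IH] U /=; first by left; apply: linked_refl.
move=> /andP[hc hw]; case: eqP => [->|ne] /= hcount.
  have h0 : count (pred1 i) w = 0 by move: hcount; rewrite add1n ltnS leqn0 => /eqP.
  right; exists U; split; first exact: linked_refl.
  apply: linked_act; move: h0 hw; elim: w {IH hcount} => //= c' w IH.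
  case: eqP => // ne h0 /andP[h1 /(IH h0) ->]; rewrite andbT.
  by move: h1 ne; rewrite /below; clear; lia.
have hc' : below i c by move: hc ne; rewrite /below; clear; lia.
have l1 : linked phi i U (phi c U) by apply: linked1.
have [|h|[W [h1 h2]]] := IH (phi c U) hw; first by [].
  by left; apply: linked_trans l1 h.
by right; exists W; split=> //; apply: linked_trans l1 h1.
Qed.

Lemma graph_short_paths i : 1 < i < n -> short_paths phi i.
Proof.
move=> hi U V [w [hw ew]].
have [_ [_ [_ [_ [_ [_ [_ [_ ax6]]]]]]]] := Hg.
have hcs : all (fun c => 1 < c < n) (iota 2 i.-1).
  by apply/allP => c; rewrite mem_iota; move: hi; clear; lia.
have [|p [hp [hp1 hp2]]] := ax6 i hi U V.
  rewrite comp_connect //; apply/connect_act; exists w; split=> //.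
  apply: sub_all hw => c; rewrite /below -[mem _ _]/(c \in iota 2 i.-1) mem_iota.
  by move: hi; clear; lia.
have {hp} -> : V = act phi [seq x.2 | x <- p] U.
  elim: p U hp hp1 {hp2 w hw ew} => [|[v c] p IH] U /=; first by move/eqP.
  move=> /andP[h /IH e] /andP[hc /e ->].
  move: h; rewrite mem_edges; last by move: hc hi; clear; lia.
  by case/andP => /eqP ->.
apply: linked_short => //; first by rewrite all_map; apply: sub_all hp1 => x; rewrite /below /=; clear; lia.
by rewrite count_map.
Qed.
End FromGraph.
End Edges.

(** * The graph axioms from Schur positivity *)

Section GraphFromSchur.
Variables (A : finType) (n : nat) (Des : A -> pred nat) (phi : nat -> A -> A).
Hypothesis Hinv : forall i, 1 < i < n -> involutive (phi i).
Notation edges := (edges phi).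

(** Every edge is listed once from each end; [edges1], [edges2] and [edges2'] remove the repetitions
    in the orders that occur. *)
Lemma restrict_list c (us : seq A) : {in us, forall U, phi c U \in us} ->
  restrict_edges (edges c) [set x in us] =
  [set e in [seq [set U; phi c U] | U <- us & phi c U != U]].
Proof.
move=> hus; apply/setP => e; rewrite !inE; apply/andP/mapP => [[/imsetP[U]]|[U]].
  rewrite inE => m -> /subsetP h; exists U => //; rewrite mem_filter m /=.
  by have := h U; rewrite !inE eqxx => /(_ isT).
rewrite mem_filter => /andP[m hU] ->; split; first exact: edge_phi.
by apply/subsetP => x; rewrite !inE => /orP[] /eqP -> //; apply: hus.
Qed.

Lemma edges1 (a b : A) : [set e in [:: [set a; b]; [set b; a]]] = [set [set a; b]].
Proof. by rewrite (setUC [set b]); apply/setP => e; rewrite !inE orbb. Qed.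
Lemma edges2 (a b c d : A) : [set e in [:: [set a; b]; [set b; a]; [set c; d]; [set d; c]]] =
  [set [set a; b]; [set c; d]].
Proof.
rewrite (setUC [set b]) (setUC [set d]); apply/setP => e; rewrite !inE.
by case: (e == _); case: (e == _).
Qed.
Lemma edges2' (a b c d : A) : [set e in [:: [set a; b]; [set c; d]; [set b; a]; [set d; c]]] =
  [set [set a; b]; [set c; d]].
Proof.
rewrite (setUC [set b]) (setUC [set d]); apply/setP => e; rewrite !inE.
by case: (e == _); case: (e == _).
Qed.

Hypothesis Hde : dual_equivalence n Des phi.

Lemma comp_window h i w (us : seq A) : 1 < h -> h <= i -> i < n ->
  us =i deq_class phi h i w -> Defs.comp edges (iota h (i - h).+1) w = [set x in us].
Proof.
move=> h1 hi hn e; apply/setP => x; rewrite !inE e inE (comp_connect Hinv) //.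
by apply/allP => c; rewrite mem_iota; move: h1 hi hn; clear; lia.
Qed.

Lemma schur_shape2 i w : 2 < i < n -> shape2 edges i (Defs.comp edges [:: i.-1; i] w).
Proof.
case: i => [//|h] /= hh; have [h1 hn] : 1 < h /\ h.+1 < n by move: hh; clear; lia.
have [L [us [hL uus cus eL htab]]] := window2 Hinv Hde w h1 hn.
have -> : [:: h; h.+1] = iota h (h.+1 - h).+1 by rewrite subSnn.
rewrite (comp_window h1 (leqnSn h) hn cus).
have inus c : h <= c <= h.+1 -> {in us, forall U, phi c U \in us}.
  by move=> hc U; rewrite !cus; apply: class_phi.
have c0 : h <= h <= h.+1 by rewrite leqnn leqnSn.
have c1 : h <= h.+1 <= h.+1 by rewrite leqnn leqnSn.
have r0 := restrict_list (inus _ c0); have r1 := restrict_list (inus _ c1).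
have t0 a := htab 0 a isT; have t1 a := htab 1 a isT.
rewrite addn0 in t0; rewrite addn1 in t1.
have sL : size us = size L by rewrite -eL size_map.
rewrite /shape2 r0 r1 {r0 r1 inus cus htab eL}.
have : size L \in [:: 1; 2; 3].
  have chk : all (fun L => size L \in [:: 1; 2; 3]) (descent_lists 4) by [].
  exact: (allP chk).
rewrite !inE => /or3P[] /eqP s; rewrite s in t0 t1 sL.
- case: us sL uus t0 t1 => [|a [|]] // _ _ /(_ 0 isT) /= e0 /(_ 0 isT) /= e1.
  by left; exists a; rewrite /= e0 e1 eqxx; split; first (by apply/setP => x; rewrite !inE);
    split; apply/setP => x; rewrite !inE.
- case: us sL uus t0 t1 => [|a [|b [|]]] // _ /=; rewrite !inE andbT => nab t0 t1.
  right; right; exists a, b; split=> //.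
  have /= e00 := t0 0 isT; have /= e01 := t0 1 isT; have /= e10 := t1 0 isT; have /= e11 := t1 1 isT.
  by rewrite /= !(e00, e01, e10, e11) (eq_sym b) nab /= !(e00, e01, e10, e11) edges1; split=> //; apply/setP => x; rewrite !inE.
case: us sL uus t0 t1 => [|a [|b [|c [|]]]] // _ uq t0 t1.
right; left; exists a, b, c; split=> //.
move: uq => /=; rewrite !inE negb_or andbT => /andP[/andP[nab nac] nbc].
have /= e00 := t0 0 isT; have /= e01 := t0 1 isT; have /= e02 := t0 2 isT.
have /= e10 := t1 0 isT; have /= e11 := t1 1 isT; have /= e12 := t1 2 isT.
rewrite /= !(e00, e01, e02, e10, e11, e12) !eqxx (eq_sym b a) nab (eq_sym c b) nbc /= !(e00, e01, e02, e10, e11, e12) !edges1; split=> //.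
by apply/setP => x; rewrite !inE orbA.
Qed.

Lemma schur_shape3 i w : 3 < i < n -> shape3 edges i (Defs.comp edges [:: i.-2; i.-1; i] w).
Proof.
case: i => [//|[//|h]] /= hh; have [h1 hn] : 1 < h /\ h.+2 < n by move: hh; clear; lia.
have [L [us [hL uus cus eL htab]]] := window3 Hinv Hde w h1 hn.
have -> : [:: h; h.+1; h.+2] = iota h (h.+2 - h).+1.
  by rewrite (_ : h.+2 - h = 2) //; clear; lia.
have hi : h <= h.+2 by rewrite ltnW.
rewrite (comp_window h1 hi hn cus).
have inus c : h <= c <= h.+2 -> {in us, forall U, phi c U \in us}.
  by move=> hc U; rewrite !cus; apply: class_phi.
have c0 : h <= h <= h.+2 by rewrite leqnn hi.
have c1 : h <= h.+1 <= h.+2 by rewrite !leqnSn.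
have c2 : h <= h.+2 <= h.+2 by rewrite leqnn hi.
have r0 := restrict_list (inus _ c0); have r1 := restrict_list (inus _ c1).
have r2 := restrict_list (inus _ c2).
have t0 a := htab 0 a isT; have t1 a := htab 1 a isT; have t2 a := htab 2 a isT.
rewrite addn0 in t0; rewrite addn1 in t1; rewrite addn2 in t2.
have sL : size us = size L by rewrite -eL size_map.
rewrite /shape3 r0 r1 r2 {r0 r1 r2 inus cus htab eL}.
have : size L \in [:: 1; 4; 5; 6].
  have chk : all (fun L => size L \in [:: 1; 4; 5; 6]) (descent_lists 5) by [].
  exact: (allP chk).
rewrite !inE => /or4P[] /eqP s; rewrite s in t0 t1 t2 sL.
- case: us sL uus t0 t1 t2 => [|a [|]] // _ _ /(_ 0 isT) /= e0 /(_ 0 isT) /= e1 /(_ 0 isT) /= e2.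
  left; exists a; rewrite /= e0 e1 e2 eqxx; split; first by apply/setP => x; rewrite !inE.
  by split; [|split]; apply/setP => x; rewrite !inE.
- case: us sL uus t0 t1 t2 => [|a [|b [|c [|d [|]]]]] // _ uq t0 t1 t2.
  right; left; exists a, b, c, d; split=> //.
  move: uq => /=; rewrite !inE !negb_or !andbT -!andbA => /and5P[nab nac nad nbc /andP[nbd ncd]].
  have /= e00 := t0 0 isT; have /= e01 := t0 1 isT; have /= e02 := t0 2 isT; have /= e03 := t0 3 isT.
  have /= e10 := t1 0 isT; have /= e11 := t1 1 isT; have /= e12 := t1 2 isT; have /= e13 := t1 3 isT.
  have /= e20 := t2 0 isT; have /= e21 := t2 1 isT; have /= e22 := t2 2 isT; have /= e23 := t2 3 isT.
  pose E := (e00, e01, e02, e03, e10, e11, e12, e13, e20, e21, e22, e23).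
  rewrite /= !E !eqxx (eq_sym b a) (eq_sym c b) (eq_sym d c) nab nbc ncd /= !E !edges1; split=> //.
  by apply/setP => x; rewrite !inE !orbA.
- case: us sL uus t0 t1 t2 => [|a [|b [|c [|d [|e [|]]]]]] // _ uq t0 t1 t2.
  right; right; left; exists a, b, c, d, e; split=> //.
  move: uq => /=; rewrite !inE !negb_or !andbT -!andbA.
  move=> /and5P[nab _ _ _ /and5P[nbc _ _ ncd /andP[_ nde]]].
  have /= e00 := t0 0 isT; have /= e01 := t0 1 isT; have /= e02 := t0 2 isT; have /= e03 := t0 3 isT.
  have /= e04 := t0 4 isT; have /= e14 := t1 4 isT; have /= e24 := t2 4 isT.
  have /= e10 := t1 0 isT; have /= e11 := t1 1 isT; have /= e12 := t1 2 isT; have /= e13 := t1 3 isT.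
  have /= e20 := t2 0 isT; have /= e21 := t2 1 isT; have /= e22 := t2 2 isT; have /= e23 := t2 3 isT.
  pose E := (e00, e01, e02, e03, e04, e10, e11, e12, e13, e14, e20, e21, e22, e23, e24).
  rewrite /= !E !eqxx (eq_sym b a) (eq_sym c b) (eq_sym d c) (eq_sym e d) nab nbc ncd nde /= !E !edges2.
  by split=> //; apply/setP => x; rewrite !inE !orbA.
case: us sL uus t0 t1 t2 => [|u [|v [|w' [|x [|y [|z [|]]]]]]] // _ uq t0 t1 t2.
right; right; right; exists u, v, w', x, y, z; split=> //.
have [nuv nvw nvx] : [/\ u != v, v != w' & v != x].
  by move: uq => /=; rewrite !inE !negb_or -!andbA => /and5P[-> _ _ _ /and3P[_ -> /andP[-> _]]].
have [nwy nxy nyz] : [/\ w' != y, x != y & y != z].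
  move: uq => /= /and5P[_ _]; rewrite !inE !negb_or => /and3P[_ -> _] /andP[-> _] /andP[-> _].
  by [].
have /= e00 := t0 0 isT; have /= e01 := t0 1 isT; have /= e02 := t0 2 isT; have /= e03 := t0 3 isT.
have /= e04 := t0 4 isT; have /= e14 := t1 4 isT; have /= e24 := t2 4 isT.
have /= e05 := t0 5 isT; have /= e15 := t1 5 isT; have /= e25 := t2 5 isT.
have /= e10 := t1 0 isT; have /= e11 := t1 1 isT; have /= e12 := t1 2 isT; have /= e13 := t1 3 isT.
have /= e20 := t2 0 isT; have /= e21 := t2 1 isT; have /= e22 := t2 2 isT; have /= e23 := t2 3 isT.
pose E := (e00, e01, e02, e03, e04, e05, e10, e11, e12, e13, e14, e15, e20, e21, e22, e23, e24, e25).
rewrite /= !E !eqxx (eq_sym v u) (eq_sym w' v) (eq_sym x v) (eq_sym y w') (eq_sym y x) (eq_sym z y).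
rewrite nuv nvw nvx nwy nxy nyz /= !E !edges2 edges2'.
by split=> //; apply/setP => a; rewrite !inE !orbA.
Qed.

(** Letters that fix the current vertex are not edges and are dropped, so the count can only
    decrease. *)
Lemma walk_act i U w : i < n -> all (below i.+1) w -> exists p : seq (A * nat),
  [/\ walk edges U p (act phi w U), all (fun st => 1 < st.2 <= i) p &
      count (fun st => st.2 == i) p <= count (pred1 i) w].
Proof.
move=> hi; elim: w U => [|c w IH] U /=; first by exists [::]; split=> /=.
move=> /andP[hc /(IH (phi c U))[p [h1 h2 h3]]].
case: (phi c U =P U) h1 => [e|/eqP ne] h1.
  by exists p; rewrite e in h1 *; split=> //; apply: leq_trans h3 (leq_addl _ _).
exists ((phi c U, c) :: p); split=> /=; first by rewrite edge_phi.
  by rewrite h2 andbT.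
by rewrite leq_add2l.
Qed.

Lemma schur_coef_one m la : 3 <= m <= 6 -> is_partition la m ->
  exists2 e, size e = m.-1 & schur_coef la (canonical e) = 1.
Proof.
move=> hm hla.
(* The superstandard filling is the only one with content la. *)
pose e la := rev (behead (flatten [seq true :: nseq p.-1 false | p <- rev la])).
have chk : all (fun m => all (fun la => (size (e la) == m.-1) &&
  (schur_coef la (canonical (e la)) == 1)) (partitions m)) [:: 3; 4; 5; 6] by vm_compute.
have mm : m \in [:: 3; 4; 5; 6] by rewrite !inE; move: hm; clear; lia.
have /andP[/eqP h1 /eqP h2] := allP (allP chk m mm) la (mem_partitions hla).
by exists (e la); [exact: h1 | exact: h2].
Qed.

(* If two vertices of a class had the same image, every vertex would have a twin
   with the same descents, so all coefficients would differ from 1. *)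
Lemma schur_window_faithful k g : 5 <= k -> 1 < k < n -> realization Des phi k.+1 g ->
  window_faithful phi k g.
Proof.
move=> k5 hk hr X w hw eg; apply/eqP; case: eqP => // /eqP ne.
have [_ hdes hphi] := hr; have [Hgf _] := Hde.
have h1 : 1 < k - 3 by move: k5; clear; lia.
have hi : k - 3 <= k by apply: leq_subr.
have hkn : k < n by case/andP: hk.
have m6 : k - (k - 3) + 3 = 6 by move: k5; clear; lia.
have [|la [pla hla]] := Hgf (k - 3) k h1 hi hkn _ X; first by move: k5; clear; lia.
have m36 : 3 <= k - (k - 3) + 3 <= 6 by rewrite m6.
have [e se e1] := schur_coef_one m36 pla; rewrite m6 in se.
have := hla (canonical e); rewrite e1 canonical_ok ?m6 // => /(_ isT).
set C := deq_class _ _ _ _ => hsum.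
have hb v : all (fun c => k - 3 <= c <= k) v -> all (below k.+1) v.
  by apply: sub_all => c; rewrite /below; move: k5; clear; lia.
have real v Y : all (fun c => k - 3 <= c <= k) v -> g (act phi v Y) = act dd v (g Y).
  by move=> hv; apply: (real_act hr); apply: hb.
pose F V := fundQ_coef 6 (Des_hi Des (k - 3) k V) (canonical e).
have [V hV FV] : exists2 V, V \in C & 0 < F V.
  apply/exists_inP; rewrite -[[exists _ in _, _]]negbK negb_exists_in; apply/negP => /forall_inP h.
  by move: hsum; rewrite big1 // => V hV; apply/eqP; have := h V hV; rewrite -eqn0Ngt /F.
have [v [hv ev]] : exists v, all (fun c => k - 3 <= c <= k) v /\ act phi v X = V.
  by apply/(class_act _ _ _ hi).
pose V2 := act phi v (act phi w X).
have V2C : V2 \in C by apply/(class_act _ _ _ hi); exists (w ++ v); rewrite all_cat hw hv act_cat.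
have eg2 : g V2 = g V by rewrite /V2 -ev !(real v) // eg.
have nV : V2 != V.
  apply: contra ne => /eqP e2; apply/eqP.
  have inv c : k - 3 <= c <= k -> involutive (phi c).
    by move=> hc; apply: Hinv; move: hc k5 hkn; clear; lia.
  by rewrite -(act_rev (act phi w X) inv hv) -/V2 e2 -ev (act_rev _ inv hv).
have FE : F V2 = F V.
  rewrite /F; congr (nat_of_bool _); apply: eq_in_all => j; rewrite mem_iota => hj.
  congr (_ ==> _); rewrite /Des_hi; congr (_ && _).
  have hj' : 0 < j + (k - 3 - 2) < k.+1 by move: hj k5; clear; lia.
  by rewrite !hdes // eg2.
move: hsum; rewrite ?m6 (bigD1 V) //= (bigD1 V2) /=; last by rewrite V2C.
rewrite -/(F V) -/(F V2) FE; move: FV; clear; lia.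
Qed.
End GraphFromSchur.

(** * Schur expansion of the classes of tableaux *)

Section Monomials.

(** Being semistandard depends only on the relative order of the entries. The value [0] is included
    because [is_ssyt] reads missing entries as the default [0]. *)
Lemma schur_relabel la s (g : nat -> nat) : g 0 = 0 ->
  {in 0 :: s &, forall x y, (g x < g y) = (x < y)} ->
  schur_coef la (map g s) = schur_coef la s.
Proof.
move=> g0 mono; have inj : {in s &, injective g}.
  move=> x y hx hy e; have := mono x y; have := mono y x; rewrite !inE hx hy !orbT e ltnn.
  by move=> /(_ isT isT) h1 /(_ isT isT) h2; apply/eqP; rewrite eqn_leq leqNgt -h1 /= leqNgt -h2.
have p : perm_eq (permutations (map g s)) (map (map g) (permutations s)).
  apply: uniq_perm; first exact: permutations_uniq.
    rewrite map_inj_in_uniq ?permutations_uniq // => t u.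
    rewrite !mem_permutations => ht hu e.
    have sz : size t = size u by rewrite (perm_size ht) (perm_size hu).
    apply: (@eq_from_nth _ 0) => // j hj.
    have hj' : j < size u by rewrite -sz.
    apply: inj; [by rewrite -(perm_mem ht) mem_nth|by rewrite -(perm_mem hu) mem_nth|].
    by have := congr1 (nth 0 ^~ j) e; rewrite !(nth_map 0).
  move=> t; rewrite mem_permutations; apply/idP/mapP => [h|[u]].
    rewrite perm_sym in h; have [u [hu <-]] := perm_lift h.
    by exists u => //; rewrite mem_permutations.
  by rewrite mem_permutations => hu ->; apply: perm_map.
rewrite /schur_coef (permP p) count_map; apply: eq_in_count => t.
rewrite mem_permutations => ht /=; apply: eq_all => rc.
have val j : nth 0 (map g t) j = g (nth 0 t j).
  by case: (ltnP j (size t)) => hj; [rewrite (nth_map 0)|rewrite !nth_default ?size_map].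
have m j : nth 0 t j \in 0 :: s.
  case: (ltnP j (size t)) => hj; last by rewrite nth_default ?mem_head.
  by rewrite inE -(perm_mem ht) mem_nth ?orbT.
by rewrite !val mono // !(leqNgt (g _)) mono // -leqNgt.
Qed.

Lemma sorted_strict (s s' : seq nat) : size s = size s' -> sorted leq s -> sorted leq s' ->
  (forall j, j.+1 < size s -> (nth 0 s j < nth 0 s j.+1) = (nth 0 s' j < nth 0 s' j.+1)) ->
  forall p q, p < size s -> q < size s -> (nth 0 s p < nth 0 s q) = (nth 0 s' p < nth 0 s' q).
Proof.
move=> sz so so' h.
have mono u p q : sorted leq u -> p <= q -> q < size u -> nth 0 u p <= nth 0 u q.
  move=> su pq qs; apply: (sorted_leq_nth leq_trans leqnn 0 su) => //.
  by rewrite inE; apply: leq_ltn_trans pq qs.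
have up p d : p + d < size s -> (nth 0 s p < nth 0 s (p + d)) = (nth 0 s' p < nth 0 s' (p + d)).
  elim: d => [|d IH] hd; first by rewrite addn0 !ltnn.
  rewrite addnS in hd *; have hd' := ltnW hd.
  have a1 := mono s p (p + d) so (leq_addr _ _) hd'.
  have a2 := mono s (p + d) (p + d).+1 so (leqnSn _) hd.
  have b1 := mono s' p (p + d) so' (leq_addr _ _); have b2 := mono s' (p + d) (p + d).+1 so' (leqnSn _).
  rewrite -sz in b1 b2; have {}b1 := b1 hd'; have {}b2 := b2 hd.
  by move: (IH hd') (h _ hd) a1 a2 b1 b2; clear; lia.
move=> p q hp hq; case: (leqP p q) => pq; first by have := up p (q - p); rewrite subnKC //; apply.
have a := mono s q p so (ltnW pq) hp; rewrite sz in hp; have b := mono s' q p so' (ltnW pq) hp.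
by rewrite !ltnNge a b.
Qed.

Definition ascents (s : seq nat) := [seq nth 0 s j < nth 0 s j.+1 | j <- iota 0 (size s).-1].

Lemma nth_canonical e j : j < size e ->
  nth 0 (canonical e) j.+1 = nth 0 (canonical e) j + nth false e j.
Proof.
rewrite /canonical; move: 1 => x; elim: e j x => [|b e IH] [|j] x //= hj; exact: IH.
Qed.

Lemma canonicalP m s : monomial_ok m s -> 0 < m -> size (ascents s) = m.-1 /\
  (forall la, schur_coef la s = schur_coef la (canonical (ascents s))) /\
  (forall D, fundQ_coef m D s = fundQ_coef m D (canonical (ascents s))).
Proof.
move=> /and3P[/eqP sz so pos] m0.
have se : size (ascents s) = m.-1 by rewrite size_map size_iota sz.
have := canonical_ok se m0; set c := canonical _ => /and3P[/eqP sc sc' cpos].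
have step j : j.+1 < size s -> (nth 0 s j < nth 0 s j.+1) = (nth 0 c j < nth 0 c j.+1).
  move=> hj; have hj2 : j < (size s).-1 by move: hj; clear; lia.
  rewrite nth_canonical ?se -?sz // (nth_map 0) ?size_iota // nth_iota // add0n.
  by case: (nth 0 s j < _); rewrite ?addn0 ?addn1 ?ltnn ?ltnSn.
have szc : size s = size c by rewrite sz sc.
have cmp := sorted_strict szc so sc' step.
split=> //; split=> [la|D]; last first.
  congr (nat_of_bool _); apply: eq_in_all => j; rewrite mem_iota => hj.
  case: j hj => [|j] hj; first by move: hj; clear; lia.
  by rewrite /= step // sz; move: hj m0; clear; lia.
pose g x := nth 0 c (index x s).
have eg : map g s = c.
  apply: (@eq_from_nth _ 0); first by rewrite size_map.
  move=> j; rewrite size_map => hj; rewrite (nth_map 0) // /g.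
  have hi : index (nth 0 s j) s < size s by rewrite index_mem mem_nth.
  have e : nth 0 s (index (nth 0 s j) s) = nth 0 s j by rewrite nth_index ?mem_nth.
  have := cmp _ _ hi hj; have := cmp _ _ hj hi; rewrite e ltnn => h1 h2.
  by apply/eqP; rewrite eqn_leq leqNgt -h1 /= leqNgt -h2.
have n0 : 0 \notin s by apply/negP => /(allP pos).
(* The index of [0] is past the end of [c], so the default of [nth] applies. *)
have g0 : g 0 = 0 by rewrite /g nth_default // memNindex // szc.
rewrite -eg; apply/esym/schur_relabel => // x y.
have gpos z : z \in s -> (0 < g z) /\ (0 < z).
  move=> hz; split; last exact: (allP pos).
  by apply: (allP cpos); rewrite mem_nth // -szc index_mem.
rewrite !inE => /orP[/eqP ->|hx] /orP[/eqP ->|hy].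
- by rewrite g0.
- by have [h1 h2] := gpos y hy; rewrite g0 h1 h2.
- by rewrite g0 !ltn0.
by rewrite /g -cmp ?index_mem // !nth_index.
Qed.
End Monomials.

(* Numbering the entries of equal content makes the labels distinct, so that a
   window of a content vector becomes a permutation. *)
Section Labels.
Fixpoint label (t : seq int) : seq (int * nat) :=
  if t is a :: t' then (a, count_mem a t') :: label t' else [::].
Definition ltlab (x y : int * nat) := (x.1 < y.1)%R || (x.1 == y.1) && (x.2 < y.2).

Lemma map_label t : map fst (label t) = t.
Proof. by elim: t => //= a t ->. Qed.
Lemma size_label t : size (label t) = size t.
Proof. by rewrite -[in RHS](map_label t) size_map. Qed.
Lemma label_bound t x : x \in label t -> x.2 < count_mem x.1 t.
Proof.
elim: t => //= a t IH; rewrite inE => /orP[/eqP -> /=|/IH]; first by rewrite eqxx.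
by move=> h; apply: leq_trans h (leq_addl _ _).
Qed.
Lemma uniq_label t : uniq (label t).
Proof. by elim: t => //= a t ->; rewrite andbT; apply/negP => /label_bound; rewrite ltnn. Qed.

Lemma label3 a b c s : a <> b -> b <> c -> a <> c -> label [:: a, b, c & s] =
  [:: (a, count_mem a s), (b, count_mem b s), (c, count_mem c s) & label s].
Proof.
move=> /nesym/eqP/negbTE n1 /nesym/eqP/negbTE n2 /nesym/eqP/negbTE n3.
by rewrite /= n1 n2 n3.
Qed.
Lemma ltlab_neq a b i j : a <> b -> ltlab (a, i) (b, j) = (a < b)%R.
Proof. by move=> /eqP/negbTE n; rewrite /ltlab /= n orbF. Qed.

(** The three contents compared are distinct: the labels are ordered like the contents, and
    exchanging neighbours does not alter the numbering within a diagonal. *)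
Lemma label_dtop t : tableau t -> dtop ltlab (label t) = label (dtop lti t).
Proof.
case: t => [|z [|y [|x s]]] // h; have [n1 n2 n3] := tableau_neq3 h.
have [m1 m2 m3] : [/\ y <> z, x <> y & x <> z] by split; apply: nesym.
rewrite label3 // /dtop /btw !ltlab_neq //.
case: ifP => _; first by rewrite label3.
by case: ifP => _; rewrite label3.
Qed.
Lemma label_ded i t : tableau t -> ded ltlab i (label t) = label (ded lti i t).
Proof.
elim: t => //= a t IH /andP[h1 h2]; rewrite size_label; case: ifP => _.
  by rewrite -[_ :: _]/(label (a :: t)) label_dtop //= h1.
by rewrite IH //= (permP (perm_ded _ _ _)).
Qed.
Lemma label_desc j t : tableau t -> desc ltlab j (label t) = desc lti j t.
Proof.
elim: t => //= a t IH /andP[h1 h2]; rewrite size_label; case: ifP => _; last exact: IH.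
case: t h1 h2 {IH} => //= b t h1 h2; rewrite /ltlab /=.
have /eqP/negbTE -> : a <> b by apply: (@tableau_neq2 a b t); rewrite /= h1.
by rewrite orbF.
Qed.
End Labels.

Section Ranks.
Variable W : seq (int * nat).
Hypothesis uW : uniq W.
Definition rank x := count (fun y => ltlab y x) W.
Lemma ltlab_irr x : ltlab x x = false.
Proof. by rewrite /ltlab ltxx eqxx ltnn. Qed.
Lemma ltlab_trans x y z : ltlab x y -> ltlab y z -> ltlab x z.
Proof. rewrite /ltlab; lia. Qed.
Lemma ltlab_total x y : x != y -> ltlab x y || ltlab y x.
Proof. by case: x y => [a i] [b j]; rewrite /ltlab xpair_eqE /=; lia. Qed.
Lemma rank_lt x y : x \in W -> ltlab x y -> rank x < rank y.
Proof.
move=> hx hxy; rewrite /rank.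
have -> : count (ltlab^~ y) W = count (ltlab^~ x) W + count (fun z => ltlab z y && ~~ ltlab z x) W.
  elim: (W) => //= z V ->; case h : (ltlab z x); last by rewrite andbT addnCA.
  by rewrite (ltlab_trans h hxy) add0n addnA.
rewrite -[X in X < _]addn0 ltn_add2l -has_count; apply/hasP; exists x => //.
by rewrite hxy ltlab_irr.
Qed.
Lemma rank_mono : {in W &, forall x y, (rank x < rank y) = ltlab x y}.
Proof.
move=> x y hx hy; case h : (ltlab x y); first exact: rank_lt.
case: (x =P y) => [->|/eqP ne]; first by rewrite ltnn.
have := ltlab_total ne; rewrite h /= => /(rank_lt hy) h2.
by rewrite ltnNge ltnW.
Qed.
Lemma rank_inj : {in W &, injective rank}.
Proof.
move=> x y hx hy e; apply/eqP; apply: contraT => ne.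
by case/orP: (ltlab_total ne) => /rank_lt => [/(_ hx)|/(_ hy)]; rewrite e ltnn.
Qed.
Lemma rank_perm : perm_eq (map rank W) (iota 0 (size W)).
Proof.
have uR : uniq (map rank W) by rewrite map_inj_in_uniq //; exact: rank_inj.
apply: uniq_perm => //; first exact: iota_uniq.
have sub : {subset map rank W <= iota 0 (size W)}.
  move=> r /mapP[x hx ->]; rewrite mem_iota add0n /=.
  rewrite /rank -(count_predC (ltlab^~ x) W).
  rewrite -[X in X < _]addn0 ltn_add2l -has_count; apply/hasP; exists x => //=.
  by rewrite ltlab_irr.
by have [] := uniq_min_size uR sub; rewrite size_map size_iota.
Qed.
End Ranks.

(** * Dual Knuth classes of permutations of at most six letters *)

Section DualKnuthClasses.
Notation dn := (ded ltn).

Fixpoint explore (cs : seq nat) (fuel : nat) (seen todo : seq (seq nat)) :=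
  if fuel is f.+1 then
    if todo is x :: td then
      if x \in seen then explore cs f seen td
      else explore cs f (x :: seen) ([seq dn c x | c <- cs] ++ td)
    else seen
  else seen.
(** The fuel only has to be large enough for the check in [dual_classP], which tests that the result
    is closed under the colours. *)
Definition dual_class m p := explore (iota 2 (m - 2)) 100 [::] [:: p].
Definition perm_bits m p := [seq desc ltn j.+1 p | j <- iota 0 m.-1].

Lemma explore_sound cs f seen todo p :
  (forall x, x \in seen ++ todo -> exists w, all (mem cs) w /\ act dn w p = x) ->
  forall x, x \in explore cs f seen todo -> exists w, all (mem cs) w /\ act dn w p = x.
Proof.
elim: f seen todo => [|f IH] seen [|y td] H x /=; try by move=> hx; apply: H; rewrite mem_cat hx.
case: ifP => hy; apply: IH => z; rewrite mem_cat.
  by move=> hz; apply: H; rewrite mem_cat inE; case/orP: hz => ->; rewrite ?orbT.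
rewrite inE mem_cat -!orbA => /or4P[/eqP ->|hz|/mapP[c hc ->]|hz]; try by
  apply: H; rewrite mem_cat ?inE ?hz ?eqxx ?orbT.
have [|w [hw <-]] := H y; first by rewrite mem_cat mem_head orbT.
by exists (rcons w c); rewrite all_rcons act_rcons /= hc hw.
Qed.

Lemma dual_classP m p : 3 <= m <= 6 -> perm_eq p (iota 0 m) ->
  let c := dual_class m p in
  [/\ uniq c, p \in c, forall x j, x \in c -> j \in iota 2 (m - 2) -> dn j x \in c &
   exists2 la, la \in partitions m & forall e, size e = m.-1 ->
     schur_coef la (canonical e) = count (fun x => subbits (perm_bits m x) e) c].
Proof.
move=> hm hp c.
have chk : all (fun m =>
   let tabs := [seq [seq schur_coef la (canonical e) | e <- bits m.-1] | la <- partitions m] in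
   all (fun p => let c := dual_class m p in
     [&& uniq c, p \in c, all (fun x => all (fun j => dn j x \in c) (iota 2 (m - 2))) c &
       let D := map (perm_bits m) c in
       [seq count (fun d => subbits d e) D | e <- bits m.-1] \in tabs])
   (permutations (iota 0 m))) [:: 3; 4; 5; 6] by vm_compute.
have mm : m \in [:: 3; 4; 5; 6] by rewrite !inE; move: hm; clear; lia.
have hp' : p \in permutations (iota 0 m) by rewrite mem_permutations.
have := allP (allP chk m mm) p hp'; rewrite -/c => /and4P[h1 h2 /allP h3 h4].
split; [exact: h1|exact: h2|by move=> x j hx; apply: (allP (h3 x hx))|].
move/mapP: h4 => [la hla /eq_in_map h]; exists la; first exact: hla.
by move=> e /mem_bits he; rewrite -(h e he) count_map.
Qed.
End DualKnuthClasses.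

Lemma dual_class_sound m p x : x \in dual_class m p ->
  exists w, all (mem (iota 2 (m - 2))) w /\ act (ded ltn) w p = x.
Proof.
by apply: explore_sound => y; rewrite inE => /eqP ->; exists [::].
Qed.

Lemma take_drop_cat3 (S : Type) p m (a b c : seq S) : size a = p -> size b = m ->
  let s := a ++ (b ++ c) in
  [/\ take p s = a, drop m (drop p s) = c & take m (drop p s) = b].
Proof. by move=> <- <- /=; rewrite take_size_cat // drop_size_cat // take_size_cat // drop_size_cat. Qed.

(** * Classes of at most four colours as dual Knuth classes *)

Section SchurFromRealization.
Variables (A : finType) (n : nat) (Des : A -> pred nat) (phi : nat -> A -> A).
Variables (f : A -> seq int) (h i : nat) (T : A).
Hypotheses (hr : realization Des phi n f) (hf : faithful phi n f).
Hypotheses (h1 : 1 < h) (hi : h <= i) (hin : i < n) (hi3 : i - h <= 3).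
Hypothesis inv : forall c, below n c -> involutive (phi c).
Let m := i - h + 3.
Let p := n - i.+1.
Let L V := label (f V).
(** The window holds the entries [h - 1, ..., i + 1], preceded by the [p] larger ones and followed
    by the [h - 2] smaller ones; colour [c] acts on it as colour [c - (h - 2)]. *)
Definition win V := take m (drop p (L V)).
Definition pre V := take p (L V).
Definition suf V := drop m (drop p (L V)).
Let C := deq_class phi h i T.
(** Ranks are taken in the window of [T] throughout: all windows of the class contain the same
    labels. *)
Definition rank_word V := map (rank (win T)) (win V).
Notation r := rank_word.

Let tabf V : tableau (f V). Proof. by case: hr => /(_ V)[]. Qed.
Let sizL V : size (L V) = n. Proof. by rewrite size_label; case: hr => /(_ V)[]. Qed.
Lemma win_cat V : L V = pre V ++ (win V ++ suf V).
Proof. by rewrite !cat_take_drop. Qed.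
Lemma size_win V : size (win V) = m.
Proof. by rewrite size_takel // size_drop sizL /m /p; move: h1 hi hin; clear; lia. Qed.
Lemma size_suf V : size (suf V) = h - 2.
Proof. by rewrite !size_drop sizL /m /p; move: h1 hi hin; clear; lia. Qed.
Lemma size_pre V : size (pre V) = p.
Proof. by rewrite size_takel // sizL /p leq_subr. Qed.

Lemma win_phi V c : h <= c <= i -> [/\ pre (phi c V) = pre V, suf (phi c V) = suf V &
  win (phi c V) = ded ltlab (c - (h - 2)) (win V)].
Proof.
move=> hc; have hcn : below n c by rewrite /below; move: hc h1 hin; clear; lia.
have e : L (phi c V) = pre V ++ (ded ltlab (c - (h - 2)) (win V) ++ suf V).
  have [_ _ hphi] := hr; rewrite /L hphi // -label_ded // -/(L V) win_cat ded_catl; last first.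
    by rewrite size_cat size_win size_suf /m; move: hc h1; clear; lia.
  congr (_ ++ _); rewrite -ded_catr ?size_suf; last by move: hc h1; clear; lia.
  by rewrite subnK //; move: hc h1; clear; lia.
have sw : size (ded ltlab (c - (h - 2)) (win V)) = m by rewrite size_ded size_win.
have := take_drop_cat3 (suf V) (size_pre V) sw; rewrite -e => -[e1 e2 e3].
by split; [exact: e1|exact: e2|exact: e3].
Qed.

Lemma class_word V : V \in C <-> exists w, all (fun c => h <= c <= i) w /\ act phi w T = V.
Proof. exact: class_act. Qed.

Lemma class_win V : V \in C -> [/\ pre V = pre T, suf V = suf T & perm_eq (win V) (win T)].
Proof.
move=> /class_word[w [hw <-]]; elim/last_ind: w hw => [|w c IH] //.
rewrite all_rcons act_rcons => /andP[hc /IH[e1 e2 e3]].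
have [-> -> ->] := win_phi (act phi w T) hc; split=> //.
exact: perm_trans (perm_ded _ _ _) e3.
Qed.

Lemma uniq_win V : uniq (win V).
Proof. by rewrite take_uniq // drop_uniq // uniq_label. Qed.

Lemma rank_word_mono V : V \in C ->
  {in win V &, forall x y, (rank (win T) x < rank (win T) y) = ltlab x y}.
Proof.
case/class_win => _ _ e x y; rewrite !(perm_mem e) => hx hy.
exact: (rank_mono (uniq_win T) hx hy).
Qed.

Lemma rank_word_phi V c : V \in C -> h <= c <= i ->
  r (phi c V) = ded ltn (c - (h - 2)) (r V).
Proof.
move=> hV hc; rewrite /r; have [_ _ ->] := win_phi V hc.
by rewrite (ded_map _ (rank_word_mono hV)).
Qed.

Lemma rank_word_bits V : V \in C -> window_bits Des h m V = perm_bits m (r V).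
Proof.
move=> hV; apply/eq_in_map => j; rewrite mem_iota => hj.
have [_ hdes _] := hr.
have hn : 0 < h.-1 + j < n by move: hj h1 hi hin; rewrite /m; clear; lia.
rewrite hdes // -label_desc // -/(L V) win_cat desc_catl; last first.
  by rewrite size_cat size_win size_suf; move: hj h1 hi; rewrite /m; clear; lia.
have -> : h.-1 + j = j.+1 + size (suf V) by rewrite size_suf; move: h1; clear; lia.
rewrite desc_catr //; last by rewrite size_win; move: hj; rewrite /m; clear; lia.
by rewrite (desc_map _ (rank_word_mono hV)).
Qed.

(** The parts outside the window are constant on the class, so the rank word determines the whole
    filling, and faithfulness determines the vertex. *)
Lemma rank_word_inj : {in C &, injective r}.
Proof.
move=> V V' hV hV' e; have [p1 s1 w1] := class_win hV; have [p2 s2 w2] := class_win hV'.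
have ew : win V = win V'.
  have sz : size (win V) = size (win V') by rewrite !size_win.
  have hm x j : perm_eq (win x) (win T) -> j < size (win x) -> nth (0%R, 0) (win x) j \in win T.
    by move=> px hj; rewrite -(perm_mem px) mem_nth.
  apply: (@eq_from_nth _ (0%R, 0)) => // j hj; have hj' := hj; rewrite sz in hj'.
  apply: (rank_inj (uniq_win T) (hm _ _ w1 hj) (hm _ _ w2 hj')).
  have := congr1 (nth 0 ^~ j) e; rewrite /r.
  by rewrite (nth_map (0%R, 0)) // (nth_map (0%R, 0)).
have eL : L V = L V' by rewrite !win_cat p1 p2 s1 s2 ew.
apply: hf; last by rewrite -(map_label (f V)) -/(L V) eL map_label.
have lk U : U \in C -> exists w, all (below n) w /\ act phi w T = U.
  move=> /class_word[w [hw <-]]; exists w; split=> //; apply: sub_all hw => c.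
  by rewrite /below; move: h1 hin; clear; lia.
have [w [hw <-]] := lk V hV; have [w' [hw' <-]] := lk V' hV'.
exists (rev w ++ w'); rewrite all_cat all_rev hw hw'; split=> //.
by rewrite act_cat (act_rev _ inv hw).
Qed.

Lemma rank_word_class : perm_eq [seq r V | V <- enum C] (dual_class m (r T)).
Proof.
have hm : 3 <= m <= 6 by rewrite /m; move: hi3; clear; lia.
have hp : perm_eq (r T) (iota 0 m) by rewrite -(size_win T); apply: rank_perm; apply: uniq_win.
have [uc pc cl _] := dual_classP hm hp.
apply: uniq_perm => //.
  by rewrite map_inj_in_uniq ?enum_uniq // => V V'; rewrite !mem_enum; apply: rank_word_inj.
move=> x; apply/mapP/idP => [[V]|hx].
  rewrite mem_enum => hV ->; have [w [hw <-]] := (class_word V).1 hV.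
  elim/last_ind: w hw {hV} => [|w c IH] //; rewrite all_rcons act_rcons => /andP[hc hw].
  have hV : act phi w T \in C by apply/class_word; exists w.
  rewrite rank_word_phi //; apply: cl; first exact: IH.
  by rewrite mem_iota /m; move: hc h1 hi; clear; lia.
have [w [hw <-]] := dual_class_sound hx.
exists (act phi (map (addn (h - 2)) w) T).
  rewrite mem_enum; apply/class_word; exists (map (addn (h - 2)) w); split=> //.
  rewrite all_map; apply: sub_all hw => c; rewrite -[mem _ _]/(c \in iota 2 (m - 2)) mem_iota /=.
  by rewrite /m; move: h1 hi; clear; lia.
elim/last_ind: w hw {hx} => [|w c IH] //; rewrite all_rcons map_rcons !act_rcons => /andP[hc hw].
have hc' : 2 <= c < m by move: hc; rewrite -[mem _ _]/(c \in iota 2 (m - 2)) mem_iota /m; clear; lia.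
have hw' : all (fun c => h <= c <= i) (map (addn (h - 2)) w).
  rewrite all_map; apply: sub_all hw => d; rewrite -[mem _ _]/(d \in iota 2 (m - 2)) mem_iota /=.
  by rewrite /m; move: h1 hi; clear; lia.
rewrite (IH hw) rank_word_phi; first by rewrite addKn.
  by apply/class_word; exists (map (addn (h - 2)) w).
by move: hc'; rewrite /m; move: h1 hi; clear; lia.
Qed.

Lemma window_schur : exists la : seq nat, is_partition la m /\ forall s, monomial_ok m s ->
  \sum_(U in C) fundQ_coef m (Des_hi Des h i U) s = schur_coef la s.
Proof.
have hm : 3 <= m <= 6 by rewrite /m; move: hi3; clear; lia.
have m0 : 0 < m by move: hm; clear; lia.
have hp : perm_eq (r T) (iota 0 m) by rewrite -(size_win T); apply: rank_perm; apply: uniq_win.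
have [_ _ _ [la hla ela]] := dual_classP hm hp.
exists la; split.
  have chk : all (fun m => all (is_partition^~ m) (partitions m)) [:: 3; 4; 5; 6] by vm_compute.
  by apply: (allP (allP chk m _) la hla); rewrite !inE; move: hm; clear; lia.
move=> s hs; have [se [sch fq]] := canonicalP hs m0.
rewrite sch ela //.
rewrite (eq_bigr (fun U => subbits (window_bits Des h m U) (ascents s) : nat)); last first.
  by move=> U _; rewrite fundQ_window // fq fundQ_canonical // size_window_bits.
rewrite sum_count -(permP rank_word_class) count_map; apply: eq_in_count => U.
by rewrite mem_enum => hU /=; rewrite rank_word_bits.
Qed.
End SchurFromRealization.

(** * The two implications *)

Lemma graph_of_dual_equivalence (A : finType) (n : nat) (Des : A -> pred nat)
    (phi : nat -> A -> A) (Hinv : forall i, 1 < i < n -> involutive (phi i)) :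
  dual_equivalence n Des phi -> dual_equivalence_graph n n (sign Des) (edges phi).
Proof.
move=> Hde; have loc := schur_local Hinv Hde.
have short i : 1 < i < n -> short_paths phi i.
  move=> hi; have hn : i.+1 <= n by case/andP: hi.
  have [|f [hr hf]] := faithful_realization loc hn; last exact: short_of_faithful hi hr hf.
  by move=> k hk; right=> k5 g hr; exact: (schur_window_faithful Hinv Hde k5 hk hr).
have nb w i x : 1 < i < n -> [set w; x] \in edges phi i -> phi i w = x /\ phi i w != w.
  move=> hi; rewrite (mem_edges Hinv) // => /andP[/eqP <- m]; split=> //.
  by rewrite eq_sym.
split=> //; split.
  split=> [w j _|i hi e]; first by rewrite /sign; case: ifP; auto.
  by move=> /imsetP[T]; rewrite inE => m ->; rewrite cards2 eq_sym m.
split.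
  move=> w i hi; split=> [|x y /(nb _ _ _ hi)[<- _] /(nb _ _ _ hi)[<- _] //].
  split=> [/sign_opp m|[x /(nb _ _ _ hi)[_ m]]].
    by exists (phi i w); apply: edge_phi; rewrite (loc_move loc).
  by apply/sign_opp; rewrite -(loc_move loc).
split.
  move=> w x i hi /(nb _ _ _ hi)[<- m]; have [f1 f2] := loc_flip loc hi m.
  split; first by apply/sign_opp; rewrite f1; case: (Des w i.-1).
  split; first by apply/sign_opp; rewrite f2; case: (Des w i).
  by move=> h hh hd; apply/sign_eq/esym/(loc_far loc).
split.
  move=> w x i hi /(nb _ _ _ hi)[<- m]; split=> [i2 /sign_opp hd|hn /sign_opp hd]; apply/sign_opp.
    (* For axiom 3, [loc_down] shows that [phi i.-1] moves [w] as well, so the descents at [i.-2]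
       and [i.-1] differ; the other half uses [loc_up]. *)
    have hi2 : 2 < i < n by move: i2 hi; clear; lia.
    have hi1 : 1 < i.-1 < n by move: i2 hi; clear; lia.
    by rewrite -[i.-2]/(i.-1.-1) -(loc_move loc) // (loc_down loc hi2) // eq_sym.
  have i1 : 1 < i by case/andP: hi.
  have hi1 : 1 < i.+1 < n by rewrite hn ltnW.
  by rewrite eq_sym -[i in Des w i]/(i.+1.-1) -(loc_move loc) // (loc_up loc i1 hn) // eq_sym.
split; first by move=> i hi w; apply: schur_shape2 Hinv Hde _ _ hi.
split; first by move=> i hi w; apply: schur_shape3 Hinv Hde _ _ hi.
split.
  move=> i j w x y hi hj hij /(nb _ _ _ hi)[<- m] /(nb _ _ _ hj)[<- m'].
  have comm V : phi j (phi i V) = phi i (phi j V).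
    by case/orP: hij => h; [rewrite (loc_comm loc V hi hj h)|rewrite (loc_comm loc V hj hi h)].
  have mj : phi j w != w.
    by apply: contra m' => /eqP e; rewrite comm e.
  exists (phi j w); split; first exact: edge_phi.
  rewrite comm; apply: edge_phi; rewrite -comm.
  by rewrite (inj_eq (can_inj (Hinv j hj))).
move=> i hi u v; have hin : i < n by case/andP: hi.
have hcs : all (fun c => 1 < c < n) (iota 2 i.-1).
  by apply/allP => c; rewrite mem_iota; move: hi; clear; lia.
rewrite (comp_connect Hinv) // => /connect_act[w [hw ew]].
have lk : linked phi i.+1 u v.
  exists w; split=> //; apply: sub_all hw => c; rewrite -[mem _ _]/(c \in iota 2 i.-1) mem_iota.
  by rewrite /below; move: hi; clear; lia.
have count0 w' : all (below i) w' -> count (pred1 i) w' = 0.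
  move=> hw'; apply/eqP; rewrite -leqn0 leqNgt -has_count; apply/hasPn => c /(allP hw').
  by rewrite /below /=; clear; lia.
suff [w' [hw' ew' cw']] : exists w', [/\ all (below i.+1) w', act phi w' u = v &
    count (pred1 i) w' <= 1].
  have [p [h1 h2 h3]] := walk_act phi u hin hw'; exists p; rewrite -ew'; split=> //; split=> //.
  exact: leq_trans h3 cw'.
case: (short i hi u v lk) => [[w1 [hw1 e1]]|[W [[w1 [hw1 e1]] [w2 [hw2 e2]]]]].
  by exists w1; rewrite count0 //; split=> //; apply: sub_below hw1.
exists (w1 ++ i :: w2); rewrite count_cat /= !count0 // eqxx act_cat e1 act_cons e2; split=> //.
rewrite all_cat /= (sub_below _ hw1) // (sub_below _ hw2) // /below ltnSn; by case/andP: hi => ->.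
Qed.

Lemma dual_equivalence_of_graph (A : finType) (n : nat) (Des : A -> pred nat)
    (phi : nat -> A -> A) (Hinv : forall i, 1 < i < n -> involutive (phi i)) :
  dual_equivalence_graph n n (sign Des) (edges phi) -> dual_equivalence n Des phi.
Proof.
move=> Hg; have loc := graph_local Hinv Hg.
have [|f [hr hf]] := faithful_realization loc (leqnn n).
  (* Axiom 6 supplies the short paths directly, so the windows are not consulted. *)
  by move=> k hk; left; apply: graph_short_paths Hinv Hg _ hk.
split=> [h i h1 hi hin hi3 T|i j hi hj /orP[] hij T].
- by apply: window_schur hr hf h1 hi hin hi3 _ => c; apply: Hinv.
- exact: (loc_comm loc T hi hj hij).
- exact/esym/(loc_comm loc T hj hi hij).
Qed.

Theorem theorem4p2 (A : finType) (n : nat) (Des : A -> pred nat)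
    (phi : nat -> A -> A)
    (HDes : forall (T : A) (d : nat), Des T d -> 0 < d < n)
    (Hinv : forall i, 1 < i < n -> involutive (phi i)) :
  dual_equivalence n Des phi <->
  dual_equivalence_graph n n
    (fun (T : A) (i : nat) => if Des T i then (-1)%R else 1%R : int)
    (fun i => [set [set T; phi i T] | T : A & phi i T != T]).
Proof.
split; first exact: graph_of_dual_equivalence.
exact: dual_equivalence_of_graph.
Qed.
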